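(* Let $\mathbf{H}$ be a right $\mathcal{C}$-invariant Hilbert space included in $\mathbf{H}_2(\mathcal{T})$. Assume that for some $j$, $1\le j\le q$, there exists a bounded linear operator $$V_j=\begin{pmatrix}A_j&B_j\\ C&D\end{pmatrix}:\begin{pmatrix}\mathbf{H}\\ \mathcal{C}_2\end{pmatrix}\longrightarrow\begin{pmatrix}\mathbf{H}\\ \mathcal{C}_2\end{pmatrix}$$ such that for every $F\in\mathbf{H}$, $c\in\mathcal{C}$, $d\in\mathcal{C}_2$ $$A_j(Fc)=(A_jF)\alpha_j^*c\,\alpha_j,\quad B_j(dc)=(B_jd)\alpha_j^*c\,\alpha_j,\quad C(Fc)=(CF)c,\quad D(dc)=(Dd)c,$$ and $$V_jV_j^*=\begin{pmatrix}\hat M_{\alpha_j^*\alpha_j}&0\\ 0&I\end{pmatrix}.$$ Then: (I) The series $S=\sum_{w\in\mathcal{F}_q}w^*S_{[w]}$, where the coefficients $S_{[w]}\in\mathcal{C}$ are determined by $$\forall d\in\mathcal{C}_2:\quad S_{[w]}d=\begin{cases}Dd,& w=\emptyset,\\ w\,(CA_j^{n-1}B_jd)\,\alpha_j^{n*},& |w|=n\ge1,\end{cases}$$ defines (in the sense of pointwise absolute convergence) a Schur multiplier $S\in\mathbf{H}(\mathcal{T})$. (II) The series $$E_cF=\sum_{n=0}^\infty(c\alpha)^n\cdot(CA_j^nF)\cdot\alpha_j^{n*},\qquad F\in\mathbf{H},\ c\in\mathbb{B}(\mathcal{T}),$$ converges absolutely in $\mathcal{C}_2$ and defines a bounded linear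 operator $E_c$ from $\mathbf{H}$ to $\mathcal{C}_2$. This operator $E_c$ and the kernel $K_S^d:=(I-S\,S^\wedge(d)^* )K_\wedge^d$ satisfy $$(K_S^d)^\wedge(c)\,k=E_cE_d^*k\qquad\text{for all }c,d\in\mathbb{B}(\mathcal{T}),\ k\in\mathcal{C}_2.$$ (III) If the operators $A_j$ and $C$ are given by $A_jF=(F-F^\wedge(0))\alpha_j$ and $CF=F^\wedge(0)$ for $F\in\mathbf{H}$, then $\mathbf{H}$ is the de Branges–Rovnyak space associated with the Schur multiplier $S$: $\mathbf{H}=\mathbf{H}(S)$.
   Context: Tree setting. Let $q\ge 1$ be an integer and $\mathcal{T}$ a homogeneous tree of order $q$, i.e. an acyclic, undirected, connected graph such that every node belongs to exactly $q+1$ edges. An infinite path from $t$ is a sequence of nodes $(t_0=t,t_1,t_2,\dots)$ with consecutive nodes joined by an edge and $t_{k+1}\neq t_k\neq t_{k+2}$ for all $k$. Two infinite paths $(t_k),(s_k)$ are equivalent if there are $m,n\ge 0$ with $t_{m+k}=s_{n+k}$ for all $k\ge 0$; equivalence classes are boundary points. Fix a boundary point $\infty_{\mathcal{T}}$; each node $t$ has a unique representative path of $\infty_{\mathcal{T}}$ starting at $t$. For nodes $t,s$ with representative paths $(t_k),(s_k)$ of $\infty_{\mathcal{T}}$, take the minimal $m,n$ with $t_{m+k}=s_{n+k}$ for all $k\ge0$, and set $s\wedge t:=t_m=s_n$, $\operatorname{dist}(s,t):=m+n$. Write $s\preceq t$ if $\operatorname{dist}(s,s\wedge t)\le\operatorname{dist}(t,s\wedge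 t)$ and $s\asymp t$ if equality holds. Fix maps (primitive shifts) $\alpha_1,\dots,\alpha_q:\mathcal{T}\to\mathcal{T}$, acting on the right, with $\{t\alpha_1,\dots,t\alpha_q\}=\{s: t\preceq s,\ \operatorname{dist}(t,s)=1\}$ for every $t$. Let $\mathcal{F}_q$ be the free semigroup with unit $\emptyset$ generated by $\alpha_1,\dots,\alpha_q$; $|\emptyset|=0$, $|\alpha_{i_1}\cdots\alpha_{i_n}|=n$; $w\in\mathcal{F}_q$ acts on nodes by $t\mapsto tw$. Operators. $\ell_2(\mathcal{T})$ is the Hilbert space of square-summable functions $f:\mathcal{T}\to\mathbb{C}$ with standard basis $\chi_t$; $\mathbf{X}(\mathcal{T})$ is the algebra of bounded linear operators on it, with operator norm $\|\cdot\|$. Each $w\in\mathcal{F}_q$ is also regarded as the operator $(wf)(t)=f(tw)$ in $\mathbf{X}(\mathcal{T})$, with adjoint $w^*$; $\alpha_j^{n*}:=(\alpha_j^n)^*$. $S\in\mathbf{X}(\mathcal{T})$ is causal if for every node $s$ and $f\in\ell_2(\mathcal{T})$ with $f(t)=0$ for all $t\preceq s$, one has $(Sf)(t)=0$ for all $t\preceq s$. $\mathbf{H}(\mathcal{T})$ is the algebra of causal operators and $\mathcal{C}=\{S\in\mathbf{X}(\mathcal{T}): S,S^*\in\mathbf{H}(\mathcal{T})\}$ is the algebra of constants. Each $S\in\mathbf{H}(\mathcal{T})$ has coefficients $S_{[w]}\in\mathcal{C}$ ($w\in\mathcal{F}_q$) given by $(S_{[w]}\chi_t)(s)=(S\chi_t)(sw)$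 if $t\asymp s$ and $0$ otherwise, and $S=\sum_{w\in\mathcal{F}_q}w^*S_{[w]}$ pointwise absolutely (for every $f,t$ the series evaluated at $f$ and $t$ converges absolutely to $(Sf)(t)$). Point evaluation. Let $\alpha$ be the column of operators $\alpha_1,\dots,\alpha_q$. For a row $c=(c_1\ \dots\ c_q)\in\mathcal{C}^q$ put $c\alpha=\sum_j c_j\alpha_j$ and $\alpha^*c^*=(c\alpha)^*=\sum_j\alpha_j^*c_j^*$. Set $\mathbb{B}(\mathcal{T})=\{c\in\mathcal{C}^q:\lim_{n\to\infty}\|(c\alpha)^n\|^{1/n}<1\}$. For $S\in\mathbf{H}(\mathcal{T})$ and $c\in\mathbb{B}(\mathcal{T})$, $S^\wedge(c):=\sum_{n=0}^\infty(c\alpha)^n\big(\sum_{|w|=n}w^*S_{[w]}\big)$, which converges absolutely in operator norm to an element of $\mathcal{C}$; in particular $S^\wedge(0)=S_{[\emptyset]}$. For $d\in\mathbb{B}(\mathcal{T})$, $K_\wedge^d:=(I-\alpha^*d^* )^{-1}\in\mathbf{H}(\mathcal{T})$. Hilbert–Schmidt spaces. $\mathbf{H}_2(\mathcal{T})=\{F\in\mathbf{H}(\mathcal{T}):\|F\|_2^2:=\operatorname{trace}(F^*F)<\infty\}$ with $\langle F,G\rangle_2=\operatorname{trace}(G^*F)$, a Hilbert space; $\mathcal{C}_2=\mathcal{C}\cap\mathbf{H}_2(\mathcal{T})$, a closed subspace. For $S\in\mathbf{H}(\mathcal{T})$, $M_S$ is the operator $F\mapsto SF$ on $\mathbf{H}_2(\mathcal{T})$.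 $\hat M_Q$ denotes right multiplication $F\mapsto FQ$; above, $\hat M_{\alpha_j^*\alpha_j}$ acts on $\mathbf{H}$ (note $\alpha_j^*\alpha_j\in\mathcal{C}$). A Hilbert space $\mathbf{H}$ of elements of $\mathbf{H}_2(\mathcal{T})$ is right $\mathcal{C}$-invariant if for all $F,G\in\mathbf{H}$, $c\in\mathcal{C}$: $Fc\in\mathbf{H}$, $\|Fc\|_{\mathbf{H}}\le\|F\|_{\mathbf{H}}\|c\|$ and $\langle Fc,G\rangle_{\mathbf{H}}=\langle F,Gc^*\rangle_{\mathbf{H}}$. Schur multipliers. A Schur multiplier is $S\in\mathbf{H}(\mathcal{T})$ with $\|S\|\le1$. With $\mathcal{B}_S=I-M_SM_S^*$ on $\mathbf{H}_2(\mathcal{T})$ and $\pi_S$ the orthogonal projection of $\mathbf{H}_2(\mathcal{T})$ onto $\ker\mathcal{B}_S$, the de Branges–Rovnyak space associated with $S$ is the Hilbert space $\mathbf{H}(S)=\sqrt{\mathcal{B}_S}\,\mathbf{H}_2(\mathcal{T})$ with norm $\|\sqrt{\mathcal{B}_S}F\|_{\mathbf{H}(S)}=\|(I-\pi_S)F\|_2$. Direct sums are Hilbert space orthogonal sums; the equality $\mathbf{H}=\mathbf{H}(S)$ is equality of Hilbert spaces. *)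

(* Defs.v *)
From HB Require Import structures.
From mathcomp Require Import all_boot all_order all_algebra.
From mathcomp Require Import all_classical all_reals all_analysis.
From mathcomp Require Import complex ring lra.

Set Implicit Arguments.
Unset Strict Implicit.
Unset Printing Implicit Defensive.

Import Order.TTheory GRing.Theory Num.Theory.
Import numFieldNormedType.Exports.
Import ComplexField.Normc.

Local Open Scope classical_set_scope.
Local Open Scope ring_scope.
Local Open Scope complex_scope.

Section InfiniteSums.
Variables (R : realType) (I : choiceType).

Definition abs_summable (a : I -> R[i]) : Prop :=
  (\esum_(k in [set: I]) (normc (a k))%:E < +oo)%E.

(* unconditional convergence: the finite partial sums converge to [l] along the
   directed set of finite subsets of [I] *)
Definition has_sum (a : I -> R[i]) (l : R[i]) : Prop :=
  forall e : R, 0 < e ->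
    exists2 A : set I, finite_set A &
      forall B : set I, finite_set B -> A `<=` B ->
        normc ((\sum_(k \in B) a k) - l) < e.

Definition csum (a : I -> R[i]) : R[i] := xget 0 [set l | has_sum a l].

End InfiniteSums.

(* A Hilbert space is a subset of an ambient complex vector space together with
   an inner product, which is relevant on that subset only. *)
Record preHilbert (R : realType) (V : lmodType R[i]) := PreHilbert {
  hset : set V;
  hdot : V -> V -> R[i]
}.

Section HilbertSpaces.
Variables (R : realType) (V : lmodType R[i]).
Implicit Types H : preHilbert V.

Definition hnorm H (x : V) : R := Num.sqrt (complex.Re (hdot H x x)).

Definition cvg_in H (u : nat -> V) (l : V) : Prop :=
  hnorm H (u n - l) @[n --> \oo] --> (0 : R).

Definition cauchy_in H (u : nat -> V) : Prop :=
  forall e : R, 0 < e -> exists N : nat, forall m n : nat,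
    (N <= m)%N -> (N <= n)%N -> hnorm H (u m - u n) < e.

Definition is_hilbert H : Prop :=
  [/\ hset H 0 /\
      (forall (a : R[i]) x y, hset H x -> hset H y -> hset H (a *: x + y)),
      forall (a : R[i]) x y z, hset H x -> hset H y -> hset H z ->
        hdot H (a *: x + y) z = a * hdot H x z + hdot H y z,
      forall x y, hset H x -> hset H y -> hdot H y x = conjc (hdot H x y),
      forall x, hset H x -> 0 <= hdot H x x /\ (hdot H x x = 0 -> x = 0)
    & forall u : nat -> V, (forall n, hset H (u n)) -> cauchy_in H u ->
        exists2 l, hset H l & cvg_in H u l].

End HilbertSpaces.

Section Operators.
Variables (R : realType) (V W : lmodType R[i]).
Implicit Types (H : preHilbert V) (K : preHilbert W) (A : V -> W).

Definition bounded_linear H K A : Prop :=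
  [/\ forall x, hset H x -> hset K (A x),
      forall (a : R[i]) x y, hset H x -> hset H y ->
        A (a *: x + y) = a *: A x + A y
    & exists M : R, forall x, hset H x -> hnorm K (A x) <= M * hnorm H x].

Definition opnorm H K A : R :=
  sup [set hnorm K (A x) | x in [set x | hset H x /\ hnorm H x <= 1]].

End Operators.

Section Adjoint.
Variables (R : realType) (V W : lmodType R[i]).
Implicit Types (H : preHilbert V) (K : preHilbert W) (A : V -> W) (B : W -> V).

Definition is_adjoint H K A B : Prop :=
  bounded_linear K H B /\
  forall x y, hset H x -> hset K y -> hdot K (A x) y = hdot H x (B y).

(* When H and K are Hilbert spaces and A is bounded, the adjoint exists and its
   restriction to [hset K], the only relevant part, is unique. *)
Definition adjoint H K A : W -> V :=
  xget (fun=> 0) [set B | is_adjoint H K A B].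

End Adjoint.

Section MoreHilbert.
Variables (R : realType) (V W : lmodType R[i]).

Definition dsum (H : preHilbert V) (K : preHilbert W) :
    preHilbert (V * W)%type :=
  PreHilbert [set p : V * W | hset H p.1 /\ hset K p.2]
             (fun p r => hdot H p.1 r.1 + hdot K p.2 r.2).

Definition block (A : V -> V) (B : W -> V) (C : V -> W) (D : W -> W) :
    V * W -> V * W :=
  fun p => (A p.1 + B p.2, C p.1 + D p.2).

(* the series of the [u n] converges absolutely in [H], with sum [l] *)
Definition abs_series_in (H : preHilbert V) (u : nat -> V) (l : V) : Prop :=
  [/\ forall n, hset H (u n),
      (\sum_(0 <= n <oo) (hnorm H (u n))%:E < +oo)%E,
      hset H l
    & cvg_in H (fun N => \sum_(n < N) u n) l].

Definition orthoproj (H : preHilbert V) (K : set V) (x : V) : V :=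
  xget 0 [set p | K p /\ forall y, K y -> hdot H (x - p) y = 0].

(* the positive square root of a positive bounded operator *)
Definition sqrtop (H : preHilbert V) (B : V -> V) : V -> V :=
  xget (fun=> 0) [set P | [/\ bounded_linear H H P,
    forall x, hset H x -> 0 <= hdot H (P x) x
  & forall x, hset H x -> P (P x) = B x]].

End MoreHilbert.

Section Trees.
Variables (T : choiceType).

Definition homogeneous_tree (q : nat) (edge : rel T) : Prop :=
  [/\ symmetric edge /\ irreflexive edge,
      forall s t, exists2 p, path edge s p & last s p = t,
      forall p, (2 < size p)%N -> ~ ucycle edge p
    & forall t, ([set s | edge t s] #= `I_q.+1)%card].

Definition infinite_path (edge : rel T) (x : nat -> T) : Prop :=
  forall k, [/\ edge (x k) (x k.+1), x k.+1 <> x k & x k <> x k.+2].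

Definition path_equiv (x y : nat -> T) : Prop :=
  exists m n, forall k, x (m + k)%N = y (n + k)%N.

Definition boundary_point (edge : rel T) (omega : set (nat -> T)) : Prop :=
  exists2 x, infinite_path edge x &
    omega = [set y | infinite_path edge y /\ path_equiv x y].

Variable omega : set (nat -> T).

(* the path from [t] representing the boundary point [omega] *)
Definition rep_path (t : T) : nat -> T :=
  xget (fun=> t) [set x | omega x /\ x 0%N = t].

Definition confluent (s t : T) (p : nat * nat) : Prop :=
  forall k, rep_path s (p.1 + k)%N = rep_path t (p.2 + k)%N.

(* the minimal m, n such that the representative paths of s and t satisfy
   s_(m+k) = t_(n+k) for all k *)
Definition confluence (s t : T) : nat * nat :=
  xget (0%N, 0%N) [set p | confluent s t p /\
    forall p', confluent s t p' -> (p.1 <= p'.1)%N /\ (p.2 <= p'.2)%N].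

Definition tmeet (s t : T) : T := rep_path s (confluence s t).1.

Definition tdist (s t : T) : nat :=
  ((confluence s t).1 + (confluence s t).2)%N.

Definition tle (s t : T) : Prop :=
  (tdist s (tmeet s t) <= tdist t (tmeet s t))%N.

Definition teq (s t : T) : Prop :=
  tdist s (tmeet s t) = tdist t (tmeet s t).

Definition primitive_shifts (q : nat) (shift : 'I_q -> T -> T) : Prop :=
  forall t, [set shift j t | j in [set: 'I_q]] =
            [set s | tle t s /\ tdist t s = 1%N].

End Trees.

Record shift_tree (q : nat) (T : choiceType) := ShiftTree {
  tree_edge : rel T;
  tree_edgeP : homogeneous_tree q tree_edge;
  tree_infty : set (nat -> T);
  tree_inftyP : boundary_point tree_edge tree_infty;
  tree_shift : 'I_q -> T -> T;
  tree_shiftP : primitive_shifts tree_infty tree_shift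
}.

(* The free semigroup on q generators is [seq 'I_q], the unit being [::]. It acts
   on the right: t(uv) = (tu)v, the first letter of a word being applied first. *)
Definition tree_act (q : nat) (T : choiceType) (G : shift_tree q T)
    (t : T) (w : seq 'I_q) : T :=
  foldl (fun s i => tree_shift G i s) t w.

Section L2.
Variables (R : realType) (T : choiceType).

Definition square_summable : {pred T -> R[i]^o} := fun f =>
  `[< (\esum_(t in [set: T]) (normc (f t) ^+ 2)%:E < +oo)%E >].

Record ell2 := Ell2 { ell2_val :> T -> R[i]^o;
                      ell2P : ell2_val \in square_summable }.

HB.instance Definition _ := [isSub for ell2_val].
HB.instance Definition _ := [Choice of ell2 by <:].

Lemma esum_lty_bound (a b c : T -> R) (k : R) : 0 <= k ->
  (forall t, 0 <= a t) -> (forall t, 0 <= b t) ->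
  (forall t, 0 <= c t <= k * a t + b t) ->
  (\esum_(t in [set: T]) (a t)%:E < +oo)%E ->
  (\esum_(t in [set: T]) (b t)%:E < +oo)%E ->
  (\esum_(t in [set: T]) (c t)%:E < +oo)%E.
Proof.
move=> k0 a0 b0 cab ha hb.
apply: (@le_lt_trans _ _
  (k%:E * (\esum_(t in [set: T]) (a t)%:E) + \esum_(t in [set: T]) (b t)%:E)%E).
  apply: ge_ereal_sup => _ [A [fA _] <-].
  apply: (@le_trans _ _ (k%:E * \sum_(t \in A) (a t)%:E +
                         \sum_(t \in A) (b t)%:E)%E).
    rewrite ge0_mule_fsumr//.
    rewrite -fsbig_split//=.
    rewrite !fsbig_finite//=; apply: lee_sum => t _.
    by rewrite -EFinM -EFinD lee_fin; case/andP: (cab t).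
  apply: leeD.
    apply: lee_wpmul2l; first by rewrite lee_fin.
    by apply: ereal_sup_ubound; exists A.
  by apply: ereal_sup_ubound; exists A.
by rewrite lte_add_pinfty// lte_mul_pinfty// ?lee_fin//.
Qed.

Lemma square_summable_submod : submod_closed square_summable.
Proof.
split.
  apply/asboolP; rewrite esum1 ?ltry// => t _.
  by rewrite normc0 expr0n.
move=> a f g /asboolP hf /asboolP hg; apply/asboolP.
have sqg : (\esum_(t in [set: T]) (2 * normc (g t) ^+ 2)%:E < +oo)%E.
  apply: (@esum_lty_bound (fun t => normc (g t) ^+ 2) (cst 0) _ 2) => //.
  - by move=> t; exact: sqr_ge0.
  - by move=> t; rewrite addr0 lexx andbT mulr_ge0// sqr_ge0.
  - by rewrite esum1 ?ltry.
apply: (@esum_lty_bound (fun t => normc (f t) ^+ 2)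
          (fun t => 2 * normc (g t) ^+ 2) _ (2 * normc a ^+ 2)) => //.
- by rewrite mulr_ge0// sqr_ge0.
- by move=> t; exact: sqr_ge0.
- by move=> t; rewrite mulr_ge0// sqr_ge0.
move=> t; rewrite sqr_ge0/=.
have := le_normcD (a * f t) (g t); rewrite normcM.
set x := normc a; set y := normc (f t); set z := normc (g t).
have nge (w : R[i]) : 0 <= normc w by case: w => ? ?; exact: sqrtr_ge0.
move=> h; apply: (@le_trans _ _ ((x * y + z) ^+ 2)).
  by rewrite lerXn2r// nnegrE ?addr_ge0 ?mulr_ge0// /x /y /z.
have -> : 2 * x ^+ 2 * y ^+ 2 = 2 * (x * y) ^+ 2 by ring.
by have := sqr_ge0 (x * y - z); rewrite sqrrB sqrrD; lra.
Qed.

HB.instance Definition _ :=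
  GRing.isSubmodClosed.Build _ _ square_summable square_summable_submod.
HB.instance Definition _ := [SubChoice_isSubLmodule of ell2 by <:].

Lemma chi_square_summable (t : T) :
  (fun s => (s == t)%:R : R[i]^o) \in square_summable.
Proof.
apply/asboolP.
rewrite (_ : (fun _ => _) =
  fun s => if s \in [set t] then 1%E else 0%E); last first.
  apply/funext => s; rewrite classical_sets.in_set1.
  by case: (s == t); rewrite ?normc1 ?normc0 ?expr1n ?expr0n.
rewrite -esum_mkcond esum_set1 ?lte01//.
exact: ltry.
Qed.

Definition chi (t : T) : ell2 := Ell2 (chi_square_summable t).

Definition L2 : preHilbert (ell2 : lmodType R[i]) :=
  PreHilbert [set: ell2] (fun f g : ell2 => csum (fun t => f t * conjc (g t))).

End L2.

Notation op R T := (ell2 R T -> ell2 R T).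

Section OperatorsOnTree.
Variables (R : realType) (q : nat) (T : choiceType) (G : shift_tree q T).
Implicit Types (S F : op R T) (s t : T) (w : seq 'I_q) (c d : 'I_q -> op R T).

Local Notation L2 := (L2 R T).
Local Notation chi := (chi R).

Definition bounded_op S : Prop := bounded_linear L2 L2 S.
Definition norm_op S : R := opnorm L2 L2 S.
Definition adj S : op R T := adjoint L2 L2 S.
Definition inv_op S : op R T :=
  xget 0 [set A | [/\ bounded_op A, A \o S = idfun & S \o A = idfun]].
Definition trace S : R[i] := csum (fun t => hdot L2 (S (chi t)) (chi t)).

(* [t |-> tree_act G t w] is injective, every node having a single predecessor, so
   the function below is square summable and the default 0 is not used. *)
Definition word_op w : op R T := fun f => insubd 0 (fun t => f (tree_act G t w)).

Definition shift_op (j : 'I_q) : op R T := word_op [:: j].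

Definition causal S : Prop :=
  bounded_op S /\ forall s (f : ell2 R T),
    (forall t, tle (tree_infty G) t s -> f t = 0) ->
    forall t, tle (tree_infty G) t s -> S f t = 0.

Definition constant_op S : Prop := causal S /\ causal (adj S).

(* the coefficient S_[w] *)
Definition coef S w : op R T :=
  xget 0 [set A | constant_op A /\ forall s t,
    A (chi t) s =
      if `[< teq (tree_infty G) t s >] then S (chi t) (tree_act G s w) else 0].

(* the series sum_w w^* X_w converges to S pointwise absolutely *)
Definition pointwise_abs_series (X : seq 'I_q -> op R T) S : Prop :=
  forall (f : ell2 R T) t,
    abs_summable (fun w => (adj (word_op w) \o X w) f t) /\
    has_sum (fun w => (adj (word_op w) \o X w) f t) (S f t).

Definition row_alpha c : op R T := \sum_(j < q) (c j \o shift_op j).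

(* the set B(T) of points of evaluation *)
Definition tree_ball c : Prop :=
  (forall j, constant_op (c j)) /\
  exists2 l : R, l < 1 &
    norm_op (iter n (row_alpha c)) `^ (n%:R^-1) @[n --> \oo] --> l.

Definition point_term S c (n : nat) : op R T :=
  iter n (row_alpha c) \o
  \sum_(w : n.-tuple 'I_q) (adj (word_op w) \o coef S w).

(* S^(c); the series converges in operator norm *)
Definition point_eval S c : op R T :=
  xget 0 [set L | bounded_op L /\
    norm_op ((\sum_(n < N) point_term S c n) - L) @[N --> \oo] --> (0 : R)].

(* the kernels K_^d = (I - alpha^* d^* )^-1 and
   K_S^d = (I - S S^(d)^* ) K_^d, with alpha^* d^* = (d alpha)^* *)
Definition ker_ball d : op R T := inv_op ((idfun : op R T) - adj (row_alpha d)).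

Definition ker_schur S d : op R T :=
  ((idfun : op R T) - (S \o adj (point_eval S d))) \o ker_ball d.

Definition H2 : preHilbert (op R T : lmodType R[i]) :=
  PreHilbert
    [set F : op R T | causal F /\
      (\esum_(t in [set: T])
         (complex.Re (hdot L2 ((adj F \o F) (chi t)) (chi t)))%:E < +oo)%E]
    (fun F F' => trace (adj F' \o F)).

Definition C2 : preHilbert (op R T : lmodType R[i]) :=
  PreHilbert [set F : op R T | constant_op F /\ hset H2 F] (hdot H2).

Definition right_invariant (H : preHilbert (op R T : lmodType R[i])) : Prop :=
  forall F F' c : op R T, hset H F -> hset H F' -> constant_op c ->
    [/\ hset H (F \o c),
        hnorm H (F \o c) <= hnorm H F * norm_op c
      & hdot H (F \o c) F' = hdot H F (F' \o adj c)].

Definition schur_multiplier S : Prop := causal S /\ norm_op S <= 1.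

Definition left_mul S : op R T -> op R T := fun F => S \o F.

(* the operator B_S = I - M_S M_S^* on H2, where M_S = left_mul S *)
Definition defect S : op R T -> op R T :=
  fun F => F - left_mul S (adjoint H2 H2 (left_mul S) F).

Definition ker_proj S : op R T -> op R T :=
  orthoproj H2 [set F | hset H2 F /\ defect S F = 0].

(* The given norm on the range of sqrt(B_S) determines the inner product, by
   polarization, so this says that H and H(S) are equal as Hilbert spaces. *)
Definition is_deBranges_Rovnyak S (H : preHilbert (op R T : lmodType R[i])) :
    Prop :=
  [/\ is_hilbert H,
      hset H = [set sqrtop H2 (defect S) F | F in hset H2]
    & forall F, hset H2 F ->
        hnorm H (sqrtop H2 (defect S) F) = hnorm H2 (F - ker_proj S F)].

(* [X] is a constant and X d is the prescribed value of S_[w] d for d in C2 *)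
Definition realization_coef (j : 'I_q) (A B C D : op R T -> op R T) w
    (X : op R T) : Prop :=
  constant_op X /\ forall d : op R T, hset C2 d ->
    X \o d = if w is [::] then D d
             else word_op w \o C (iter (size w).-1 A (B d))
                    \o adj (iter (size w) (shift_op j)).

(* the n-th term of the series E_c F *)
Definition eval_term (j : 'I_q) (A C : op R T -> op R T) c F (n : nat) :
    op R T :=
  iter n (row_alpha c) \o C (iter n A F) \o adj (iter n (shift_op j)).

End OperatorsOnTree.

(* Main.v *)
Require Import Defs.
From mathcomp Require Import all_boot all_order all_algebra.
From mathcomp Require Import all_classical all_reals all_analysis.
From mathcomp Require Import finmap complex zify ring lra.

Set Implicit Arguments.
Unset Strict Implicit.
Unset Printing Implicit Defensive.

Import Order.TTheory GRing.Theory Num.Theory.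
Import numFieldNormedType.Exports.
Import ComplexField.Normc.

Local Open Scope classical_set_scope.
Local Open Scope ring_scope.
Local Open Scope complex_scope.

(** The tree enters only through the levels of its nodes, that is, the horocycles
    of the boundary point: [t] precedes [s] exactly when the level of [t] is at most
    that of [s] ([tleE]). Operators are thereby graded by the amount by which they
    raise levels. Causal operators have degree at least 0, constants have degree 0,
    the shift [U = alpha_j] has degree -1, and [U U^* = I]. With [diag X] the part of
    [X] of degree 0, the coefficient [S_[w]] is [diag (w S)] ([coefE]), and the value
    of [S] at [c] is [diag (L S)] with [L = (I - c alpha)^-1] ([point_evalE]).

    The colligation is run as a linear system whose state space is [H]. Since [V V^*]
    is at most the identity, [V] is a contraction, and the observability operator
<<
      O F = sum_n C (A^n F) U^{n*}
>>
    is a contraction of [H] into the causal Hilbert-Schmidt operators, its terms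
    having different degrees. It satisfies [O F = C F + O (A F) U^*]. A constant [d]
    put in as input contributes [D d + O (B d) U^*] to the output, which gives
    the rule [state_step] for one step of the system. Iterating it, with an
    orthogonal splitting of the output at each level, shows that the response to
    finitely many inputs has at most their energy ([simulation]). By duality there is
    a contraction [S] such that [S d = D d + O (B d) U^*] for all the constants [d] of
    Hilbert-Schmidt class ([transfer_input]); taking parts of degree [n] gives the
    prescribed coefficients ([transfer_coef]). Pointwise absolute convergence holds
    for every causal operator ([coef_series]), as the restrictions of a
    square-summable function to the horocycles are orthogonal.

    The heart of the proof is the identity
<<
      O O^* = I - M_S M_S^*
>>
    ([observability_gram]). Taking the adjoint of [(F, d) |-> O F + S d] in the two
    members of [state_step] expresses [V^*] at a pair built from the backward shift
    [tail X] and [diag X] ([adjoint_state]). Applying [V] and the formula for [V V^*],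
    one finds that the difference [Delta] of the two sides satisfies
    [Delta X = Delta (tail X) U^*]. So [Delta X] raises levels by any given amount,
    and is 0.

    The operator [E_c] is [O] followed by evaluation at [c]. Evaluation at [c] on the
    causal Hilbert-Schmidt operators has adjoint [k |-> K^c k], where [K^c = L^*], and
    [M_S^*] maps [K^c k] to [S^(c)^* K^c k] ([Ms_ker_ball]). Hence [O E_d^* k] is
    [K_S^d k], and evaluating at [c] gives the factorization of the kernel.

    For the canonical [A] and [C], the recursion satisfied by [O] is also satisfied by
    the inclusion, so [O F = F]. Thus [H] is contractively included in the space of
    causal Hilbert-Schmidt operators, and the inclusion composed with its adjoint is
    [B_S = I - M_S M_S^*]. A Hilbert space included in another one in this way is the
    range of the square root of the composite, with the range norm ([range_sqrt],
    [range_sqrt_norm]); the square root is built by an iteration ([ex_sqrt]). *)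

(** * Unconditional sums *)

Section Sums.
Variables (R : realType) (I : choiceType).
Implicit Types (a b : I -> R[i]) (p : I -> R).

Lemma normc_ge0 (z : R[i]) : 0 <= normc z.
Proof. by case: z => x y; exact: sqrtr_ge0. Qed.

Lemma normcJ (z : R[i]) : normc (conjc z) = normc z.
Proof. by case: z => x y /=; rewrite sqrrN. Qed.

Lemma normc_sqr (z : R[i]) : normc z ^+ 2 = complex.Re z ^+ 2 + complex.Im z ^+ 2.
Proof. by case: z => x y /=; rewrite sqr_sqrtr// addr_ge0 ?sqr_ge0. Qed.

Lemma mulcJ (z : R[i]) : z * conjc z = (normc z ^+ 2)%:C.
Proof.
rewrite normc_sqr; case: z => x y /=; rewrite /real_complex_def; simpc.
by congr (_ +i* _); ring.
Qed.

Lemma normc_real (x : R) : normc x%:C = `|x|.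
Proof. by rewrite /= expr0n/= addr0 sqrtr_sqr. Qed.

Lemma Re_le_normc (z : R[i]) : `|complex.Re z| <= normc z.
Proof.
rewrite -(@ler_pXn2r _ 2)// ?nnegrE ?normc_ge0//.
by rewrite normc_sqr real_normK ?num_real// lerDl sqr_ge0.
Qed.

Lemma Im_le_normc (z : R[i]) : `|complex.Im z| <= normc z.
Proof.
rewrite -(@ler_pXn2r _ 2)// ?nnegrE ?normc_ge0//.
by rewrite normc_sqr real_normK ?num_real// lerDr sqr_ge0.
Qed.

Lemma has_sumP a (l : R[i]) : has_sum a l <->
  forall e : R, 0 < e -> exists A : {fset I}, forall B : {fset I},
    (A `<=` B)%fset -> normc (\sum_(k <- B) a k - l) < e.
Proof.
split=> h e e0.
  have [A fA hA] := h _ e0.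
  exists (fset_set A) => B AB.
  have := hA [set` B] (finite_fset B).
  rewrite (fsbig_finite _ _ (finite_fset B))/= set_fsetK; apply.
  move=> x Ax; apply: (fsubsetP AB).
  by rewrite in_fset_set//; exact: mem_set.
have [A hA] := h _ e0.
exists [set` A]; first exact: finite_fset.
move=> B fB AB; rewrite fsbig_finite//=; apply: hA.
by apply/fsubsetP => x xA; rewrite in_fset_set//; apply: mem_set; apply: AB.
Qed.

Lemma has_sum_unique a l l' : has_sum a l -> has_sum a l' -> l = l'.
Proof.
move=> /has_sumP h /has_sumP h'; apply/eqP; rewrite -subr_eq0; apply/eqP.
apply: eq0_normc; apply/eqP; rewrite eq_le normc_ge0 andbT leNgt; apply/negP => n0.
have [A hA] := h _ (divr_gt0 n0 (ltr0Sn _ 1)).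
have [A' hA'] := h' _ (divr_gt0 n0 (ltr0Sn _ 1)).
have := hA _ (fsubsetUl A A'); have := hA' _ (fsubsetUr A A').
set s := \sum_(_ <- _) _ => s1 s2.
have := le_normcD (s - l') (- (s - l)); rewrite normcN.
by rewrite (_ : s - l' + - (s - l) = l - l'); [lra | ring].
Qed.

Lemma has_sum_csum a l : has_sum a l -> csum a = l.
Proof.
move=> h; rewrite /csum; case: xgetP => [x _ hx|/(_ l)//].
exact: has_sum_unique hx h.
Qed.

Lemma has_sumD a b l m : has_sum a l -> has_sum b m ->
  has_sum (fun i => a i + b i) (l + m).
Proof.
move=> /has_sumP ha /has_sumP hb; apply/has_sumP => e e0.
have [A hA] := ha _ (divr_gt0 e0 (ltr0Sn _ 1)).
have [B hB] := hb _ (divr_gt0 e0 (ltr0Sn _ 1)).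
exists (A `|` B)%fset => X ABX.
have := hA _ (fsubset_trans (fsubsetUl _ _) ABX).
have := hB _ (fsubset_trans (fsubsetUr _ _) ABX).
rewrite big_split/=; set x := \sum_(_ <- _) _; set y := \sum_(_ <- _) _.
have := le_normcD (y - l) (x - m).
by rewrite (_ : y - l + (x - m) = y + x - (l + m)); [lra | ring].
Qed.

Lemma has_sumZ (c : R[i]) a l : has_sum a l -> has_sum (fun i => c * a i) (c * l).
Proof.
move=> /has_sumP ha; apply/has_sumP => e e0.
have n0 := normc_ge0 c.
have k0 : 0 < normc c + 1 by lra.
have [A hA] := ha _ (divr_gt0 e0 k0).
exists A => B AB; rewrite -mulr_sumr -mulrBr normcM.
have := hA _ AB; rewrite ltr_pdivlMr//; apply: le_lt_trans.
by rewrite mulrC ler_wpM2l ?normc_ge0//; lra.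
Qed.

Lemma has_sumJ a l : has_sum a l -> has_sum (fun i => conjc (a i)) (conjc l).
Proof.
move=> /has_sumP ha; apply/has_sumP => e e0; have [A hA] := ha _ e0.
by exists A => B AB; rewrite -rmorph_sum -rmorphB/= normcJ; exact: hA.
Qed.

Lemma has_sum_fset (A : {fset I}) a : (forall i, i \notin A -> a i = 0) ->
  has_sum a (\sum_(i <- A) a i).
Proof.
move=> a0; apply/has_sumP => e e0; exists A => B AB.
rewrite (_ : \sum_(i <- B) a i = \sum_(i <- A) a i) ?subrr ?normc0//.
rewrite [RHS](big_fset_incl _ AB)//.
by move=> i _ iA; exact: a0.
Qed.

Lemma has_sum_single i0 a : (forall i, i != i0 -> a i = 0) -> has_sum a (a i0).
Proof.
move=> a0; have := @has_sum_fset [fset i0]%fset a.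
rewrite big_seq_fset1; apply => i; rewrite inE; exact: a0.
Qed.

Lemma csum_single i0 a : (forall i, i != i0 -> a i = 0) -> csum a = a i0.
Proof. by move=> h; apply: has_sum_csum; exact: has_sum_single. Qed.

Definition summable_nneg p := (\esum_(i in [set: I]) (p i)%:E < +oo)%E.

Definition nnegsum p : R := fine (\esum_(i in [set: I]) (p i)%:E)%E.

Lemma esum_fset_le p (A : {fset I}) :
  ((\sum_(i <- A) p i)%:E <= \esum_(i in [set: I]) (p i)%:E)%E.
Proof.
apply: ereal_sup_ubound; exists [set` A]; first by split => //; exact: finite_fset.
by rewrite (fsbig_finite _ _ (finite_fset A))/= set_fsetK sumEFin.
Qed.

Lemma esum_le_fset p (M : \bar R) :
  (forall A : {fset I}, ((\sum_(i <- A) p i)%:E <= M)%E) ->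
  (\esum_(i in [set: I]) (p i)%:E <= M)%E.
Proof.
move=> h; apply: ge_ereal_sup => _ [A [fA _] <-].
by rewrite fsbig_finite//= sumEFin; exact: h.
Qed.

Lemma nnegsumE p : (forall i, 0 <= p i) -> summable_nneg p ->
  (\esum_(i in [set: I]) (p i)%:E)%E = (nnegsum p)%:E.
Proof.
move=> p0 sp; rewrite /nnegsum fineK// ge0_fin_numE//.
by apply: esum_ge0 => i _; rewrite lee_fin.
Qed.

Lemma nnegsum_ge p (A : {fset I}) : (forall i, 0 <= p i) -> summable_nneg p ->
  \sum_(i <- A) p i <= nnegsum p.
Proof.
by move=> p0 sp; rewrite -lee_fin -nnegsumE//; exact: esum_fset_le.
Qed.

Lemma nnegsum_ge1 p i : (forall i, 0 <= p i) -> summable_nneg p ->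
  p i <= nnegsum p.
Proof.
by move=> p0 sp; have := nnegsum_ge [fset i]%fset p0 sp; rewrite big_seq_fset1.
Qed.

Lemma nnegsum_ge0 p : (forall i, 0 <= p i) -> 0 <= nnegsum p.
Proof. by move=> p0; apply: fine_ge0; apply: esum_ge0 => i _; rewrite lee_fin. Qed.

Lemma summable_nneg_bound p (M : R) :
  (forall A : {fset I}, \sum_(i <- A) p i <= M) -> summable_nneg p.
Proof.
move=> h; apply: (@le_lt_trans _ _ M%:E); last exact: ltry.
by apply: esum_le_fset => A; rewrite lee_fin.
Qed.

Lemma nnegsum_le p (M : R) : (forall i, 0 <= p i) ->
  (forall A : {fset I}, \sum_(i <- A) p i <= M) -> nnegsum p <= M.
Proof.
move=> p0 h; rewrite -lee_fin -nnegsumE//; last exact: summable_nneg_bound h.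
by apply: esum_le_fset => A; rewrite lee_fin.
Qed.

Lemma summable_nneg_le p p' : (forall i, 0 <= p' i) -> (forall i, p i <= p' i) ->
  summable_nneg p' -> summable_nneg p.
Proof.
move=> p'0 pp' sp'; apply: (@summable_nneg_bound _ (nnegsum p')) => A.
by apply: le_trans (nnegsum_ge A p'0 sp'); exact: ler_sum.
Qed.

Lemma has_sum_nneg p : (forall i, 0 <= p i) -> summable_nneg p ->
  has_sum (fun i => (p i)%:C) (nnegsum p)%:C.
Proof.
move=> p0 sp; apply/has_sumP => e e0.
have [A hA] : exists A : {fset I}, nnegsum p - e < \sum_(i <- A) p i.
  apply: contrapT => hn; suff : nnegsum p <= nnegsum p - e by lra.
  apply: nnegsum_le => // A; rewrite leNgt; apply/negP => ?; apply: hn; by exists A.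
exists A => B AB.
rewrite -(rmorph_sum (real_complex R)) -rmorphB normc_real.
have h1 := nnegsum_ge B p0 sp.
have h2 : \sum_(i <- A) p i <= \sum_(i <- B) p i.
  rewrite [leRHS](big_fsetID _ (mem A))/=.
  rewrite (_ : [fset x in B | x \in A]%fset = A); last first.
    apply/fsetP => x; rewrite !inE/= andbC.
    by case xA : (x \in A) => //=; rewrite (fsubsetP AB _ xA).
  by rewrite lerDl sumr_ge0.
by rewrite ltr_norml; lra.
Qed.

(** The positive and negative parts of the real and imaginary parts are dominated
    by the moduli, and sums of nonnegative terms converge as soon as they are
    bounded. *)
Lemma abs_summable_has_sum a : abs_summable a -> has_sum a (csum a).
Proof.
move=> sa.
have n0 i := normc_ge0 (a i).
have hb p : (forall i, 0 <= p i) -> (forall i, p i <= normc (a i)) ->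
    has_sum (fun i => (p i)%:C) (nnegsum p)%:C.
  move=> p0 pa; apply: has_sum_nneg => //; exact: summable_nneg_le sa.
pose pos (x : R) := Num.max x 0.
have pos0 x : 0 <= pos x by rewrite /pos le_max lexx orbT.
have posn x : pos x <= `|x| by rewrite /pos ge_max ler_norm normr_ge0.
have posB x : x = pos x - pos (- x).
  by rewrite /pos /Order.max; case: ltP => ?; case: ltP => ?; lra.
have h1 := hb (fun i => pos (complex.Re (a i))) (fun=> pos0 _)
  (fun i => le_trans (posn _) (Re_le_normc _)).
have h2 := hb (fun i => pos (- complex.Re (a i))) (fun=> pos0 _).
have {}h2 := h2 (fun i => le_trans (posn _) _).
have {}h2 := h2 (fun i => ltac:(rewrite normrN; exact: Re_le_normc)).
have h3 := hb (fun i => pos (complex.Im (a i))) (fun=> pos0 _)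
  (fun i => le_trans (posn _) (Im_le_normc _)).
have h4 := hb (fun i => pos (- complex.Im (a i))) (fun=> pos0 _).
have {}h4 := h4 (fun i => le_trans (posn _) _).
have {}h4 := h4 (fun i => ltac:(rewrite normrN; exact: Im_le_normc)).
have := has_sumD (has_sumD h1 (has_sumZ (-1) h2))
   (has_sumZ 'i (has_sumD h3 (has_sumZ (-1) h4))).
set l := (_ + _ : R[i]) => hl.
suff ha : has_sum a l by rewrite (has_sum_csum ha).
move: hl; congr (has_sum _ l); apply/funext => i.
rewrite !mulN1r -!rmorphB/= -!posB; case: (a i) => x y /=; rewrite /real_complex_def.
by simpc.
Qed.

Lemma csum_ext a b : a =1 b -> csum a = csum b.
Proof. by move=> /funext ->. Qed.

Lemma csum_nneg p : (forall i, 0 <= p i) -> summable_nneg p ->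
  csum (fun i => (p i)%:C) = (nnegsum p)%:C.
Proof. by move=> p0 sp; apply: has_sum_csum; exact: has_sum_nneg. Qed.

End Sums.

(** At a given node, a series indexed by words has nonzero terms only for the words
    leading to it from its ancestors, and so becomes a series over [nat]. *)
Lemma has_sum_reindex (R : realType) (I J : choiceType) (h : I -> J)
    (a : J -> R[i]) l :
  injective h -> (forall j, (forall i, h i <> j) -> a j = 0) ->
  has_sum a l <-> has_sum (a \o h) l.
Proof.
move=> hinj a0.
have sumE (B : {fset I}) :
    \sum_(j <- [fset h i | i in B]%fset) a j = \sum_(i <- B) a (h i).
  by rewrite big_imfset//= => x y _ _; exact: hinj.
split=> /has_sumP ha; apply/has_sumP => e e0; have [A hA] := ha _ e0.
  pose A' : {fset I} := fset_set [set i | h i \in A].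
  have fA' : finite_set [set i | h i \in A].
    have := @finite_preimage _ _ [set` A] h.
    apply; last exact: finite_fset.
    by move=> x y _ _; exact: hinj.
  exists A' => B AB.
  have := hA ([fset h i | i in B] `|` A)%fset (fsubsetUr _ _).
  rewrite -[\sum_(k <- B) _]sumE.
  rewrite [in X in X -> _](_ : \sum_(k <- _) a k =
     \sum_(j <- [fset h i | i in B]%fset) a j)//.
  rewrite [RHS](big_fset_incl _ (fsubsetUl _ A))// => j.
  rewrite inE => /orP[->//|jA jB]; apply: a0 => i hij.
  move/negP: jB; apply; apply/imfsetP; exists i => //=.
  by apply: (fsubsetP AB); rewrite in_fset_set//; apply: mem_set; rewrite /= hij.
exists [fset h i | i in A]%fset => B AB.
pose B' : {fset I} := fset_set [set i | h i \in B].
have fB' : finite_set [set i | h i \in B].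
  have := @finite_preimage _ _ [set` B] h.
  apply; last exact: finite_fset.
  by move=> x y _ _; exact: hinj.
have AB' : (A `<=` B')%fset.
  apply/fsubsetP => i iA; rewrite in_fset_set//; apply: mem_set => /=.
  by apply: (fsubsetP AB); apply/imfsetP; exists i.
have := hA _ AB'; rewrite -sumE (big_fset_incl _ (_ : _ `<=` B)%fset)//.
  by apply/fsubsetP => j /imfsetP[i /=]; rewrite in_fset_set// => /set_mem/= ? ->.
move=> j jB jB'; apply: a0 => i hij.
move/negP: jB'; apply; apply/imfsetP; exists i => //=.
by rewrite in_fset_set//; apply: mem_set; rewrite /= hij.
Qed.

(** * Hilbert spaces *)

Lemma conjcM (R : realType) (a b : R[i]) : conjc (a * b) = conjc a * conjc b.
Proof. exact: rmorphM. Qed.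

Lemma real_complexM (R : realType) (x y : R) : (x * y)%:C = x%:C * y%:C.
Proof. exact: (rmorphM (real_complex R)). Qed.

Lemma complex_ReD (R : realType) (a b : R[i]) :
  complex.Re (a + b) = complex.Re a + complex.Re b.
Proof. by case: a b => [x y] [z w]. Qed.

Lemma dist_halves (R : realType) (l x y e : R) :
  `|l - x| < e / 2 -> `|l - y| < e / 2 -> x - y < e.
Proof. by rewrite !ltr_norml => /andP[? ?] /andP[? ?]; lra. Qed.

Lemma cancel_sum (V : zmodType) (a b s r x : V) :
  a + b - s - (a + x - (s + r)) = b - (x - r).
Proof.
rewrite opprB addrA [a + b - s + _]addrA subrK opprD addrA -(addrA a) [a + _]addrC addrK.
by rewrite [in RHS]opprB addrA.
Qed.

Lemma le_of_sqr (R : realType) (a b : R) : 0 <= b -> a ^+ 2 <= b ^+ 2 -> a <= b.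
Proof. by move=> b0; rewrite leNgt => h; rewrite leNgt; apply/negP => ba; move: h; nra. Qed.

Lemma sqr_le (R : realType) (a b : R) : 0 <= a -> a <= b -> a ^+ 2 <= b ^+ 2.
Proof. nra. Qed.

Section HilbertTheory.
Variables (R : realType) (V : lmodType R[i]) (H : preHilbert V).
Hypothesis hH : is_hilbert H.
Implicit Types (x y z : V) (a : R[i]).
Local Notation "''[' x , y ]" := (hdot H x y) (format "''[' x , y ]").
Local Notation N := (hnorm H).
Local Notation inH := (hset H).

Lemma hset0 : inH 0. Proof. by case: hH => -[]. Qed.

Lemma hsetL a x y : inH x -> inH y -> inH (a *: x + y).
Proof. by case: hH => -[_ h] *; exact: h. Qed.

Lemma hsetZ a x : inH x -> inH (a *: x).
Proof. by move=> hx; rewrite -[_ *: _]addr0; apply: hsetL => //; exact: hset0. Qed.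

Lemma hsetD x y : inH x -> inH y -> inH (x + y).
Proof. by move=> hx hy; rewrite -[x]scale1r; exact: hsetL. Qed.

Lemma hsetN x : inH x -> inH (- x).
Proof. by rewrite -scaleN1r; exact: hsetZ. Qed.

Lemma hsetB x y : inH x -> inH y -> inH (x - y).
Proof. by move=> hx hy; apply: hsetD => //; exact: hsetN. Qed.

Lemma hset_sum (J : Type) (r : seq J) (P : pred J) (u : J -> V) :
  (forall i, P i -> inH (u i)) -> inH (\sum_(i <- r | P i) u i).
Proof. by move=> hu; apply: big_ind => //; [exact: hset0|exact: hsetD]. Qed.

Lemma hdotL a x y z : inH x -> inH y -> inH z ->
  '[a *: x + y, z] = a * '[x, z] + '[y, z].
Proof. by case: hH => _ h *; exact: h. Qed.

Lemma hdotC x y : inH x -> inH y -> '[y, x] = conjc '[x, y].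
Proof. by case: hH => _ _ h *; exact: h. Qed.

Lemma hdotDl x y z : inH x -> inH y -> inH z -> '[x + y, z] = '[x, z] + '[y, z].
Proof. by move=> hx hy hz; rewrite -[x]scale1r hdotL// mul1r scale1r. Qed.

Lemma hdot0l z : inH z -> '[0, z] = 0.
Proof.
move=> hz; have := hdotDl hset0 hset0 hz; rewrite addr0 => /eqP.
by rewrite -subr_eq subrr => /eqP <-.
Qed.

Lemma hdotZl a x z : inH x -> inH z -> '[a *: x, z] = a * '[x, z].
Proof.
by move=> hx hz; rewrite -[a *: x]addr0 hdotL//; [rewrite hdot0l// addr0|exact: hset0].
Qed.

Lemma hdotNl x z : inH x -> inH z -> '[- x, z] = - '[x, z].
Proof. by move=> hx hz; rewrite -scaleN1r hdotZl// mulN1r. Qed.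

Lemma hdotBl x y z : inH x -> inH y -> inH z -> '[x - y, z] = '[x, z] - '[y, z].
Proof. by move=> hx hy hz; rewrite hdotDl ?hdotNl//; exact: hsetN. Qed.

Lemma hdotDr x y z : inH x -> inH y -> inH z -> '[z, x + y] = '[z, x] + '[z, y].
Proof.
move=> hx hy hz; rewrite hdotC//; last exact: hsetD.
by rewrite hdotDl// rmorphD/= -!hdotC.
Qed.

Lemma hdotZr a x z : inH x -> inH z -> '[z, a *: x] = conjc a * '[z, x].
Proof.
move=> hx hz; rewrite hdotC//; last exact: hsetZ.
by rewrite hdotZl// rmorphM/= -!hdotC.
Qed.

Lemma hdotNr x z : inH x -> inH z -> '[z, - x] = - '[z, x].
Proof. by move=> hx hz; rewrite -scaleN1r hdotZr// rmorphN rmorph1 mulN1r. Qed.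

Lemma hdotBr x y z : inH x -> inH y -> inH z -> '[z, x - y] = '[z, x] - '[z, y].
Proof. by move=> hx hy hz; rewrite hdotDr ?hdotNr//; exact: hsetN. Qed.

Lemma hdot0r z : inH z -> '[z, 0] = 0.
Proof. by move=> hz; rewrite hdotC ?hdot0l ?rmorph0//; exact: hset0. Qed.

Lemma hdot_suml (J : Type) (r : seq J) (u : J -> V) z : inH z ->
  (forall i, inH (u i)) -> '[\sum_(i <- r) u i, z] = \sum_(i <- r) '[u i, z].
Proof.
move=> hz hu; elim: r => [|i r IH]; first by rewrite !big_nil hdot0l.
by rewrite !big_cons hdotDl ?IH//; exact: hset_sum.
Qed.

Lemma hnorm_ge0 x : 0 <= N x. Proof. exact: sqrtr_ge0. Qed.

Lemma hdot_self x : inH x -> '[x, x] = (N x ^+ 2)%:C.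
Proof.
move=> hx; case: hH => _ _ _ /(_ x hx)[+ _] _; rewrite /hnorm.
case: '[x, x] => u v; rewrite lecE/= => /andP[/eqP -> u0].
by rewrite sqr_sqrtr.
Qed.

Lemma hnorm_sqr x : inH x -> N x ^+ 2 = complex.Re '[x, x].
Proof. by move=> hx; rewrite hdot_self. Qed.

Lemma hnorm0_eq0 x : inH x -> N x = 0 -> x = 0.
Proof.
move=> hx n0; case: hH => _ _ _ /(_ x hx)[_ +] _; apply.
by rewrite hdot_self// n0 expr0n.
Qed.

Lemma hnorm0 : N 0 = 0.
Proof. by rewrite /hnorm hdot0l ?sqrtr0//; exact: hset0. Qed.

Lemma hnormZ a x : inH x -> N (a *: x) = normc a * N x.
Proof.
move=> hx; have n0 : 0 <= normc a * N x by rewrite mulr_ge0 ?hnorm_ge0 ?normc_ge0.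
apply/eqP; rewrite -(@eqrXn2 _ 2) ?hnorm_ge0//; apply/eqP.
rewrite hnorm_sqr ?hdotZl ?hdotZr//; try exact: hsetZ.
by rewrite hdot_self// mulrA mulcJ -rmorphM/= exprMn.
Qed.

Lemma hnormN x : inH x -> N (- x) = N x.
Proof. by move=> hx; rewrite -scaleN1r hnormZ// normcN normc1 mul1r. Qed.

Lemma hnormBC x y : inH x -> inH y -> N (x - y) = N (y - x).
Proof. by move=> hx hy; rewrite -opprB hnormN//; exact: hsetB. Qed.

Lemma hnorm_sqrD x y : inH x -> inH y ->
  N (x + y) ^+ 2 = N x ^+ 2 + N y ^+ 2 + 2 * complex.Re '[x, y].
Proof.
move=> hx hy; rewrite hnorm_sqr; last exact: hsetD.
rewrite hdotDl ?hdotDr//; try exact: hsetD.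
rewrite (hdotC hx hy) !hdot_self//; case: '[x, y] => u v /=; ring.
Qed.

Lemma hnorm_pythagoras x y : inH x -> inH y -> '[x, y] = 0 ->
  N (x + y) ^+ 2 = N x ^+ 2 + N y ^+ 2.
Proof. by move=> hx hy xy; rewrite hnorm_sqrD// xy/= mulr0 addr0. Qed.

(** The quadratic polynomial in [t] behind both the Cauchy-Schwarz inequality and
    the orthogonality that characterizes nearest points. *)
Lemma hnorm_sqrB_proj (t : R) x y : inH x -> inH y ->
  N (x - (t%:C * '[x, y]) *: y) ^+ 2 =
  N x ^+ 2 - 2 * t * normc '[x, y] ^+ 2 + t ^+ 2 * normc '[x, y] ^+ 2 * N y ^+ 2.
Proof.
move=> hx hy; rewrite hnorm_sqrD//; last by apply: hsetN; exact: hsetZ.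
rewrite hnormN; last exact: hsetZ.
rewrite hdotNr//; last exact: hsetZ.
rewrite hnormZ// normcM normc_real hdotZr//.
rewrite !exprMn real_normK ?num_real//.
have -> : conjc (t%:C * '[x, y]) * '[x, y] = (t * normc '[x, y] ^+ 2)%:C.
  rewrite conjcM conjc_real -mulrA [conjc _ * _]mulrC mulcJ.
  by rewrite -real_complexM.
by rewrite /=; ring.
Qed.

Lemma cauchy_schwarz x y : inH x -> inH y -> normc '[x, y] <= N x * N y.
Proof.
move=> hx hy; have [y0|y0] := eqVneq (N y) 0.
  by rewrite (hnorm0_eq0 hy y0) hdot0r// normc0 hnorm0 mulr0.
have yp : 0 < N y ^+ 2 by rewrite exprn_gt0// lt_def y0 hnorm_ge0.
rewrite -(@ler_pXn2r _ 2)// ?nnegrE ?mulr_ge0 ?hnorm_ge0 ?normc_ge0//.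
have := hnorm_sqrB_proj (N y ^+ 2)^-1 hx hy.
set n := normc _ ^+ 2; set m := N y ^+ 2 => e.
have : 0 <= N x ^+ 2 - 2 * m^-1 * n + m^-1 ^+ 2 * n * m by rewrite -e exprn_ge0// hnorm_ge0.
rewrite (_ : _ + _ = N x ^+ 2 - n / m); last by field; rewrite gt_eqF.
by rewrite subr_ge0 ler_pdivrMr// exprMn.
Qed.

Lemma hnormD x y : inH x -> inH y -> N (x + y) <= N x + N y.
Proof.
move=> hx hy.
rewrite -(@ler_pXn2r _ 2)// ?nnegrE ?addr_ge0 ?hnorm_ge0//.
rewrite hnorm_sqrD// sqrrD.
have := cauchy_schwarz hx hy; have := Re_le_normc '[x, y].
have := ler_norm (complex.Re '[x, y]); lra.
Qed.

Lemma hnormB x y : inH x -> inH y -> N (x - y) <= N x + N y.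
Proof. by move=> hx hy; rewrite -(hnormN hy) hnormD//; exact: hsetN. Qed.

Lemma hnorm_dist x y z : inH x -> inH y -> inH z -> N (x - z) <= N (x - y) + N (y - z).
Proof.
move=> hx hy hz; rewrite (_ : x - z = (x - y) + (y - z)); last by rewrite addrA subrK.
by rewrite hnormD//; exact: hsetB.
Qed.

Lemma hnorm_sum (J : Type) (r : seq J) (u : J -> V) :
  (forall i, inH (u i)) -> N (\sum_(i <- r) u i) <= \sum_(i <- r) N (u i).
Proof.
move=> hu; elim: r => [|i r IH]; first by rewrite !big_nil hnorm0.
rewrite !big_cons; apply: le_trans (hnormD _ _) _ => //; first exact: hset_sum.
by rewrite lerD2l.
Qed.

Lemma parallelogram x y : inH x -> inH y ->
  N (x + y) ^+ 2 + N (x - y) ^+ 2 = 2 * N x ^+ 2 + 2 * N y ^+ 2.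
Proof.
move=> hx hy; rewrite !hnorm_sqrD//; last exact: hsetN.
by rewrite hdotNr// hnormN// raddfN/=; ring.
Qed.

Lemma hdot_eq0_all x : inH x -> (forall y, inH y -> '[x, y] = 0) -> x = 0.
Proof.
move=> hx /(_ x hx) h; apply: hnorm0_eq0 => //; apply/eqP.
by rewrite -sqrf_eq0 hnorm_sqr// h.
Qed.

Lemma cvg_inP (u : nat -> V) l : cvg_in H u l <->
  forall e : R, 0 < e -> exists M, forall n, (M <= n)%N -> N (u n - l) < e.
Proof.
split=> [h e e0|h].
  have /cvgrPdist_lt/(_ _ e0)[M _ hM] := h.
  exists M => n Mn; have := hM n Mn.
  by rewrite /= sub0r normrN ger0_norm// hnorm_ge0.
apply/cvgrPdist_lt => e e0; have [M hM] := h _ e0.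
exists M => // n Mn; rewrite /= sub0r normrN ger0_norm ?hnorm_ge0//; exact: hM.
Qed.

Lemma cvg_in_unique (u : nat -> V) l m : (forall n, inH (u n)) ->
  inH l -> inH m -> cvg_in H u l -> cvg_in H u m -> l = m.
Proof.
move=> hu hl hm /cvg_inP ul /cvg_inP um.
apply/eqP; rewrite -subr_eq0; apply/eqP; apply: hnorm0_eq0; first exact: hsetB.
apply/eqP; rewrite eq_le hnorm_ge0 andbT leNgt; apply/negP => n0.
have [M1 h1] := ul _ (divr_gt0 n0 (ltr0Sn _ 1)).
have [M2 h2] := um _ (divr_gt0 n0 (ltr0Sn _ 1)).
have := h1 _ (leq_maxl M1 M2); have := h2 _ (leq_maxr M1 M2).
have := hnorm_dist hl (hu (maxn M1 M2)) hm.
rewrite (hnormBC hl (hu _)); lra.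
Qed.

Lemma cvg_in_lin a (u v : nat -> V) x y : (forall n, inH (u n)) ->
  (forall n, inH (v n)) -> inH x -> inH y -> cvg_in H u x -> cvg_in H v y ->
  cvg_in H (fun n => a *: u n + v n) (a *: x + y).
Proof.
move=> hu hv hx hy /cvg_inP ux /cvg_inP vy; apply/cvg_inP => e e0.
have k0 : 0 < normc a + 1 by have := normc_ge0 a; lra.
have [K1 h1] := ux _ (divr_gt0 e0 (mulr_gt0 (ltr0Sn R 1) k0)).
have [K2 h2] := vy _ (divr_gt0 e0 (ltr0Sn R 1)).
exists (maxn K1 K2) => n; rewrite geq_max => /andP[/h1 + /h2].
rewrite ltr_pdivlMr ?mulr_gt0//.
rewrite (_ : a *: u n + v n - _ = a *: (u n - x) + (v n - y)); last first.
  by rewrite scalerBr opprD addrACA.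
have hux := hsetB (hu n) hx; have hvy := hsetB (hv n) hy.
have := hnormD (hsetZ a hux) hvy; rewrite hnormZ//.
have := hnorm_ge0 (u n - x); have := normc_ge0 a.
move: (N _) (N _) (N _) (normc a) => b c d w; nra.
Qed.

Lemma cvg_in_norm_le (u : nat -> V) l (B : R) : (forall n, inH (u n)) -> inH l ->
  cvg_in H u l -> (exists M, forall n, (M <= n)%N -> N (u n) <= B) -> N l <= B.
Proof.
move=> hu hl /cvg_inP ul [M hM]; apply/ler_addgt0Pr => e e0.
have [K hK] := ul _ e0; set n := maxn M K.
have h1 := hM n (leq_maxl _ _); have h2 := hK n (leq_maxr _ _).
have := hnormB (hu n) (hsetB (hu n) hl).
rewrite subKr; lra.
Qed.

Lemma cvg_in_dot_eq (u : nat -> V) l y c : (forall n, inH (u n)) -> inH l -> inH y ->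
  cvg_in H u l -> (exists M, forall n, (M <= n)%N -> '[u n, y] = c) -> '[l, y] = c.
Proof.
move=> hu hl hy /cvg_inP ul [M hM].
apply/eqP; rewrite -subr_eq0; apply/eqP; apply: eq0_normc.
apply/eqP; rewrite eq_le normc_ge0 andbT; apply/ler_addgt0Pr => e e0.
have k0 : 0 < N y + 1 by have := hnorm_ge0 y; lra.
have [K hK] := ul _ (divr_gt0 e0 k0); set n := maxn M K.
rewrite -(hM n (leq_maxl _ _)) -hdotBl//.
apply: le_trans (cauchy_schwarz (hsetB hl (hu n)) hy) _.
have := hK n (leq_maxr _ _); rewrite hnormBC// ltr_pdivlMr// add0r => /ltW.
by apply: le_trans; rewrite ler_wpM2l ?hnorm_ge0//; lra.
Qed.

Lemma cvg_in_cauchy (u : nat -> V) l : (forall n, inH (u n)) -> inH l ->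
  cvg_in H u l -> cauchy_in H u.
Proof.
move=> hu hl /cvg_inP ul e e0; have [M hM] := ul _ (divr_gt0 e0 (ltr0Sn _ 1)).
exists M => m n Mm Mn; have := hM _ Mm; have := hM _ Mn.
have := hnorm_dist (hu m) hl (hu n); rewrite (hnormBC hl (hu n)); lra.
Qed.

Definition closed_subspace (K : set V) := [/\ K `<=` inH, K 0,
  (forall a x y, K x -> K y -> K (a *: x + y)) &
  (forall (u : nat -> V) l, (forall n, K (u n)) -> inH l -> cvg_in H u l -> K l)].

(** The nearest point of [K] to [x]: a minimizing sequence is Cauchy by the
    parallelogram law, and minimality forces orthogonality. *)
Lemma orthogonal_projection (K : set V) x : closed_subspace K -> inH x ->
  exists2 p, K p & forall y, K y -> '[x - p, y] = 0.
Proof.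
move=> [KH K0 KL Kc] hx.
pose E := [set N (x - k) ^+ 2 | k in K].
have E0 : has_inf E.
  split; first by exists (N (x - 0) ^+ 2); exists 0.
  by exists 0 => _ [k _ <-]; rewrite exprn_ge0// hnorm_ge0.
pose d := inf E.
have dle k : K k -> d <= N (x - k) ^+ 2.
  by move=> Kk; apply: ge_inf; [case: E0|exists k].
have ap n : exists k, K k /\ N (x - k) ^+ 2 < d + n.+1%:R^-1.
  have [|_ [k Kk <-] h] := @inf_adherent _ E n.+1%:R^-1 _ E0.
    by rewrite invr_gt0.
  by exists k.
have {ap}[k hk] := choice ap.
have hkH n : inH (k n) by apply: KH; case: (hk n).
have kB m n : N (k m - k n) ^+ 2 <= 2 * (m.+1%:R^-1 + n.+1%:R^-1).
  have [Km hm] := hk m; have [Kn hn] := hk n.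
  (* The midpoint of [k m] and [k n] is no nearer to [x] than [d]. *)
  have Kmid : K (2^-1 *: k m + 2^-1 *: k n).
    by apply: (KL) => //; rewrite -[_ *: _]addr0; apply: (KL).
  have := dle _ Kmid.
  have := parallelogram (hsetB hx (hkH m)) (hsetB hx (hkH n)).
  rewrite (_ : x - k m - (x - k n) = - (k m - k n)); last first.
    by rewrite !opprB addrACA [x + _]addrC addrACA subrr addr0 addrC.
  rewrite (_ : x - k m + (x - k n) = 2%:R *: (x - (2^-1 *: k m + 2^-1 *: k n))).
    rewrite hnormN ?hnormZ; [|apply: hsetB => //|exact: hsetB]; last exact: KH.
    have -> : normc (2%:R : R[i]) = 2.
      by rewrite -(rmorph_nat (real_complex R)) normc_real normr_nat.
    rewrite exprMn; move: hm hn.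
    move: (N (x - k m) ^+ 2) (N (x - k n) ^+ 2) m.+1%:R^-1 n.+1%:R^-1 => u v w z.
    move: (N (k m - k n) ^+ 2) (N _ ^+ 2) => r o; lra.
  rewrite scalerBr scalerDr !scalerA divff ?pnatr_eq0// !scale1r.
  by rewrite scaler_nat mulr2n opprD addrACA.
have kC : cauchy_in H k.
  move=> e e0.
  have e2 : 0 < e ^+ 2 / 4 by rewrite divr_gt0// exprn_gt0.
  have [M hM] : exists M, forall n, (M <= n)%N -> n.+1%:R^-1 < e ^+ 2 / 4 :> R.
    have [M hM] := ltr_add_invr (y := 0) (x := e ^+ 2 / 4) e2.
    exists M => n Mn; rewrite add0r in hM; apply: le_lt_trans hM.
    by rewrite lef_pV2 ?posrE// ler_nat ltnS.
  exists M => m n Mm Mn.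
  rewrite -(@ltr_pXn2r _ 2)// ?nnegrE ?hnorm_ge0 ?ltW//.
  move: (kB m n) (hM _ Mm) (hM _ Mn); move: m.+1%:R^-1 n.+1%:R^-1 => s t; lra.
have [p hp kp] : exists2 l, inH l & cvg_in H k l by case: hH => _ _ _ _; apply.
have Kp : K p by apply: Kc kp => // n; case: (hk n).
have dp : N (x - p) ^+ 2 <= d.
  rewrite -[leRHS]sqr_sqrtr; last by apply: lb_le_inf; [case: E0|
     move=> _ [z _ <-]; rewrite exprn_ge0// hnorm_ge0].
  rewrite ler_pXn2r// ?nnegrE ?hnorm_ge0 ?sqrtr_ge0//.
  apply/ler_addgt0Pr => e e0.
  have d0 : 0 <= d by apply: lb_le_inf; [case: E0|
     move=> _ [z _ <-]; rewrite exprn_ge0// hnorm_ge0].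
  have /cvg_inP/(_ _ (divr_gt0 e0 (ltr0Sn _ 1)))[M hM] := kp.
  have e2 : 0 < (e / 2) ^+ 2 by rewrite exprn_gt0// divr_gt0.
  have [M' hM'] := ltr_add_invr (y := 0) (x := (e / 2) ^+ 2) e2.
  rewrite add0r in hM'.
  pose n := maxn M M'.
  have h1 := hM n (leq_maxl _ _).
  have [_ h2] := hk n; move: h2.
  have : n.+1%:R^-1 < (e / 2) ^+ 2 :> R.
    by apply: le_lt_trans hM'; rewrite lef_pV2 ?posrE// ler_nat ltnS leq_maxr.
  move: n.+1%:R^-1 => s h3 h2.
  have h4 : N (x - k n) < Num.sqrt d + e / 2.
    rewrite -(@ltr_pXn2r _ 2)// ?nnegrE ?hnorm_ge0 ?addr_ge0 ?sqrtr_ge0 ?divr_ge0 ?ltW//.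
    rewrite sqrrD [Num.sqrt d ^+ 2]sqr_sqrtr//.
    have : 0 <= Num.sqrt d * (e / 2) by rewrite mulr_ge0 ?sqrtr_ge0 ?divr_ge0 ?ltW//.
    lra.
  have := hnorm_dist hx (hkH n) hp; lra.
exists p => // y Ky; apply: eq0_normc.
(* Moving [p] by the multiple [t * '[x - p, y]] of [y] would bring it nearer to [x],
   since [t * N y ^+ 2 < 2], unless that multiple vanishes. *)
pose t := (N y ^+ 2 + 1)^-1.
have hy := KH _ Ky.
have := hnorm_sqrB_proj t (hsetB hx hp) hy.
set c := normc _.
have Kz : K (p + (t%:C * '[x - p, y]) *: y) by rewrite addrC; exact: KL.
have := dle _ Kz; rewrite opprD addrA => h1 h2.
have y0 : 0 <= N y ^+ 2 by rewrite exprn_ge0// hnorm_ge0.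
have t0 : 0 < t by rewrite invr_gt0; lra.
have ty : t * N y ^+ 2 <= 1.
  by rewrite /t mulrC ler_pdivrMr; lra.
have c0 : 0 <= c ^+ 2 by rewrite exprn_ge0// normc_ge0.
have h3 : t * c ^+ 2 * (2 - t * N y ^+ 2) <= 0 by nra.
have h4 : t * c ^+ 2 <= 0 by nra.
apply/eqP; rewrite -sqrf_eq0 eq_le c0 andbT.
by move: h4; rewrite pmulr_rle0.
Qed.

(** The representing vector is a multiple of one orthogonal to the kernel. *)
Lemma riesz (phi : V -> R[i]) (M : R) :
  (forall a x y, inH x -> inH y -> phi (a *: x + y) = a * phi x + phi y) ->
  (forall x, inH x -> normc (phi x) <= M * N x) ->
  exists2 y, inH y & forall x, inH x -> phi x = '[x, y].
Proof.
move=> phiL phiM.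
have phi0 : phi 0 = 0.
  have := phiM _ hset0; rewrite hnorm0 mulr0 => h; apply: eq0_normc.
  by apply/eqP; rewrite eq_le h normc_ge0.
have phiZ a x : inH x -> phi (a *: x) = a * phi x.
  by move=> hx; rewrite -[_ *: _]addr0 phiL ?phi0 ?addr0//; exact: hset0.
have phiB x y : inH x -> inH y -> phi (x - y) = phi x - phi y.
  by move=> hx hy; rewrite addrC -scaleN1r phiL// mulN1r addrC.
have [h0|/existsNP[x0 /not_implyP[hx0 nx0]]] :=
    pselect (forall x, inH x -> phi x = 0).
  by exists 0 => [|x hx]; [exact: hset0|rewrite h0// hdot0r].
pose K := [set x | inH x /\ phi x = 0].
have KC : closed_subspace K.
  split; first by move=> x [].
  - by split=> //; exact: hset0.
  - move=> a x y [hx px] [hy py]; split; first exact: hsetL.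
    by rewrite phiL// px py mulr0 addr0.
  move=> u l hu hl /cvg_inP ul; split=> //; apply: eq0_normc.
  apply/eqP; rewrite eq_le normc_ge0 andbT; apply/ler_addgt0Pr => e e0.
  have k0 : 0 < `|M| + 1 by have := normr_ge0 M; lra.
  have [n /(_ n (leqnn n)) hn] := ul _ (divr_gt0 e0 k0).
  have [hun pun] := hu n.
  have := phiM _ (hsetB hun hl); rewrite phiB// pun sub0r normcN add0r => h.
  apply: (le_trans h); apply: (@le_trans _ _ ((`|M| + 1) * N (u n - l))).
    by rewrite ler_wpM2r ?hnorm_ge0//; have := ler_norm M; lra.
  by move: hn; rewrite ltr_pdivlMr// mulrC => /ltW.
have [p [hp pp] orth] := orthogonal_projection KC hx0.
pose z := x0 - p; have hz : inH z by exact: hsetB.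
have pz : phi z = phi x0 by rewrite /z phiB// pp subr0.
have z0 : N z != 0.
  apply/eqP => /(hnorm0_eq0 hz) z0; apply: nx0.
  by rewrite -pz z0 phi0.
exists ((conjc (phi z) * ((N z ^+ 2)^-1)%:C) *: z); first exact: hsetZ.
move=> x hx.
have Kw : K (phi z *: x - phi x *: z).
  split; first by apply: hsetB; exact: hsetZ.
  rewrite phiB; [|exact: hsetZ|exact: hsetZ].
  by rewrite !phiZ// mulrC subrr.
have := orth _ Kw; rewrite -/z hdotBr ?hdotZr//; [|exact: hsetZ|exact: hsetZ].
rewrite hdot_self// => /eqP; rewrite subr_eq0 => /eqP /(congr1 conjc).
rewrite !conjcM !conjcK conjc_real -hdotC// => e.
rewrite conjc_real mulrAC e -mulrA -real_complexM.
by rewrite mulfV ?mulr1// expf_neq0.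
Qed.

End HilbertTheory.

Section AdjointTheory.
Variables (R : realType) (V W : lmodType R[i]).
Variables (H : preHilbert V) (K : preHilbert W).
Hypotheses (hH : is_hilbert H) (hK : is_hilbert K).
Implicit Types (A : V -> W) (B : W -> V).

Lemma bounded_linearE A : bounded_linear H K A ->
  [/\ forall x, hset H x -> hset K (A x), A 0 = 0,
      forall a x, hset H x -> A (a *: x) = a *: A x,
      forall x y, hset H x -> hset H y -> A (x + y) = A x + A y &
      forall x y, hset H x -> hset H y -> A (x - y) = A x - A y].
Proof.
move=> [AK AL _].
have h0 := hset0 hH.
have A0 : A 0 = 0.
  have := AL 1 0 0 h0 h0; rewrite !scale1r addr0 => /eqP.
  by rewrite -subr_eq subrr eq_sym => /eqP.
split=> // [a x hx|x y hx hy|x y hx hy].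
- by have := AL a x 0 hx h0; rewrite A0 !addr0.
- by have := AL 1 x y hx hy; rewrite !scale1r.
- by rewrite addrC -scaleN1r AL// scaleN1r addrC.
Qed.

Lemma bounded_linear_bound A : bounded_linear H K A ->
  exists2 M : R, 0 <= M & forall x, hset H x -> hnorm K (A x) <= M * hnorm H x.
Proof.
move=> [_ _ [M hM]]; exists `|M| => // x hx; apply: le_trans (hM _ hx) _.
by rewrite ler_wpM2r ?hnorm_ge0 ?ler_norm.
Qed.

Lemma bounded_linear_sum A (J : Type) (r : seq J) (u : J -> V) :
  bounded_linear H K A -> (forall i, hset H (u i)) ->
  A (\sum_(i <- r) u i) = \sum_(i <- r) A (u i).
Proof.
move=> /bounded_linearE[AK A0 _ AD _] hu.
elim: r => [|i r IH]; first by rewrite !big_nil.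
by rewrite !big_cons AD ?IH//; exact: hset_sum.
Qed.

Lemma bounded_linear_cvg A (u : nat -> V) l : bounded_linear H K A ->
  (forall n, hset H (u n)) -> hset H l -> cvg_in H u l ->
  cvg_in K (A \o u) (A l).
Proof.
move=> bA hu hl /cvg_inP ul; apply/cvg_inP => e e0.
have [_ _ _ _ AB] := bounded_linearE bA.
have [M M0 hM] := bounded_linear_bound bA.
have k0 : 0 < M + 1 by lra.
have [n hn] := ul _ (divr_gt0 e0 k0); exists n => m nm.
rewrite /= -AB//; apply: le_lt_trans (hM _ (hsetB hH (hu m) hl)) _.
have := hn _ nm; rewrite ltr_pdivlMr//; apply: le_lt_trans.
by rewrite mulrC ler_wpM2l ?hnorm_ge0//; lra.
Qed.

Lemma is_adjoint_unique A B B' : is_adjoint H K A B -> is_adjoint H K A B' ->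
  forall y, hset K y -> B y = B' y.
Proof.
move=> [[BH _ _] hB] [[BH' _ _] hB'] y hy.
apply/eqP; rewrite -subr_eq0; apply/eqP.
apply: (hdot_eq0_all hH); first by apply: (hsetB hH); [exact: BH|exact: BH'].
move=> x hx; rewrite (hdotC hH hx); last by apply: (hsetB hH); [exact: BH|exact: BH'].
rewrite (hdotBr hH)//; [|exact: BH|exact: BH'].
by rewrite -hB// -hB'// subrr rmorph0.
Qed.

(** Riesz representation of the functionals [x |-> <A x, y>]; uniqueness of the
    representing vectors makes them linear in [y]. *)
Lemma ex_adjoint A : bounded_linear H K A -> exists B, is_adjoint H K A B.
Proof.
move=> bA; have [AK _ _ _ _] := bounded_linearE bA.
have [M M0 hM] := bounded_linear_bound bA.
have ex y : exists z, hset K y ->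
    hset H z /\ forall x, hset H x -> hdot K (A x) y = hdot H x z.
  have [hy|nhy] := pselect (hset K y); last by exists 0.
  have [||z hz h] := @riesz _ _ H hH (fun x => hdot K (A x) y) (M * hnorm K y).
  - move=> a x1 x2 h1 h2; case: bA => _ -> // _.
    by rewrite (hdotL hK)//; exact: AK.
  - move=> x hx; apply: (le_trans (cauchy_schwarz hK (AK _ hx) hy)).
    by rewrite mulrAC ler_wpM2r ?hnorm_ge0//; exact: hM.
  by exists z => _; split.
have [B hB] := choice ex.
have BH y : hset K y -> hset H (B y) by move=> /hB[].
have adj x y : hset H x -> hset K y -> hdot K (A x) y = hdot H x (B y).
  by move=> hx /hB[_]; apply.
exists B; split=> //; split=> //.
  move=> a x y hx hy.
  have hxy := hsetL hK a hx hy.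
  apply/eqP; rewrite -subr_eq0; apply/eqP; apply: (hdot_eq0_all hH).
    by apply: (hsetB hH); [exact: BH|apply: (hsetL hH); exact: BH].
  move=> z hz; have h1 := BH _ hx; have h2 := BH _ hy; have h3 := BH _ hxy.
  have h4 := hsetL hH a h1 h2.
  rewrite (hdotC hH hz (hsetB hH h3 h4)) (hdotBr hH h3 h4 hz).
  rewrite (hdotDr hH (hsetZ hH a h1) h2 hz) (hdotZr hH a h1 hz) -!adj//.
  rewrite (hdotDr hK (hsetZ hK a hx) hy (AK _ hz)) (hdotZr hK a hx (AK _ hz)).
  by rewrite subrr rmorph0.
exists M => y hy; have hBy := BH _ hy.
have [->|n0] := eqVneq (hnorm H (B y)) 0; first by rewrite mulr_ge0 ?hnorm_ge0.
have np : 0 < hnorm H (B y) by rewrite lt_def n0 hnorm_ge0.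
rewrite -(ler_pM2r np) -expr2 (hnorm_sqr hH)// -adj//.
apply: le_trans (ler_norm _) _; apply: le_trans (Re_le_normc _) _.
apply: le_trans (cauchy_schwarz hK (AK _ hBy) hy) _.
by rewrite mulrAC ler_wpM2r ?hnorm_ge0//; exact: hM.
Qed.

Lemma adjointP A : bounded_linear H K A -> is_adjoint H K A (adjoint H K A).
Proof.
move=> /ex_adjoint[B hB]; rewrite /adjoint; case: xgetP => [B' _ //|/(_ B)].
by move=> /(_ hB).
Qed.

Lemma adjoint_eq A B : is_adjoint H K A B ->
  forall y, hset K y -> adjoint H K A y = B y.
Proof.
move=> hB y hy; rewrite /adjoint; case: xgetP => [B' _ hB'|/(_ B)/(_ hB)//].
exact: (is_adjoint_unique hB' hB).
Qed.

End AdjointTheory.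


(** * Square-summable functions *)

Section RealCauchy.
Variable R : realType.

Lemma real_cauchy_cvg (x : nat -> R) :
  (forall e : R, 0 < e -> exists M, forall m n, (M <= m)%N -> (M <= n)%N ->
     `|x m - x n| < e) ->
  exists l, forall e : R, 0 < e -> exists M, forall n, (M <= n)%N -> `|x n - l| < e.
Proof.
move=> hx.
have /cauchy_cvgP : cauchy (x @ \oo).
  apply/cauchy_ballP => e e0; have [M hM] := hx _ e0.
  exists (x @` [set n | (M <= n)%N], x @` [set n | (M <= n)%N]) => /=.
    by split; exists M => // n Mn; exists n.
  by move=> [_ _] /= [[m Mm <-] [n Mn <-]]; rewrite /ball/=; exact: hM.
move=> /cvg_ex[l /cvgrPdist_lt hl]; exists l => e e0.
have [M _ hM] := hl _ e0; exists M => n Mn.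
by rewrite distrC; exact: hM.
Qed.

Lemma complex_cauchy_cvg (x : nat -> R[i]) :
  (forall e : R, 0 < e -> exists M, forall m n, (M <= m)%N -> (M <= n)%N ->
     normc (x m - x n) < e) ->
  exists l, forall e : R, 0 < e -> exists M, forall n, (M <= n)%N -> normc (x n - l) < e.
Proof.
move=> hx.
have [|a ha] := @real_cauchy_cvg (fun n => complex.Re (x n)).
  move=> e /hx[M hM]; exists M => m n Mm Mn.
  by apply: le_lt_trans (hM _ _ Mm Mn); rewrite -raddfB; exact: Re_le_normc.
have [|b hb] := @real_cauchy_cvg (fun n => complex.Im (x n)).
  move=> e /hx[M hM]; exists M => m n Mm Mn.
  by apply: le_lt_trans (hM _ _ Mm Mn); rewrite -raddfB; exact: Im_le_normc.
exists (a +i* b) => e e0.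
have [M hM] := ha _ (divr_gt0 e0 (ltr0Sn _ 1)).
have [N hN] := hb _ (divr_gt0 e0 (ltr0Sn _ 1)).
exists (maxn M N) => n; rewrite geq_max => /andP[/hM h1 /hN h2].
rewrite (_ : x n - (a +i* b) = (complex.Re (x n) - a)%:C + 'i * (complex.Im (x n) - b)%:C).
  apply: le_lt_trans (le_normcD _ _) _; rewrite normcM !normc_real.
  rewrite (_ : normc 'i = 1) ?mul1r; first by move: h1 h2; lra.
  by rewrite /= expr0n expr1n/= add0r sqrtr1.
by case: (x n) => u v; rewrite /real_complex_def/=; simpc.
Qed.

End RealCauchy.

(** Lower semicontinuity of finite sums under termwise limits: through it the
    estimates on Cauchy sequences of square-summable families pass to the limit. *)
Lemma finite_sum_limit_le (R : realType) (I : choiceType) (A : {fset I})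
    (x : nat -> I -> R) (l : I -> R) (B : R) :
  (forall t c, 0 < c -> exists M, forall m, (M <= m)%N -> l t <= x m t + c) ->
  (exists M, forall m, (M <= m)%N -> \sum_(t <- A) x m t <= B) ->
  \sum_(t <- A) l t <= B.
Proof.
move=> hl [M hM]; apply/ler_addgt0Pr => d d0.
have c0 : 0 < d / (#|` A|.+1%:R) by rewrite divr_gt0.
have /choice[K hK] : forall t, exists K, forall m, (K <= m)%N ->
    l t <= x m t + d / (#|` A|.+1%:R) by move=> t; exact: hl.
pose m := maxn M (\max_(t <- A) K t)%N.
apply: (@le_trans _ _ (\sum_(t <- A) (x m t + d / (#|` A|.+1%:R)))).
  rewrite big_seq [leRHS]big_seq; apply: ler_sum => t tA; apply: hK.
  by apply: leq_trans (leq_maxr _ _); exact: leq_bigmax_seq.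
rewrite big_split/= lerD ?hM ?leq_maxl// big_const_seq iter_addr_0 count_predT.
rewrite -[_ *+ _]mulr_natr mulrAC ler_pdivrMr//.
by apply: ler_wpM2l; [exact: ltW|rewrite ler_nat leqnSn].
Qed.

Lemma sqr_le_perturb (R : realType) (b x y c : R) : 0 <= b -> 0 <= x -> 0 <= y ->
  b <= x + y -> y * (2 * b + 1) < c -> b ^+ 2 <= x ^+ 2 + c.
Proof. by move=> b0 x0 y0 bxy yc; have [bx|bx] := leP b x; nra. Qed.

Section L2Theory.
Variables (R : realType) (I : choiceType).
Implicit Types (f g h : ell2 R I) (t s : I).
Local Notation L2 := (L2 R I).
Local Notation N := (hnorm L2).

Lemma ell2_ext f g : (forall t, f t = g t) -> f = g.
Proof. by move=> h; apply/val_inj/funext. Qed.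

Lemma ell2D f g t : (f + g) t = f t + g t. Proof. by []. Qed.
Lemma ell2N f t : (- f) t = - f t. Proof. by []. Qed.
Lemma ell2B f g t : (f - g) t = f t - g t. Proof. by []. Qed.
Lemma ell2Z (a : R[i]) f t : (a *: f) t = a * f t. Proof. by []. Qed.
Lemma ell20 t : (0 : ell2 R I) t = 0. Proof. by []. Qed.
Lemma ell2_sum (J : Type) (r : seq J) (P : pred J) (u : J -> ell2 R I) t :
  (\sum_(i <- r | P i) u i) t = \sum_(i <- r | P i) u i t.
Proof. by elim/big_rec2 : _ => // i x y _ <-. Qed.
Lemma chiE s t : chi R s t = (t == s)%:R. Proof. by []. Qed.

Lemma sqr_normc_ge0 (z : R[i]) : 0 <= normc z ^+ 2.
Proof. by rewrite exprn_ge0// normc_ge0. Qed.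

Lemma ell2_summable f : summable_nneg (fun t => normc (f t) ^+ 2).
Proof. by have /asboolP := ell2P f. Qed.

Lemma ell2_abs_summable f g : abs_summable (fun t => f t * conjc (g t)).
Proof.
have := @summable_nneg_bound _ _ (fun t => normc (f t * conjc (g t)))
  (nnegsum (fun t => normc (f t) ^+ 2) + nnegsum (fun t => normc (g t) ^+ 2)).
apply => A.
have h1 := nnegsum_ge A (fun t => sqr_normc_ge0 (f t)) (ell2_summable f).
have h2 := nnegsum_ge A (fun t => sqr_normc_ge0 (g t)) (ell2_summable g).
apply: le_trans (lerD h1 h2); rewrite -big_split/=; apply: ler_sum => t _.
rewrite normcM normcJ.
have := normc_ge0 (f t); have := normc_ge0 (g t).
have := sqr_ge0 (normc (f t) - normc (g t)); nra.
Qed.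

Lemma ell2_has_sum f g : has_sum (fun t => f t * conjc (g t)) (hdot L2 f g).
Proof. exact: abs_summable_has_sum (ell2_abs_summable f g). Qed.

Lemma ell2_dot_self f : hdot L2 f f = (nnegsum (fun t => normc (f t) ^+ 2))%:C.
Proof.
rewrite /= -csum_nneg; [|by move=> t; exact: sqr_normc_ge0|exact: ell2_summable].
by apply: csum_ext => t; rewrite mulcJ.
Qed.

Lemma ell2_norm f : N f ^+ 2 = nnegsum (fun t => normc (f t) ^+ 2).
Proof.
rewrite /hnorm ell2_dot_self sqr_sqrtr//.
by apply: nnegsum_ge0 => t; exact: sqr_normc_ge0.
Qed.

Lemma ell2_coord_le f t : normc (f t) <= N f.
Proof.
rewrite -(@ler_pXn2r _ 2)// ?nnegrE ?hnorm_ge0 ?normc_ge0// ell2_norm.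
apply: (nnegsum_ge1 (p := fun t => normc (f t) ^+ 2)) => [t'|].
  exact: sqr_normc_ge0.
exact: ell2_summable.
Qed.

Lemma ell2_sum_le f (A : {fset I}) : \sum_(t <- A) normc (f t) ^+ 2 <= N f ^+ 2.
Proof.
rewrite ell2_norm; apply: nnegsum_ge; last exact: ell2_summable.
by move=> t; exact: sqr_normc_ge0.
Qed.

Lemma ell2_norm_le f (M : R) :
  (forall A : {fset I}, \sum_(t <- A) normc (f t) ^+ 2 <= M) -> N f ^+ 2 <= M.
Proof.
by move=> h; rewrite ell2_norm; apply: nnegsum_le => // t; exact: sqr_normc_ge0.
Qed.

Definition mkell2 (f : I -> R[i]) : ell2 R I := insubd 0 f.

Lemma mkell2E (f : I -> R[i]) (M : R) :
  (forall A : {fset I}, \sum_(t <- A) normc (f t) ^+ 2 <= M) ->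
  forall t, mkell2 f t = f t.
Proof.
move=> h t; rewrite /mkell2 /insubd insubT//.
by apply/asboolP; exact: (summable_nneg_bound h).
Qed.

(** Completeness: a Cauchy sequence converges coordinatewise, and the bounds on
    finite partial sums pass to the coordinatewise limit. *)
Lemma L2_hilbert : is_hilbert L2.
Proof.
split=> //.
- move=> a f g h _ _ _; apply: has_sum_csum.
  have := has_sumD (has_sumZ a (ell2_has_sum f h)) (ell2_has_sum g h).
  by congr has_sum; apply/funext => t; rewrite ell2D ell2Z mulrDl mulrA.
- move=> f g _ _; apply: has_sum_csum.
  have := has_sumJ (ell2_has_sum f g); congr has_sum.
  by apply/funext => t; rewrite conjcM conjcK mulrC.
- move=> f _; rewrite ell2_dot_self; split.
    by rewrite lecR nnegsum_ge0// => t; exact: sqr_normc_ge0.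
  move=> -[h]; apply: ell2_ext => t; rewrite ell20; apply: eq0_normc; apply/eqP.
  rewrite -sqrf_eq0 eq_le sqr_normc_ge0 andbT -h.
  apply: (nnegsum_ge1 (p := fun t => normc (f t) ^+ 2)) => [t'|].
    exact: sqr_normc_ge0.
  exact: ell2_summable.
move=> u _ uC.
have [l hl] : exists l : I -> R[i], forall t, forall e : R, 0 < e ->
    exists M, forall n, (M <= n)%N -> normc (u n t - l t) < e.
  suff /choice[l hl] : forall t, exists l : R[i], forall e : R, 0 < e ->
    exists M, forall n, (M <= n)%N -> normc (u n t - l) < e by exists l.
  move=> t; apply: complex_cauchy_cvg => e /uC[M hM]; exists M => m n Mm Mn.
  by apply: le_lt_trans (hM _ _ Mm Mn); exact: (ell2_coord_le (u m - u n) t).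
have key (e : R) : 0 < e -> exists M, forall n, (M <= n)%N -> forall A : {fset I},
    \sum_(t <- A) normc (u n t - l t) ^+ 2 <= e ^+ 2.
  move=> e0; have [M hM] := uC _ e0; exists M => n Mn A.
  apply: (finite_sum_limit_le (x := fun m t => normc (u n t - u m t) ^+ 2)).
    move=> t c c0; pose b := normc (u n t - l t).
    have b0 : 0 <= b by exact: normc_ge0.
    have e1 : 0 < c / (2 * b + 1) by rewrite divr_gt0//; lra.
    have [K hK] := hl t _ e1; exists K => m Km.
    have := hK _ Km; rewrite ltr_pdivlMr; last lra.
    have := le_normcD (u n t - u m t) (u m t - l t).
    rewrite [u n t - u m t + _]addrA subrK -/b.
    exact: sqr_le_perturb b0 (normc_ge0 _) (normc_ge0 _).
  exists M => m Mm; apply: le_trans (ell2_sum_le (u n - u m) A) _.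
  by rewrite lerXn2r// ?nnegrE ?hnorm_ge0 ?ltW//; exact: hM.
have [M1 hM1] := key _ ltr01.
have lE : forall t, mkell2 (fun t => u M1 t - l t) t = u M1 t - l t.
  exact: (mkell2E (hM1 _ (leqnn _))).
pose L := u M1 - mkell2 (fun t => u M1 t - l t).
have LE t : L t = l t by rewrite /L ell2B lE subKr.
exists L => //; apply/cvg_inP => e e0.
have e2 := divr_gt0 e0 (ltr0Sn R 1).
have [M hM] := key _ e2; exists M => n Mn.
apply: (@le_lt_trans _ _ (e / 2)); last by lra.
rewrite -(@ler_pXn2r _ 2)// ?nnegrE ?hnorm_ge0//; last exact: ltW.
apply: ell2_norm_le => A; apply: le_trans (hM _ Mn A).
by apply: ler_sum => t _; rewrite ell2B LE.
Qed.

Let hL := L2_hilbert.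

Lemma dot_chi f t : hdot L2 f (chi R t) = f t.
Proof.
rewrite [LHS](_ : _ = csum (fun s => f s * conjc (chi R t s)))//.
rewrite (@csum_single _ _ t).
  by rewrite chiE eqxx rmorph1 mulr1.
by move=> s /negPf st; rewrite chiE st rmorph0 mulr0.
Qed.

Lemma norm_chi t : N (chi R t) = 1.
Proof.
by rewrite /hnorm dot_chi chiE eqxx/= sqrtr1.
Qed.

Lemma ell2_cvg_coord (u : nat -> ell2 R I) f t c : cvg_in L2 u f ->
  (exists M, forall n, (M <= n)%N -> u n t = c) -> f t = c.
Proof.
move=> uf h; rewrite -dot_chi; apply: (cvg_in_dot_eq hL _ _ _ uf) => //.
by case: h => M h; exists M => n /h <-; rewrite dot_chi.
Qed.

Definition restr (D : pred I) f : ell2 R I := mkell2 (fun t => if D t then f t else 0).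

Lemma restrE D f t : restr D f t = if D t then f t else 0.
Proof.
apply: (@mkell2E _ (N f ^+ 2)) => A; apply: le_trans (ell2_sum_le f A).
by apply: ler_sum => s _; case: ifP => // _; rewrite normc0 expr0n sqr_normc_ge0.
Qed.

Lemma restr_lin D (a : R[i]) f g : restr D (a *: f + g) = a *: restr D f + restr D g.
Proof.
apply: ell2_ext => t; rewrite ell2D ell2Z !restrE; case: ifP => // _.
by rewrite mulr0 addr0.
Qed.

Lemma restr_norm D f : N (restr D f) <= N f.
Proof.
rewrite -(@ler_pXn2r _ 2)// ?nnegrE ?hnorm_ge0//; apply: ell2_norm_le => A.
apply: le_trans (ell2_sum_le f A); apply: ler_sum => s _; rewrite restrE.
by case: ifP => // _; rewrite normc0 expr0n sqr_normc_ge0.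
Qed.

Lemma dot_disjoint f g : (forall t, f t = 0 \/ g t = 0) -> hdot L2 f g = 0.
Proof.
move=> fg; rewrite /= (_ : (fun t => _) = fun=> 0).
  by apply: has_sum_csum; have := @has_sum_fset R I fset0 (fun=> 0); rewrite big_seq_fset0; exact.
by apply/funext => t; case: (fg t) => ->; rewrite ?rmorph0 ?mulr0 ?mul0r.
Qed.

Lemma norm_disjoint_sum (J : eqType) (r : seq J) (u : J -> ell2 R I) : uniq r ->
  (forall i j t, i != j -> u i t = 0 \/ u j t = 0) ->
  N (\sum_(i <- r) u i) ^+ 2 = \sum_(i <- r) N (u i) ^+ 2.
Proof.
move=> + hu; elim: r => [|i r IH] /=; first by rewrite !big_nil hnorm0 ?expr0n.
move=> /andP[ir ur]; rewrite !big_cons (hnorm_pythagoras hL)// ?IH//.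
apply: dot_disjoint => t.
have [->|n0] := eqVneq (u i t) 0; [by left|right].
rewrite ell2_sum big1_seq// => j /= jr.
have ij : i != j by apply: contra ir => /eqP ->.
by case: (hu i j t ij) => // e; rewrite e eqxx in n0.
Qed.

End L2Theory.

Arguments L2 : simpl never.
Arguments chi : simpl never.

(** * Bounded operators *)

Section BoundedOperators.
Variables (R : realType) (T : choiceType).
Implicit Types (f g : ell2 R T) (t s : T) (S X Y : op R T) (a : R[i]).
Local Notation L2 := (L2 R T).
Local Notation N := (hnorm L2).
Local Notation chi := (chi R).
Local Notation dot := (hdot L2).
Let hL := L2_hilbert R T.
Let BL X := @bounded_linearE _ _ _ L2 L2 (L2_hilbert R T) X.

Lemma ell2_norm_ge0 f : 0 <= N f. Proof. exact: hnorm_ge0. Qed.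
Lemma ell2_normD f g : N (f + g) <= N f + N g. Proof. exact: (hnormD hL). Qed.
Lemma ell2_normB f g : N (f - g) <= N f + N g. Proof. exact: (hnormB hL). Qed.
Lemma ell2_normZ a f : N (a *: f) = normc a * N f. Proof. exact: (hnormZ hL). Qed.
Lemma ell2_norm0 : N 0 = 0. Proof. exact: (hnorm0 hL). Qed.
Lemma ell2_dotC f g : dot g f = conjc (dot f g). Proof. exact: (hdotC hL). Qed.

Lemma op_linear X a f g : bounded_op X -> X (a *: f + g) = a *: X f + X g.
Proof. by case=> _ h _; exact: h. Qed.

Lemma opD X f g : bounded_op X -> X (f + g) = X f + X g.
Proof. by move=> /BL[_ _ _ h _]; exact: h. Qed.
Lemma opB X f g : bounded_op X -> X (f - g) = X f - X g.
Proof. by move=> /BL[_ _ _ _ h]; exact: h. Qed.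
Lemma opZ X a f : bounded_op X -> X (a *: f) = a *: X f.
Proof. by move=> /BL[_ _ h _ _]; exact: h. Qed.
Lemma op0 X : bounded_op X -> X 0 = 0.
Proof. by move=> /BL[_ h _ _ _]; exact: h. Qed.
Lemma op_sum X (J : Type) (r : seq J) (u : J -> ell2 R T) : bounded_op X ->
  X (\sum_(i <- r) u i) = \sum_(i <- r) X (u i).
Proof. by move=> bX; apply: (bounded_linear_sum hL _ bX). Qed.

Lemma bounded_opI X (M : R) :
  (forall a f g, X (a *: f + g) = a *: X f + X g) ->
  (forall f, N (X f) <= M * N f) -> bounded_op X.
Proof. by move=> hX hM; split=> //; exists M. Qed.

Lemma norm_op_ub X (M : R) : 0 <= M -> (forall f, N (X f) <= M * N f) ->
  norm_op X <= M.
Proof.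
move=> M0 hM; apply: ge_sup => [|_ [f /= [_ f1] <-]].
  by exists (N (X 0)); exists 0 => //=; split => //; rewrite ell2_norm0.
by apply: (le_trans (hM f)); rewrite -[leRHS]mulr1 ler_wpM2l.
Qed.

Lemma norm_op_le X f : bounded_op X -> N (X f) <= norm_op X * N f.
Proof.
move=> bX; have [M M0 hM] := bounded_linear_bound bX.
have [f0|f0] := eqVneq (N f) 0.
  by rewrite (hnorm0_eq0 hL _ f0)// op0// ell2_norm0 mulr0.
have fp : 0 < N f by rewrite lt_def f0 ell2_norm_ge0.
have fi : 0 <= (N f)^-1 by rewrite invr_ge0 ltW.
rewrite -ler_pdivrMr//.
have -> : N (X f) / N f = N (X ((N f)^-1%:C *: f)).
  rewrite opZ// ell2_normZ normc_real ger0_norm//.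
  by rewrite mulrC.
apply: ub_le_sup.
  exists M => _ [g /= [_ g1] <-].
  by apply: (le_trans (hM g I)); rewrite -[leRHS]mulr1 ler_wpM2l.
exists ((N f)^-1%:C *: f); last by [].
split; first by [].
by rewrite ell2_normZ normc_real ger0_norm// mulVf.
Qed.

Lemma norm_op_ge0 X : bounded_op X -> 0 <= norm_op X.
Proof.
move=> bX; have [M M0 hM] := bounded_linear_bound bX.
apply: ub_le_sup.
  exists M => _ [g /= [_ g1] <-].
  by apply: (le_trans (hM g I)); rewrite -[leRHS]mulr1 ler_wpM2l.
exists (0 : ell2 R T); last by rewrite op0// ell2_norm0.
by split; rewrite // ell2_norm0.
Qed.

Lemma bounded_id : bounded_op (idfun : op R T).
Proof. by apply: (@bounded_opI _ 1) => // f; rewrite mul1r. Qed.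

Lemma bounded_comp X Y : bounded_op X -> bounded_op Y -> bounded_op (X \o Y).
Proof.
move=> bX bY; apply: (@bounded_opI _ (norm_op X * norm_op Y)) => [a f g|f] /=.
  by rewrite !op_linear.
apply: (le_trans (norm_op_le _ bX)); rewrite -mulrA ler_wpM2l//.
  exact: norm_op_ge0.
exact: norm_op_le.
Qed.

Lemma bounded_add X Y : bounded_op X -> bounded_op Y -> bounded_op (X + Y).
Proof.
move=> bX bY; apply: (@bounded_opI _ (norm_op X + norm_op Y)) => [a f g|f].
  have E h : (X + Y) h = X h + Y h by [].
  by rewrite !E (op_linear a f g bX) (op_linear a f g bY) scalerDr addrACA.
rewrite [Z in N Z](_ : _ = X f + Y f)// mulrDl.
by apply: le_trans (ell2_normD _ _) _; rewrite lerD ?norm_op_le.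
Qed.

Lemma bounded_scale a X : bounded_op X -> bounded_op (a *: X).
Proof.
move=> bX; apply: (@bounded_opI _ (normc a * norm_op X)) => [b f g|f].
  have E h : (a *: X) h = a *: X h by [].
  by rewrite !E (op_linear b f g bX) scalerDr !scalerA mulrC.
by rewrite [Z in N Z](_ : _ = a *: X f)// ell2_normZ -mulrA ler_wpM2l ?normc_ge0 ?norm_op_le.
Qed.

Lemma bounded_opp X : bounded_op X -> bounded_op (- X).
Proof. by rewrite -scaleN1r; exact: bounded_scale. Qed.

Lemma bounded_sub X Y : bounded_op X -> bounded_op Y -> bounded_op (X - Y).
Proof. by move=> bX bY; apply: bounded_add => //; exact: bounded_opp. Qed.

Lemma bounded_zero : bounded_op (0 : op R T).
Proof. by have := bounded_scale 0 bounded_id; rewrite scale0r. Qed.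

Lemma bounded_sum (J : Type) (r : seq J) (P : pred J) (u : J -> op R T) :
  (forall i, P i -> bounded_op (u i)) -> bounded_op (\sum_(i <- r | P i) u i).
Proof.
by move=> hu; apply: big_ind => //; [exact: bounded_zero|exact: bounded_add].
Qed.

Lemma bounded_iter X n : bounded_op X -> bounded_op (iter n X).
Proof.
move=> bX; elim: n => [|n IH]; first exact: bounded_id.
exact: bounded_comp bX IH.
Qed.

Lemma sum_opE (J : Type) (r : seq J) (P : pred J) (u : J -> op R T) f :
  (\sum_(i <- r | P i) u i) f = \sum_(i <- r | P i) u i f.
Proof. by elim/big_rec2 : _ => // i x y _ <-. Qed.

Lemma adj_is_adjoint X : bounded_op X -> is_adjoint L2 L2 X (adj X).
Proof. exact: (adjointP hL hL). Qed.

Lemma bounded_adj X : bounded_op X -> bounded_op (adj X).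
Proof. by move=> /adj_is_adjoint[]. Qed.

Lemma adjE X f g : bounded_op X -> dot (X f) g = dot f (adj X g).
Proof. by move=> /adj_is_adjoint[_]; apply. Qed.

Lemma adjE' X f g : bounded_op X -> dot (adj X f) g = dot f (X g).
Proof. by move=> bX; rewrite ell2_dotC -adjE// -ell2_dotC. Qed.

Lemma ell2_dot_ext f g : (forall h, dot h f = dot h g) -> f = g.
Proof.
move=> h; apply/eqP; rewrite -subr_eq0; apply/eqP; apply: (hdot_eq0_all hL) => // k _.
by rewrite ell2_dotC (hdotBr hL)// h subrr rmorph0.
Qed.

Lemma adj_unique X Y : bounded_op X -> (forall f g, dot (X f) g = dot f (Y g)) ->
  adj X = Y.
Proof.
by move=> bX h; apply/funext => g; apply: ell2_dot_ext => k; rewrite -adjE// h.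
Qed.

Lemma adjK X : bounded_op X -> adj (adj X) = X.
Proof. by move=> bX; apply: adj_unique; [exact: bounded_adj|move=> f g; exact: adjE']. Qed.

Lemma adj_comp X Y : bounded_op X -> bounded_op Y -> adj (X \o Y) = adj Y \o adj X.
Proof.
move=> bX bY; apply: adj_unique; [exact: bounded_comp|move=> f g].
have h1 := adjE (Y f) g bX; have h2 := adjE f (adj X g) bY.
exact: etrans h1 h2.
Qed.

Lemma adj_id : adj (idfun : op R T) = idfun.
Proof. by apply: adj_unique => //; exact: bounded_id. Qed.

Lemma adj_sub X Y : bounded_op X -> bounded_op Y -> adj (X - Y) = adj X - adj Y.
Proof.
move=> bX bY; apply: adj_unique => [|f g]; first exact: bounded_sub.
have E (A B : op R T) h : (A - B) h = A h - B h by [].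
by rewrite !E (hdotBl hL)// (hdotBr hL)// (adjE _ _ bX) (adjE _ _ bY).
Qed.

Lemma adj_iter X n : bounded_op X -> adj (iter n X) = iter n (adj X).
Proof.
move=> bX; elim: n => [|n IH]; first exact: adj_id.
rewrite (_ : iter n.+1 X = iter n X \o X).
  by rewrite adj_comp ?IH//; exact: bounded_iter.
by apply/funext => f; rewrite iterSr.
Qed.

Lemma norm_adj_le X (M : R) : bounded_op X -> (forall f, N (X f) <= M * N f) ->
  forall f, N (adj X f) <= M * N f.
Proof.
move=> bX hM f.
have [->|n0] := eqVneq (N (adj X f)) 0.
  by apply: le_trans (hM f); exact: ell2_norm_ge0.
have np : 0 < N (adj X f) by rewrite lt_def n0 ell2_norm_ge0.
rewrite -(ler_pM2r np) -expr2 (hnorm_sqr hL)// adjE'//.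
apply: le_trans (ler_norm _) _; apply: le_trans (Re_le_normc _) _.
apply: (le_trans (cauchy_schwarz hL _ _)) => //.
by rewrite mulrC mulrAC ler_wpM2r ?ell2_norm_ge0.
Qed.

Lemma op_coordE X f t : bounded_op X -> X f t = dot f (adj X (chi t)).
Proof. by move=> bX; rewrite -adjE// dot_chi. Qed.

Lemma adj_entry X s t : bounded_op X -> adj X (chi t) s = conjc (X (chi s) t).
Proof.
by move=> bX; rewrite -dot_chi ell2_dotC -adjE// dot_chi.
Qed.

Lemma op_coord0 X f t : bounded_op X ->
  (forall s, f s = 0 \/ X (chi s) t = 0) -> X f t = 0.
Proof.
move=> bX h; rewrite op_coordE//; apply: dot_disjoint => s.
by case: (h s) => e; [left|right]; rewrite // adj_entry// e rmorph0.
Qed.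

(** The coordinates of [X f] are the inner products of [f] with the vectors
    [adj X (chi t)], whose coordinates are conjugates of entries of [X]. *)
Lemma op_ext X Y : bounded_op X -> bounded_op Y ->
  (forall s t, X (chi s) t = Y (chi s) t) -> X = Y.
Proof.
move=> bX bY h; apply/funext => f; apply: ell2_ext => t.
rewrite (op_coordE f t bX) (op_coordE f t bY); congr dot; apply: ell2_ext => s.
by rewrite !adj_entry// h.
Qed.

Definition rank1 f t : op R T := fun g => g t *: f.

Lemma bounded_rank1 f t : bounded_op (rank1 f t).
Proof.
apply: (@bounded_opI _ (N f)) => [a g h|g]; rewrite /rank1.
  by rewrite ell2D ell2Z scalerDl scalerA.
by rewrite ell2_normZ mulrC ler_wpM2l ?ell2_norm_ge0 ?ell2_coord_le.
Qed.

Lemma rank1_chi f t s : rank1 f t (chi s) = if t == s then f else 0.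
Proof. by rewrite /rank1 chiE; case: eqP => _; rewrite ?scale1r ?scale0r. Qed.

End BoundedOperators.

Section GeometricSeries.
Variable R : realType.
Implicit Types (M r e : R).

Lemma geometric_small M r e : 0 <= r -> r < 1 -> 0 < e ->
  exists K, forall n, (K <= n)%N -> M * r ^+ n < e.
Proof.
move=> r0 r1 e0.
have : (fun n => M * r ^+ n) @ \oo --> (0 : R).
  by have := @cvg_geometric R M r; apply; rewrite ger0_norm.
move=> /cvgrPdist_lt/(_ _ e0)[K _ hK]; exists K => n /hK/=.
by rewrite sub0r normrN; apply: le_lt_trans; exact: ler_norm.
Qed.

Lemma geometric_sum r n : (1 - r) * \sum_(i < n) r ^+ i = 1 - r ^+ n.
Proof.
elim: n => [|n IH]; first by rewrite big_ord0 mulr0 expr0 subrr.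
by rewrite big_ord_recr/= mulrDr IH exprS; ring.
Qed.

Lemma geometric_sum_le r n : 0 <= r -> r < 1 -> \sum_(i < n) r ^+ i <= (1 - r)^-1.
Proof.
move=> r0 r1; have r1' : 0 < 1 - r by lra.
rewrite -(ler_pM2l r1') geometric_sum mulfV ?gt_eqF//.
by have := exprn_ge0 n r0; lra.
Qed.

Variables (V : lmodType R[i]) (H : preHilbert V).
Hypothesis hH : is_hilbert H.

Lemma geometric_series_cvg (u : nat -> V) M r : 0 <= r -> r < 1 ->
  (forall n, hset H (u n)) -> (forall n, hnorm H (u n) <= M * r ^+ n) ->
  exists2 l, hset H l & cvg_in H (fun n => \sum_(i < n) u i) l /\
    hnorm H l <= M / (1 - r).
Proof.
move=> r0 r1 hu hM; have r1' : 0 < 1 - r by lra.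
have M0 : 0 <= M by have := hM 0%N; rewrite expr0 mulr1; apply: le_trans; exact: hnorm_ge0.
have hS n : hset H (\sum_(i < n) u i) by exact: (hset_sum hH).
have hb m n : hnorm H (\sum_(i < n) u (m + i)%N) <= M / (1 - r) * r ^+ m.
  apply: (le_trans (hnorm_sum hH _ _)) => //.
  apply: (@le_trans _ _ (\sum_(i < n) M * r ^+ m * r ^+ i)).
    by apply: ler_sum => i _; rewrite -mulrA -exprD.
  rewrite -mulr_sumr [leRHS]mulrAC; apply: ler_wpM2l; last exact: geometric_sum_le.
  by rewrite mulr_ge0 ?exprn_ge0.
have hd m n : hnorm H (\sum_(i < m + n) u i - \sum_(i < m) u i) <= M / (1 - r) * r ^+ m.
  by rewrite big_split_ord addrAC subrr add0r; exact: hb.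
have [l hl ul] : exists2 l, hset H l & cvg_in H (fun n => \sum_(i < n) u i) l.
  case: hH => _ _ _ _; apply=> //.
  move=> e e0; have [K hK] := geometric_small (M / (1 - r)) r0 r1 (divr_gt0 e0 (ltr0Sn R 1)).
  exists K => m n Km Kn.
  have := hd K (m - K)%N; have := hd K (n - K)%N; rewrite !subnKC//.
  have := hK K (leqnn K).
  have := hnorm_dist hH (hS m) (hS K) (hS n).
  rewrite (hnormBC hH (hS K) (hS n)); lra.
exists l => //; split=> //.
apply: (cvg_in_norm_le hH hS hl ul); exists 0%N => n _.
by have := hb 0%N n; rewrite expr0 mulr1.
Qed.

End GeometricSeries.

Lemma geometric_nneseries (R : realType) (u : nat -> R) (K r : R) :
  0 <= r -> r < 1 -> (forall n, 0 <= u n) -> (forall n, u n <= K * r ^+ n) ->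
  (\sum_(0 <= n <oo) (u n)%:E < +oo)%E.
Proof.
move=> r0 r1 u0 uK; apply: (@le_lt_trans _ _ (K / (1 - r))%:E); last exact: ltry.
have K0 : 0 <= K by have := uK 0%N; rewrite expr0 mulr1; exact: le_trans.
apply: lime_le; first by apply: is_cvg_nneseries => n _ _; rewrite lee_fin.
apply: nearW => n; rewrite sumEFin lee_fin big_mkord.
apply: (@le_trans _ _ (\sum_(i < n) K * r ^+ i)); first exact: ler_sum.
by rewrite -mulr_sumr ler_wpM2l// geometric_sum_le.
Qed.

Section SpectralRadius.
Variables (R : realType) (T : choiceType).
Implicit Types (X : op R T).
Local Notation L2 := (L2 R T).
Local Notation N := (hnorm L2).

(** The norm of [X ^ n] is at most [r ^ n] for large [n], where [r < 1] exceeds the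
    limit of the roots; the factor [M] takes care of the other powers. *)
Lemma root_test X (l : R) : bounded_op X -> l < 1 ->
  norm_op (iter n X) `^ (n%:R^-1) @[n --> \oo] --> l ->
  exists M r : R, [/\ 0 <= r, r < 1 &
    forall n f, N (iter n X f) <= M * r ^+ n * N f].
Proof.
move=> bX l1 /cvgrPdist_lt hl.
pose r := (Num.max l 0 + 1) / 2.
have m1 : Num.max l 0 < 1 by rewrite gt_max l1 ltr01.
have m0 : 0 <= Num.max l 0 by rewrite le_max lexx orbT.
have ml : l <= Num.max l 0 by rewrite le_max lexx.
have r0 : 0 < r by rewrite /r; lra.
have r1 : r < 1 by rewrite /r; lra.
have lr : 0 < r - l by rewrite /r; lra.
have [K _ hK] := hl _ lr.
have hbig n : (K < n)%N -> norm_op (iter n X) <= r ^+ n.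
  move=> Kn; have n0 : (0 < n)%N by exact: leq_trans Kn.
  have := hK n (ltnW Kn); rewrite /= distrC ltr_norml => /andP[_].
  set x := norm_op _ => h.
  have x0 : 0 <= x by apply: norm_op_ge0; exact: bounded_iter.
  have xr : x `^ (n%:R^-1) <= r by lra.
  rewrite -[x in leLHS]powRr1// -(@mulVf _ n%:R) ?pnatr_eq0 -?lt0n// powRrM.
  rewrite powR_mulrn ?powR_ge0// lerXn2r// ?nnegrE ?powR_ge0 ?ltW//.
pose M := 1 + \sum_(i < K.+1) norm_op (iter i X) / r ^+ i.
have nn i : 0 <= norm_op (iter i X) / r ^+ i.
  by apply: divr_ge0; [apply: norm_op_ge0; exact: bounded_iter|exact/exprn_ge0/ltW].
have M1 : 1 <= M by rewrite lerDl sumr_ge0.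
exists M, r; split=> // [|n f]; first exact: ltW.
apply: (le_trans (norm_op_le _ (bounded_iter _ bX))).
rewrite ler_wpM2r ?ell2_norm_ge0//.
have rn : 0 < r ^+ n by rewrite exprn_gt0.
have [Kn|nK] := ltnP K n.
  by apply: (le_trans (hbig _ Kn)); rewrite ler_peMl// ltW.
rewrite -ler_pdivrMr// /M -(big_mkord xpredT (fun i => norm_op (iter i X) / r ^+ i)).
rewrite (bigD1_seq n) ?iota_uniq ?mem_index_iota//=.
by rewrite addrCA lerDl addr_ge0// sumr_ge0.
Qed.

(** The inverse is kept as the limit of the partial sums of the Neumann series
    because it inherits from them the vanishing of entries. *)
Lemma neumann X (M r : R) : bounded_op X -> 0 <= r -> r < 1 ->
  (forall n f, N (iter n X f) <= M * r ^+ n * N f) ->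
  exists L : op R T, [/\ bounded_op L, L \o ((idfun : op R T) - X) = idfun,
    ((idfun : op R T) - X) \o L = idfun &
    forall f, cvg_in L2 (fun n => \sum_(i < n) iter i X f) (L f)].
Proof.
move=> bX r0 r1 hM; have hL := L2_hilbert R T.
have ex f : exists l, cvg_in L2 (fun n => \sum_(i < n) iter i X f) l /\
    N l <= M * N f / (1 - r).
  have [//|n|l _ h] := @geometric_series_cvg R _ _ hL (fun i => iter i X f) (M * N f) r r0 r1.
    by rewrite mulrAC.
  by exists l.
have [L hLL] := choice ex; have hLc f := (hLL f).1.
have Luniq f l : cvg_in L2 (fun n => \sum_(i < n) iter i X f) l -> l = L f.
  by move=> h; apply: (cvg_in_unique hL _ _ _ h (hLc f)).
have bL : bounded_op L.
  apply: (@bounded_opI _ _ _ (M / (1 - r))) => [a f g|f].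
    apply/esym/Luniq.
    rewrite (_ : (fun n => _) = fun n => a *: (\sum_(i < n) iter i X f) +
       \sum_(i < n) iter i X g); first exact: (cvg_in_lin hL).
    apply/funext => n; rewrite scaler_sumr -big_split/=.
    by apply: eq_bigr => i _; rewrite (op_linear a f g (bounded_iter i bX)).
  by have := (hLL f).2; rewrite mulrAC.
have LX f : L (X f) = L f - f.
  apply/esym/Luniq.
  have /cvg_inP hf := hLc f; apply/cvg_inP => e /hf[K hK].
  exists K => n Kn; have := hK n.+1 (leqW Kn).
  rewrite big_ord_recl/= (_ : \sum_(i < n) _ = \sum_(i < n) iter i X (X f)); last first.
    by apply: eq_bigr => i _; rewrite -iterSr.
  by rewrite -addrA addrCA opprB.
have XL f : X (L f) = L f - f.
  rewrite -LX; apply: Luniq.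
  rewrite (_ : (fun n => _) = X \o (fun n => \sum_(i < n) iter i X f)).
    exact: (bounded_linear_cvg hL bX).
  apply/funext => n /=; rewrite op_sum//; apply: eq_bigr => i _.
  by rewrite -iterS iterSr.
exists L; split=> //; apply/funext => f /=.
  by rewrite [X in L X](_ : _ = f - X f)// opB// LX subKr.
by rewrite [LHS](_ : _ = L f - X (L f))// XL subKr.
Qed.

End SpectralRadius.

(** * Trees with a boundary point *)

Section ReducedWalks.
Variables (T : choiceType) (e : rel T).
Hypotheses (e_sym : symmetric e) (eirr : irreflexive e)
  (eacyc : forall p, (2 < size p)%N -> ~ ucycle e p).

Definition reduced_walk (z : nat -> T) (n : nat) : Prop := forall k,
  ((k < n)%N -> e (z k) (z k.+1)) /\ ((k.+1 < n)%N -> z k <> z k.+2).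

(** A shortest return in a walk without backtracking would be a cycle. *)
Lemma reduced_walk_inj (z : nat -> T) n : reduced_walk z n ->
  forall i j, (i < j <= n)%N -> z i <> z j.
Proof.
move=> hz i j; move: {2}(j - i)%N (leqnn (j - i)%N) => d.
elim: d i j => [|d IH] i j; first by lia.
move=> ji ij zij.
case: (ltnP (j - i)%N d.+1) => [lt|ge]; first by apply: (IH i j) zij; lia.
have jE : j = (i + d.+1)%N by lia.
have d2 : (2 < d.+1)%N.
  case: d IH ji ge jE => [|[|d]] //= _ _ _ jE.
    have [h _] := hz i; have {}h : e (z i) (z i.+1) by apply: h; lia.
    by move: h; rewrite zij jE addn1 eirr.
  have [_ h] := hz i; exfalso; apply: h; first by lia.
  by rewrite zij jE addn2.
apply: (@eacyc (mkseq (fun k => z (i + k)%N) d.+1)); first by rewrite size_mkseq.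
apply/andP; split; last first.
  apply/mkseq_uniqP => a b; rewrite !inE => ad bd zab.
  apply/eqP; case: ltngtP => // ab; exfalso.
    by apply: (IH (i + a)%N (i + b)%N) zab; lia.
  by move/esym: zab => zab; apply: (IH (i + b)%N (i + a)%N) zab; lia.
have -> : mkseq (fun k => z (i + k)%N) d.+1 =
    z i :: mkseq (fun k => z (i + k.+1)%N) d.
  rewrite /mkseq /= addn0; congr cons.
  by rewrite -[1%N]/(1 + 0)%N iotaDl -map_comp; apply: eq_map => k /=; rewrite add1n.
rewrite /= [X in rcons _ X]zij jE -(mkseqS (fun k => z (i + k.+1)%N)).
apply/(pathP (z i)) => k; rewrite size_mkseq => kd.
rewrite nth_mkseq// (_ : nth _ _ _ = z (i + k)%N).
  by have [h _] := hz (i + k)%N; rewrite addnS; apply: h; lia.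
by case: k kd => [|k] kd; rewrite /= ?addn0// nth_mkseq//; lia.
Qed.

Lemma infinite_path_walk x n : infinite_path e x -> reduced_walk x n.
Proof. by move=> hx k; have [] := hx k. Qed.

Lemma infinite_path_inj x i j : infinite_path e x -> x i = x j -> i = j.
Proof.
move=> hx xij; case: (ltngtP i j) => // ij; exfalso.
  by apply: (reduced_walk_inj (infinite_path_walk j hx) (i := i) (j := j)); rewrite // ij leqnn.
by apply: (reduced_walk_inj (infinite_path_walk i hx) (i := j) (j := i)); rewrite ?ij ?leqnn.
Qed.

(** If two paths with the same origin and the same tail diverged, then running
    backwards along one and forwards along the other would be a closed reduced
    walk. *)
Lemma infinite_path_unique x y : infinite_path e x -> infinite_path e y ->
  x 0%N = y 0%N -> path_equiv x y -> forall k, x k = y k.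
Proof.
move=> hx hy xy0 [m [n mn]].
elim/ltn_ind => -[//|i] IH; apply: contrapT => ne.
have xyi : x i = y i by apply: IH.
pose M := (m + 1)%N; pose N := (n + 1)%N.
pose u k := x (i + k)%N; pose v k := y (i + k)%N.
have uv : u M = v N.
  rewrite /u /v /M /N (_ : (i + (m + 1) = m + i.+1)%N); last by lia.
  by rewrite mn; congr y; lia.
pose z k := if (k <= M)%N then u (M - k)%N else v (k - M)%N.
have zv k : (M <= k)%N -> z k = v (k - M)%N.
  move=> Mk; rewrite /z; case: leqP => // kM.
  have -> : k = M by lia.
  by rewrite subnn /u /v addn0.
have hz : reduced_walk z (M + N).
  move=> k; split=> kMN.
    case: (ltnP k M) => kM.
      rewrite /z (ltnW kM) kM e_sym /u (_ : (i + (M - k) = (i + (M - k.+1)).+1)%N); last by lia.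
      by have [] := hx (i + (M - k.+1))%N.
    rewrite !zv//; last by lia.
    rewrite /v (_ : (i + (k.+1 - M) = (i + (k - M)).+1)%N); last by lia.
    by have [] := hy (i + (k - M))%N.
  case: (ltnP k.+1 M) => kM.
    rewrite /z (ltnW (ltnW kM)) kM /u => /esym.
    rewrite (_ : (i + (M - k) = (i + (M - k.+2)).+2)%N); last by lia.
    by have [] := hx (i + (M - k.+2))%N.
  case: (ltnP k M) => kM'.
    rewrite (zv k.+2); last by lia.
    rewrite /z (ltnW kM') /u /v (_ : (i + (M - k) = i.+1)%N); last by lia.
    by rewrite (_ : (i + (k.+2 - M) = i.+1)%N); last by lia.
  rewrite !zv//; last by lia.
  rewrite /v (_ : (i + (k.+2 - M) = (i + (k - M)).+2)%N); last by lia.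
  by have [] := hy (i + (k - M))%N.
apply: (reduced_walk_inj hz (i := 0%N) (j := (M + N)%N)); first by lia.
by rewrite (zv (M + N)%N) ?leq_addr// addKn /z leq0n subn0.
Qed.

Lemma path_equiv_sym (x y : nat -> T) : path_equiv x y -> path_equiv y x.
Proof. by move=> [m [n h]]; exists n, m => k; rewrite h. Qed.

Lemma path_equiv_trans (x y z : nat -> T) :
  path_equiv x y -> path_equiv y z -> path_equiv x z.
Proof.
move=> [m [n h]] [m' [n' h']]; exists (m + m')%N, (n' + n)%N => k.
by rewrite -!addnA h addnCA h'.
Qed.

End ReducedWalks.

Section TreeOrder.
Variables (q : nat) (T : choiceType) (G : shift_tree q T).
Implicit Types (s t : T) (w : seq 'I_q).
Local Notation edge := (tree_edge G).
Local Notation omega := (tree_infty G).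
Local Notation rep := (rep_path omega).

Let edge_sym : symmetric edge. Proof. by case: (tree_edgeP G) => -[]. Qed.
Let eirr : irreflexive edge. Proof. by case: (tree_edgeP G) => -[]. Qed.
Let eacyc p : (2 < size p)%N -> ~ ucycle edge p.
Proof. by case: (tree_edgeP G) => _ _ + _; apply. Qed.

Lemma omega_path x : omega x -> infinite_path edge x.
Proof. by have [x0 _ ->] := tree_inftyP G; case. Qed.

Lemma omega_equiv x y : omega x -> omega y -> path_equiv x y.
Proof.
have [x0 _ ->] := tree_inftyP G => -[_ h] [_ h'].
exact: path_equiv_trans (path_equiv_sym h) h'.
Qed.

Lemma omega_closed x y : omega x -> infinite_path edge y -> path_equiv x y -> omega y.
Proof.
have [x0 _ ->] := tree_inftyP G => -[_ h] hy xy; split=> //.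
exact: path_equiv_trans h xy.
Qed.

Lemma omega_unique x y : omega x -> omega y -> x 0%N = y 0%N -> x = y.
Proof.
move=> hx hy xy; apply/funext.
apply: (infinite_path_unique edge_sym eirr eacyc) => //; try exact: omega_path.
exact: omega_equiv.
Qed.

Lemma omega_tail x : omega x -> omega (fun k => x k.+1).
Proof.
move=> hx; apply: (omega_closed hx); first by move=> k; exact: (omega_path hx).
by exists 1%N, 0%N => k; rewrite add1n add0n.
Qed.

Lemma omega_cons t x : omega x -> edge t (x 0%N) -> t <> x 1%N ->
  omega (fun k => if k is k'.+1 then x k' else t).
Proof.
move=> hx tx tx1; apply: (omega_closed hx).
  move=> [|k] /=; last exact: (omega_path hx).
  split=> //; first by move=> h; move: tx; rewrite h eirr.
by exists 0%N, 1%N => k; rewrite add1n add0n.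
Qed.

Lemma rep_exists t : exists2 x, omega x & x 0%N = t.
Proof.
have [x0 h0] : exists x0, omega x0.
  by have [x h e] := tree_inftyP G; exists x; rewrite e; split=> //; exists 0%N, 0%N.
have [_ conn _ _] := tree_edgeP G.
have [p] := conn (x0 0%N) t.
have : exists2 x, omega x & x 0%N = x0 0%N by exists x0.
move: (x0 0%N) => s; elim: p s => [|u p IH] s /=; first by move=> h _ <-.
move=> [x hx xs] /andP[su up] ht; apply: (IH u) => //.
have [e|/eqP ne] := eqVneq u (x 1%N).
  by exists (fun k => x k.+1); [exact: omega_tail|].
exists (fun k => if k is k'.+1 then x k' else u) => //.
by apply: omega_cons; rewrite // xs edge_sym.
Qed.

Lemma repP t : omega (rep t) /\ rep t 0%N = t.
Proof.
rewrite /rep_path; case: xgetP => [x -> //|h].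
by have [x hx xt] := rep_exists t; case: (h x).
Qed.

Lemma rep_eq x : omega x -> rep (x 0%N) = x.
Proof. by move=> hx; apply: omega_unique => //; case: (repP (x 0%N)). Qed.

Definition parent t : T := rep t 1%N.

Lemma rep_iter t k : rep t k = iter k parent t.
Proof.
elim: k => [|k IH] /=; first by case: (repP t).
rewrite -IH /parent.
have hx : omega (fun i => rep t (k + i)%N).
  elim: k {IH} => [|k IH]; first by case: (repP t) => + _; congr omega; apply/funext.
  by have := omega_tail IH; congr omega; apply/funext => i; rewrite addnS.
by have := rep_eq hx; rewrite addn0 => ->; rewrite addn1.
Qed.

Lemma edge_parent t : edge t (parent t).
Proof. by have [/omega_path/(_ 0%N)[+ _ _] e] := repP t; rewrite e. Qed.

(** A neighbour of [t] other than its parent can be put in front of the path that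
    leads from [t] to the boundary point. *)
Lemma edgeE s t : edge t s -> s = parent t \/ parent s = t.
Proof.
move=> ts; have [e|/eqP ne] := eqVneq s (parent t); [by left|right].
have [ht t0] := repP t.
have hx : omega (fun k => if k is k'.+1 then rep t k' else s).
  by apply: omega_cons; rewrite // t0 edge_sym.
by rewrite /parent; have := rep_eq hx => /= ->.
Qed.

Lemma iter_parent_inj t i j : iter i parent t = iter j parent t -> i = j.
Proof.
rewrite -!rep_iter; apply: (infinite_path_inj eirr eacyc).
by apply: omega_path; case: (repP t).
Qed.

Lemma common_ancestor s t : exists m n, iter m parent s = iter n parent t.
Proof.
have [hs _] := repP s; have [ht _] := repP t.
have [m [n h]] := omega_equiv hs ht; exists m, n.
by have := h 0%N; rewrite !addn0 !rep_iter.
Qed.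

(** The path to the boundary point has no repetition, so the difference of the two
    heights below a common ancestor does not depend on that ancestor. *)
Lemma ancestor_balance s t m n m' n' : iter m parent s = iter n parent t ->
  iter m' parent s = iter n' parent t -> (m + n' = m' + n)%N.
Proof.
wlog mm : m n m' n' / (m <= m')%N.
  move=> h e e'; case: (leqP m m') => mm; first exact: h.
  by apply/esym; apply: h => //; exact: ltnW.
move=> e e'.
have : iter (m' - m + n) parent t = iter n' parent t.
  by rewrite -e' iterD -e -iterD subnK.
by move=> /iter_parent_inj; lia.
Qed.

Lemma ex_node : exists t : T, infinite_path edge (rep t).
Proof.
have [x _ _] := tree_inftyP G; exists (x 0%N); apply: omega_path.
by case: (repP (x 0%N)).
Qed.

Let origin : T := projT1 (cid ex_node).

Lemma ex_level t : exists l : int,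
  exists m n : nat, iter m parent t = iter n parent origin /\ l = m%:Z - n%:Z.
Proof. by have [m [n h]] := common_ancestor t origin; exists (m%:Z - n%:Z), m, n. Qed.

(** The Busemann function of the boundary point, normalized at an arbitrary node: it
    numbers the horocycles, and grows by 1 from a node to its children. *)
Definition level t : int := projT1 (cid (ex_level t)).

Lemma levelP t : exists m n : nat,
  iter m parent t = iter n parent origin /\ level t = m%:Z - n%:Z.
Proof. exact: projT2 (cid (ex_level t)). Qed.

Lemma level_eq s t m n : iter m parent s = iter n parent t ->
  level s - m%:Z = level t - n%:Z.
Proof.
move=> e; have [m1 [n1 [e1 ->]]] := levelP s; have [m2 [n2 [e2 ->]]] := levelP t.
have := @ancestor_balance s origin (m2 + m) (n2 + n) m1 n1.
have e3 : iter (m2 + m) parent s = iter (n + n2) parent origin.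
  by rewrite iterD e -iterD addnC iterD e2 -iterD.
have := ancestor_balance e3 e1; lia.
Qed.

Lemma level_parent t : level (parent t) = level t - 1.
Proof. by have := @level_eq (parent t) t 0%N 1%N erefl; rewrite subr0. Qed.

Lemma level_iter_parent n t : level (iter n parent t) = level t - n%:Z.
Proof. by have := @level_eq (iter n parent t) t 0%N n erefl; rewrite subr0. Qed.

Lemma confluentE s t p : confluent omega s t p <->
  iter p.1 parent s = iter p.2 parent t.
Proof.
split=> [/(_ 0%N)|h k]; first by rewrite !addn0 !rep_iter.
by rewrite !rep_iter addnC [(p.2 + _)%N]addnC !iterD h.
Qed.

Lemma confluenceP s t (p := confluence omega s t) :
  iter p.1 parent s = iter p.2 parent t /\
  forall m n, iter m parent s = iter n parent t -> (p.1 <= m)%N /\ (p.2 <= n)%N.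
Proof.
have ex : exists m, `[< exists n, iter m parent s = iter n parent t >].
  by have [m [n h]] := common_ancestor s t; exists m; apply/asboolP; exists n.
have [m /asboolP[n mn] hm] := ex_minnP ex.
rewrite /p /confluence; case: xgetP => [p' _ [/confluentE h1 h2]|/(_ (m, n))[]].
  split=> // m' n' /(confluentE _ _ (m', n')) h; exact: (h2 _ h).
split; first exact/confluentE.
move=> [m' n'] /confluentE /= e; have m0 : (m <= m')%N by apply: hm; apply/asboolP; exists n'.
by split=> //=; have := ancestor_balance mn e; lia.
Qed.

Lemma tdist_ancestor s m : tdist omega s (iter m parent s) = m.
Proof.
rewrite /tdist; have [h1 h2] := confluenceP s (iter m parent s).
have [_] := h2 m 0%N erefl; rewrite leqn0 => /eqP p0.
by move: h1; rewrite p0 addn0 => /iter_parent_inj.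
Qed.

Lemma tdist_meet s t (p := confluence omega s t) :
  tdist omega s (tmeet omega s t) = p.1 /\ tdist omega t (tmeet omega s t) = p.2.
Proof.
rewrite /tmeet rep_iter tdist_ancestor; split=> //.
by have [-> _] := confluenceP s t; rewrite tdist_ancestor.
Qed.

(** The distances of [s] and [t] to their meet are the differences of levels. *)
Lemma tleE s t : tle omega s t <-> level s <= level t.
Proof.
rewrite /tle; have [-> ->] := tdist_meet s t.
have [/level_eq h _] := confluenceP s t; split; lia.
Qed.

Lemma teqE s t : teq omega s t <-> level s = level t.
Proof.
rewrite /teq; have [-> ->] := tdist_meet s t.
have [/level_eq h _] := confluenceP s t; split; lia.
Qed.

Lemma childE s t : (tle omega t s /\ tdist omega t s = 1%N) <-> parent s = t.
Proof.
rewrite /tle; have [-> ->] := tdist_meet t s; rewrite /tdist.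
have [h1 h2] := confluenceP t s; split.
  move=> [le1 sum1]; move: h1.
  have -> : (confluence omega t s).1 = 0%N by lia.
  by have -> : (confluence omega t s).2 = 1%N by lia.
move=> st; have [m0 n1] := h2 0%N 1%N (esym st).
have := @ancestor_balance t s 0%N 1%N _ _ (esym st) h1; lia.
Qed.

Lemma parent_shift j t : parent (tree_shift G j t) = t.
Proof.
apply/childE; have := tree_shiftP G t.
have : [set tree_shift G j t | j in [set: 'I_q]] (tree_shift G j t) by exists j.
by move=> /[swap] ->.
Qed.

Lemma shift_surj s : exists j, s = tree_shift G j (parent s).
Proof.
have : [set u | tle omega (parent s) u /\ tdist omega (parent s) u = 1%N] s.
  exact/childE.
by rewrite -(tree_shiftP G) => -[j _ e]; exists j.
Qed.

Lemma shift_injl j : injective (tree_shift G j).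
Proof. by move=> s t /(congr1 parent); rewrite !parent_shift. Qed.

(** A node has [q] children besides its parent, so the [q] shifts are distinct. *)
Lemma shift_injr t : injective (fun j => tree_shift G j t).
Proof.
move=> i j ij; apply: contrapT => /eqP nij.
have [_ _ _ /(_ t)] := tree_edgeP G.
have -> : [set s | edge t s] =
    (fun o : option 'I_q => if o is Some k then tree_shift G k t else parent t) @`
    ([set: option 'I_q] `\ Some j).
  apply/seteqP; split=> [s /=|_ [[k|] [_ kj] <-] /=].
  - move=> /edgeE[->|st]; first by exists None.
    have [k e] := shift_surj s; rewrite st in e.
    have [kj|kj] := eqVneq k j; last first.
      by exists (Some k) => //; split => // -[/eqP]; rewrite (negPf kj).
    by exists (Some i); [split=> // -[/eqP]; rewrite (negPf nij)|rewrite ij -kj].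
  - by rewrite edge_sym -{2}(parent_shift k t); exact: edge_parent.
  - exact: edge_parent.
move=> /card_eqPle[_] /card_le_trans /(_ (card_image_le _ _)).
case: q G i j ij nij => [|q'] G' i j ij nij; first by case: i ij nij.
move=> /pcard_leP[f].
pose g (o : option 'I_q'.+2) : option 'I_q'.+1 := if o is Some k then f k else Some j.
have fj (k : 'I_q'.+2) : f k <> Some j.
  by have [_ +] := @funS _ _ _ _ f k (ltn_ord k).
have ginj : injective g.
  move=> [a|] [b|] //=; [|by move=> /fj|by move=> /esym /fj].
  move=> h; congr Some; apply: val_inj.
  by apply: (@inj _ _ _ f) h; apply: mem_set => /=; exact: ltn_ord.
by have := leq_card g ginj; rewrite !card_option !card_ord ltnn.
Qed.

End TreeOrder.

(** * The grading of operators by levels *)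

Section Words.
Variables (q : nat) (T : choiceType) (G : shift_tree q T).
Implicit Types (s t : T) (w : seq 'I_q).
Local Notation act := (tree_act G).
Local Notation lev := (level G).
Local Notation par := (parent G).

Lemma level_shift j t : lev (tree_shift G j t) = lev t + 1.
Proof. by have := level_parent G (tree_shift G j t); rewrite parent_shift; lia. Qed.

Lemma level_act w t : lev (act t w) = lev t + (size w)%:Z.
Proof.
elim: w t => [|j w IH] t /=; first by rewrite addr0.
by rewrite [act _ _]/= IH level_shift; lia.
Qed.

Lemma parent_act w t : iter (size w) par (act t w) = t.
Proof.
elim: w t => [//|j w IH] t.
by rewrite [act _ _]/= iterS IH parent_shift.
Qed.

Lemma act_inj w : injective (act^~ w).
Proof. by move=> s t /(congr1 (iter (size w) par)); rewrite !parent_act. Qed.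

Lemma act_surj n s : exists2 w, size w = n & act (iter n par s) w = s.
Proof.
elim: n => [|n [w sw ws]]; first by exists [::].
have [j e] := shift_surj G (iter n par s).
by exists (j :: w); rewrite /= ?sw// [act _ _]/= -e.
Qed.

Lemma act_injw t w w' : size w = size w' -> act t w = act t w' -> w = w'.
Proof.
elim: w w' t => [|j w IH] [|j' w'] t //= [sw] e.
have {}e : act (tree_shift G j t) w = act (tree_shift G j' t) w' by [].
have e' : tree_shift G j t = tree_shift G j' t.
  by have := congr1 (iter (size w) par) e; rewrite parent_act sw parent_act.
have <- := shift_injr e'; congr cons; apply: (IH _ (tree_shift G j t)) => //.
by rewrite e -e'.
Qed.

End Words.

Section WordOperators.
Variables (R : realType) (q : nat) (T : choiceType) (G : shift_tree q T).
Implicit Types (s t : T) (w : seq 'I_q) (f g : ell2 R T) (X Y S c : op R T) (k l : int).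
Local Notation act := (tree_act G).
Local Notation lev := (level G).
Local Notation L2 := (L2 R T).
Local Notation N := (hnorm L2).
Local Notation chi := (chi R).
Local Notation dot := (hdot L2).
Local Notation W := (@word_op R q T G).
Local Notation U := (@shift_op R q T G).
Let hL := L2_hilbert R T.

Lemma word_sum_le w f (A : {fset T}) :
  \sum_(t <- A) normc (f (act t w)) ^+ 2 <= N f ^+ 2.
Proof.
have := ell2_sum_le f [fset act t w | t in A]%fset.
by rewrite big_imfset//= => s t _ _; exact: act_inj.
Qed.

Lemma word_opE w f t : W w f t = f (act t w).
Proof. exact: (mkell2E (word_sum_le w f)). Qed.

Lemma word_op_norm w f : N (W w f) <= N f.
Proof.
rewrite -(@ler_pXn2r _ 2)// ?nnegrE ?hnorm_ge0//; apply: ell2_norm_le => A.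
by apply: le_trans (word_sum_le w f A); apply: ler_sum => t _; rewrite word_opE.
Qed.

Lemma word_op_bounded w : bounded_op (W w).
Proof.
apply: (@bounded_opI _ _ _ 1) => [a f g|f]; last by rewrite mul1r word_op_norm.
by apply: ell2_ext => t; rewrite ell2D ell2Z !word_opE.
Qed.

Lemma adj_word_act w f t : adj (W w) f (act t w) = f t.
Proof.
rewrite op_coordE; last exact/bounded_adj/word_op_bounded.
rewrite adjK; last exact: word_op_bounded.
rewrite -[RHS]dot_chi; congr dot; apply: ell2_ext => s.
by rewrite word_opE !chiE; congr (nat_of_bool _)%:R; apply/eqP/eqP => [/act_inj|->].
Qed.

Lemma adj_word_out w f s : (forall t, act t w <> s) -> adj (W w) f s = 0.
Proof.
move=> h; rewrite op_coordE; last exact/bounded_adj/word_op_bounded.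
rewrite adjK; last exact: word_op_bounded.
apply: dot_disjoint => t; right; rewrite word_opE chiE.
by case: eqP => // /h.
Qed.

Lemma adj_word_chi w t : adj (W w) (chi t) = chi (act t w).
Proof.
apply: ell2_ext => s; have [[u us]|h] := pselect (exists u, act u w = s).
  rewrite -us adj_word_act !chiE; congr (nat_of_bool _)%:R.
  by apply/eqP/eqP => [->|/act_inj].
rewrite adj_word_out ?chiE; last by move=> u us; apply: h; exists u.
by case: eqP => // st; case: h; exists t.
Qed.

Lemma word_opK w f : W w (adj (W w) f) = f.
Proof. by apply: ell2_ext => t; rewrite word_opE adj_word_act. Qed.

(** The words of a fixed length partition the nodes, each node having exactly one
    ancestor at that distance. *)
Lemma sum_word_proj n f : \sum_(w : n.-tuple 'I_q) adj (W w) (W w f) = f.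
Proof.
apply: ell2_ext => s; rewrite ell2_sum.
have [w sw ws] := act_surj G n s.
have wn : size w == n by exact/eqP.
rewrite (bigD1 (Tuple wn))//= big1 => [|w' nw].
  by rewrite addr0 -{1}ws adj_word_act word_opE ws.
apply: adj_word_out => t ts; case/eqP: nw; apply: val_inj => /=.
have := parent_act G w' t; rewrite ts size_tuple => e.
by apply: (act_injw (G := G) (t := t)); rewrite ?size_tuple ?sw// ts -e.
Qed.

Lemma adj_shift_chi j t : adj (U j) (chi t) = chi (tree_shift G j t).
Proof. exact: (adj_word_chi [:: j]). Qed.

Lemma shift_opE j f t : U j f t = f (tree_shift G j t).
Proof. exact: word_opE. Qed.

Lemma shift_op_bounded j : bounded_op (U j).
Proof. exact: word_op_bounded. Qed.

Lemma shift_opK j f : U j (adj (U j) f) = f.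
Proof. exact: word_opK. Qed.

(** Operators are graded by the amount by which they raise levels. Words have
    degree minus their length, causal operators are those of degree at least 0, and
    the constants are those of degree exactly 0. *)
Definition low k X : Prop :=
  bounded_op X /\ forall s t, lev t < lev s + k -> X (chi s) t = 0.

Definition upp k X : Prop :=
  bounded_op X /\ forall s t, lev s + k < lev t -> X (chi s) t = 0.

Lemma low_comp k l X Y : low k X -> low l Y -> low (k + l) (X \o Y).
Proof.
move=> [bX hX] [bY hY]; split; first exact: bounded_comp.
move=> s t st; apply: (@op_coord0 _ _ X (Y (chi s)) t bX) => u.
case: (ltP (lev u) (lev s + l)) => h; first by left; exact: hY.
by right; apply: hX; lia.
Qed.

Lemma upp_comp k l X Y : upp k X -> upp l Y -> upp (k + l) (X \o Y).
Proof.
move=> [bX hX] [bY hY]; split; first exact: bounded_comp.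
move=> s t st; apply: (@op_coord0 _ _ X (Y (chi s)) t bX) => u.
case: (ltP (lev s + l) (lev u)) => h; first by left; exact: hY.
by right; apply: hX; lia.
Qed.

Lemma low_adj k X : low k X -> upp (- k) (adj X).
Proof.
move=> [bX hX]; split; first exact: bounded_adj.
by move=> s t st; rewrite adj_entry// hX ?rmorph0//; lia.
Qed.

Lemma upp_adj k X : upp k X -> low (- k) (adj X).
Proof.
move=> [bX hX]; split; first exact: bounded_adj.
by move=> s t st; rewrite adj_entry// hX ?rmorph0//; lia.
Qed.

Lemma low_add k X Y : low k X -> low k Y -> low k (X + Y).
Proof.
move=> [bX hX] [bY hY]; split; first exact: bounded_add.
by move=> s t st; rewrite [LHS](_ : _ = X (chi s) t + Y (chi s) t)// hX// hY// addr0.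
Qed.

Lemma upp_add k X Y : upp k X -> upp k Y -> upp k (X + Y).
Proof.
move=> [bX hX] [bY hY]; split; first exact: bounded_add.
by move=> s t st; rewrite [LHS](_ : _ = X (chi s) t + Y (chi s) t)// hX// hY// addr0.
Qed.

Lemma low_scale (a : R[i]) k X : low k X -> low k (a *: X).
Proof.
move=> [bX hX]; split; first exact: bounded_scale.
by move=> s t st; rewrite [LHS](_ : _ = a * X (chi s) t)// hX// mulr0.
Qed.

Lemma upp_scale (a : R[i]) k X : upp k X -> upp k (a *: X).
Proof.
move=> [bX hX]; split; first exact: bounded_scale.
by move=> s t st; rewrite [LHS](_ : _ = a * X (chi s) t)// hX// mulr0.
Qed.

Lemma low_zero k : low k (0 : op R T).
Proof. by split; [exact: bounded_zero|]. Qed.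

Lemma upp_zero k : upp k (0 : op R T).
Proof. by split; [exact: bounded_zero|]. Qed.

Lemma low_sub k X Y : low k X -> low k Y -> low k (X - Y).
Proof. by move=> hX hY; rewrite -scaleN1r; apply: low_add => //; exact: low_scale. Qed.

Lemma low_sum k (J : Type) (r : seq J) (u : J -> op R T) :
  (forall i, low k (u i)) -> low k (\sum_(i <- r) u i).
Proof. by move=> hu; apply: big_ind => //; [exact: low_zero|exact: low_add]. Qed.

Lemma upp_sum k (J : Type) (r : seq J) (u : J -> op R T) :
  (forall i, upp k (u i)) -> upp k (\sum_(i <- r) u i).
Proof. by move=> hu; apply: big_ind => //; [exact: upp_zero|exact: upp_add]. Qed.

Lemma low_id : low 0 (idfun : op R T).
Proof.
split; first exact: bounded_id.
by move=> s t; rewrite addr0 -[idfun (chi s)]/(chi s) chiE; case: eqP => // ->; rewrite ltxx.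
Qed.

Lemma upp_id : upp 0 (idfun : op R T).
Proof.
split; first exact: bounded_id.
by move=> s t; rewrite addr0 -[idfun (chi s)]/(chi s) chiE; case: eqP => // ->; rewrite ltxx.
Qed.

Lemma low_weaken k l X : (l <= k)%R -> low k X -> low l X.
Proof. by move=> lk [bX hX]; split=> // s t st; apply: hX; lia. Qed.

Lemma upp_weaken k l X : (k <= l)%R -> upp k X -> upp l X.
Proof. by move=> lk [bX hX]; split=> // s t st; apply: hX; lia. Qed.

Lemma low_iter k n X : low k X -> low (k *+ n) (iter n X).
Proof.
move=> hX; elim: n => [|n IH]; first exact: low_id.
by rewrite mulrS; exact: (low_comp hX IH).
Qed.

Lemma upp_iter k n X : upp k X -> upp (k *+ n) (iter n X).
Proof.
move=> hX; elim: n => [|n IH]; first exact: upp_id.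
by rewrite mulrS; exact: (upp_comp hX IH).
Qed.

Lemma low_word w : low (- (size w)%:Z) (W w).
Proof.
split; first exact: word_op_bounded.
by move=> s t h; rewrite word_opE chiE; case: eqP => // e; move: h; rewrite -e level_act; lia.
Qed.

Lemma upp_word w : upp (- (size w)%:Z) (W w).
Proof.
split; first exact: word_op_bounded.
by move=> s t h; rewrite word_opE chiE; case: eqP => // e; move: h; rewrite -e level_act; lia.
Qed.

Lemma low_adj_word w : low (size w)%:Z (adj (W w)).
Proof. by rewrite -[_%:Z]opprK; apply: upp_adj; exact: upp_word. Qed.

Lemma upp_adj_word w : upp (size w)%:Z (adj (W w)).
Proof. by rewrite -[_%:Z]opprK; apply: low_adj; exact: low_word. Qed.

Lemma low_bounded k X : low k X -> bounded_op X. Proof. by case. Qed.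
Lemma upp_bounded k X : upp k X -> bounded_op X. Proof. by case. Qed.
Lemma low_entry k X s t : low k X -> lev t < lev s + k -> X (chi s) t = 0.
Proof. by case=> _; apply. Qed.
Lemma lowI k X : bounded_op X ->
  (forall s t, lev t < lev s + k -> X (chi s) t = 0) -> low k X.
Proof. by split. Qed.

Lemma low_all_eq0 X : (forall n : nat, low n%:Z X) -> X = 0.
Proof.
move=> hX; apply: op_ext; [exact: low_bounded (hX 0%N)|exact: bounded_zero|move=> s t].
apply: (low_entry (hX (absz (lev t - lev s)).+1)); lia.
Qed.

Lemma low_vanish k n X f : low k X -> (forall s, lev s < n -> f s = 0) ->
  forall t, lev t < n + k -> X f t = 0.
Proof.
move=> [bX hX] hf t ht; apply: op_coord0 => // s.
by case: (ltP (lev s) n) => h; [left; exact: hf|right; apply: hX; lia].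
Qed.

Lemma upp_vanish k n X f : upp k X -> (forall s, n < lev s -> f s = 0) ->
  forall t, n + k < lev t -> X f t = 0.
Proof.
move=> [bX hX] hf t ht; apply: op_coord0 => // s.
by case: (ltP n (lev s)) => h; [left; exact: hf|right; apply: hX; lia].
Qed.

(** The function [chi s] vanishes at all the nodes that precede the parent of [s],
    so causality tested there gives the vanishing of the entries. *)
Lemma causalP S : causal G S <-> low 0 S.
Proof.
split=> [[bS hS]|hS].
  split=> // s t; rewrite addr0 => ts.
  apply: (hS (parent G s)) => [u /tleE|]; last by apply/tleE; rewrite level_parent; lia.
  rewrite level_parent chiE; case: eqP => // ->; lia.
split=> [|s f hf t /tleE ts]; first by case: hS.
apply: (low_vanish (n := lev s + 1) hS); last by lia.
by move=> u us; apply: hf; apply/tleE; lia.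
Qed.

Lemma constantP c : constant_op G c <-> low 0 c /\ upp 0 c.
Proof.
split=> [[hc hc']|[hc hc']].
  have {}hc := (causalP c).1 hc; split=> //.
  have bc := hc.1; have {}hc' := (causalP _).1 hc'.
  by rewrite -[c]adjK// -[0]oppr0; exact: low_adj.
split; first exact/causalP.
by apply/causalP; rewrite -[0]oppr0; exact: upp_adj.
Qed.

Lemma constant_bounded c : constant_op G c -> bounded_op c.
Proof. by case=> -[]. Qed.

Lemma constant_entry c s t : constant_op G c -> lev t != lev s -> c (chi s) t = 0.
Proof.
move=> /constantP[[_ h1] [_ h2]]; rewrite neq_lt => /orP[h|h].
  by apply: h1; rewrite addr0.
by apply: h2; rewrite addr0.
Qed.

Lemma constantI c : bounded_op c ->
  (forall s t, lev t != lev s -> c (chi s) t = 0) -> constant_op G c.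
Proof.
move=> bc hc; apply/constantP; split; split=> // s t; rewrite addr0 => st; apply: hc.
  by rewrite lt_eqF.
by rewrite gt_eqF.
Qed.

Lemma constant_adj c : constant_op G c -> constant_op G (adj c).
Proof.
move=> h; split; first by case: h.
by rewrite adjK; [case: h|exact: constant_bounded].
Qed.

Lemma constant_rank1 f t : (forall s, lev s != lev t -> f s = 0) ->
  constant_op G (rank1 f t).
Proof.
move=> hf; apply: constantI; first exact: bounded_rank1.
move=> s u us; rewrite rank1_chi; case: eqP => // ts; apply: hf.
by rewrite ts.
Qed.

Lemma constant_shift j : constant_op G (adj (U j) \o U j).
Proof.
have e : 0 = 1%:Z + (- 1%:Z) by rewrite subrr.
apply/constantP; split; rewrite e.
  exact: low_comp (low_adj_word [:: j]) (low_word [:: j]).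
exact: upp_comp (upp_adj_word [:: j]) (upp_word [:: j]).
Qed.

Definition level_restr l f : ell2 R T := restr (fun t => lev t == l) f.

Lemma level_restrE l f t : level_restr l f t = if lev t == l then f t else 0.
Proof. exact: restrE. Qed.

Lemma sum_level_restr (r : seq int) (u : int -> ell2 R T) t : uniq r ->
  (\sum_(l <- r) level_restr l (u l)) t = if lev t \in r then u (lev t) t else 0.
Proof.
move=> ur; rewrite ell2_sum; case: ifPn => h.
  rewrite (bigD1_seq (lev t))//= level_restrE eqxx big1 ?addr0// => l ne.
  by rewrite level_restrE eq_sym (negPf ne).
rewrite big1_seq// => l /= lr; rewrite level_restrE; case: eqP => // e.
by rewrite e lr in h.
Qed.

Lemma norm_sum_level_restr (r : seq int) (u : int -> ell2 R T) : uniq r ->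
  N (\sum_(l <- r) level_restr l (u l)) ^+ 2 = \sum_(l <- r) N (level_restr l (u l)) ^+ 2.
Proof.
move=> ur; apply: norm_disjoint_sum => // i j t ij; rewrite !level_restrE.
by case: (eqVneq (lev t) i) => [->|_]; [right; rewrite (negPf ij)|left].
Qed.

(** The block diagonal of [X] for the partition of the nodes into horocycles: the
    conditional expectation of [X] onto the algebra of constants. *)
Definition diag X : op R T := fun f => mkell2 (fun t => X (level_restr (lev t) f) t).

(** The diagonal blocks act between orthogonal subspaces, hence are bounded together
    by any common bound. *)
Lemma diag_sum_le X (M : R) f (A : {fset T}) : bounded_op X -> 0 <= M ->
  (forall f, N (X f) <= M * N f) ->
  \sum_(t <- A) normc (X (level_restr (lev t) f) t) ^+ 2 <= (M * N f) ^+ 2.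
Proof.
move=> bX M0 hM; pose r := undup [seq lev t | t <- A].
have ur : uniq r by exact: undup_uniq.
pose g := \sum_(l <- r) level_restr l (X (level_restr l f)).
have -> : \sum_(t <- A) normc (X (level_restr (lev t) f) t) ^+ 2 =
    \sum_(t <- A) normc (g t) ^+ 2.
  rewrite big_seq [RHS]big_seq; apply: eq_bigr => t tA.
  by rewrite /g sum_level_restr// mem_undup map_f.
apply: (le_trans (ell2_sum_le _ _)); rewrite norm_sum_level_restr//.
apply: (@le_trans _ _ (\sum_(l <- r) M ^+ 2 * N (level_restr l f) ^+ 2)).
  apply: ler_sum => l _; rewrite -exprMn lerXn2r// ?nnegrE ?mulr_ge0 ?hnorm_ge0//.
  exact: le_trans (restr_norm _ _) (hM _).
rewrite -mulr_sumr exprMn ler_wpM2l ?exprn_ge0//.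
rewrite -(norm_sum_level_restr (fun=> f))// lerXn2r// ?nnegrE ?hnorm_ge0//.
rewrite (_ : \sum_(l <- r) _ = restr (fun t => lev t \in r) f) ?restr_norm//.
by apply: ell2_ext => t; rewrite sum_level_restr// restrE.
Qed.

Lemma diagE X f t : bounded_op X -> diag X f t = X (level_restr (lev t) f) t.
Proof.
move=> bX; apply: (mkell2E (M := (norm_op X * N f) ^+ 2)) => A.
by apply: diag_sum_le; rewrite ?norm_op_ge0// => g; exact: norm_op_le.
Qed.

Lemma diag_norm X (M : R) f : bounded_op X -> 0 <= M ->
  (forall f, N (X f) <= M * N f) -> N (diag X f) <= M * N f.
Proof.
move=> bX M0 hM.
rewrite -(@ler_pXn2r _ 2)// ?nnegrE ?hnorm_ge0 ?mulr_ge0 ?hnorm_ge0//.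
apply: ell2_norm_le => A; apply: le_trans (diag_sum_le f A bX M0 hM).
by apply: ler_sum => t _; rewrite diagE.
Qed.

Lemma diag_bounded X : bounded_op X -> bounded_op (diag X).
Proof.
move=> bX; apply: (@bounded_opI _ _ _ (norm_op X)) => [a f g|f].
  apply: ell2_ext => t; rewrite ell2D ell2Z !(diagE _ _ bX) /level_restr restr_lin.
  by rewrite (op_linear _ _ _ bX).
by apply: diag_norm => // [|g]; [exact: norm_op_ge0|exact: norm_op_le].
Qed.

Lemma level_restr_chi l s : level_restr l (chi s) = if lev s == l then chi s else 0.
Proof.
apply: ell2_ext => t; rewrite level_restrE chiE.
case: (eqVneq t s) => [->|ts]; first by case: ifP; rewrite ?ell20// chiE eqxx.
by case: ifP; case: ifP; rewrite ?chiE ?(negPf ts) ?ell20.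
Qed.

Lemma diag_entry X s t : bounded_op X ->
  diag X (chi s) t = if lev t == lev s then X (chi s) t else 0.
Proof.
move=> bX; rewrite diagE// level_restr_chi eq_sym.
by case: ifP => // _; rewrite op0.
Qed.

Lemma diag_chi X s : bounded_op X -> diag X (chi s) = level_restr (lev s) (X (chi s)).
Proof. by move=> bX; apply: ell2_ext => t; rewrite diag_entry// level_restrE. Qed.

Lemma diag_constant X : bounded_op X -> constant_op G (diag X).
Proof.
move=> bX; apply: constantI; first exact: diag_bounded.
by move=> s t st; rewrite diag_entry// (negPf st).
Qed.

Lemma diag_id c : constant_op G c -> diag c = c.
Proof.
move=> hc; have bc := constant_bounded hc; apply: op_ext => //; first exact: diag_bounded.
by move=> s t; rewrite diag_entry//; case: eqVneq => // st; rewrite constant_entry.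
Qed.

Lemma diag_eq0 X : low 1 X -> diag X = 0.
Proof.
move=> [bX hX]; apply: op_ext; [exact: diag_bounded|exact: bounded_zero|].
move=> s t; rewrite diag_entry//; case: eqP => // st; apply: hX.
by rewrite st ltrDl.
Qed.

Lemma diag_eq0_upp k X : (k < 0)%R -> upp k X -> diag X = 0.
Proof.
move=> k0 [bX hX]; apply: op_ext; [exact: diag_bounded|exact: bounded_zero|].
move=> s t; rewrite diag_entry//; case: eqP => // st; apply: hX.
by rewrite st; lia.
Qed.

Lemma bounded_level_restr l : bounded_op (level_restr l).
Proof.
apply: (@bounded_opI _ _ _ 1) => [a f g|f]; first exact: restr_lin.
by rewrite mul1r restr_norm.
Qed.

Lemma diag_add X Y : bounded_op X -> bounded_op Y -> diag (X + Y) = diag X + diag Y.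
Proof.
move=> bX bY; apply/funext => f; apply: ell2_ext => t.
rewrite diagE; last exact: bounded_add.
by rewrite [RHS](_ : _ = diag X f t + diag Y f t)// !diagE.
Qed.

Lemma diag_scale (a : R[i]) X : bounded_op X -> diag (a *: X) = a *: diag X.
Proof.
move=> bX; apply/funext => f; apply: ell2_ext => t.
rewrite diagE; last exact: bounded_scale.
by rewrite [RHS](_ : _ = a * diag X f t)// diagE.
Qed.

Lemma diag_sub X Y : bounded_op X -> bounded_op Y -> diag (X - Y) = diag X - diag Y.
Proof.
move=> bX bY; rewrite diag_add//; last exact: bounded_opp.
by rewrite -[- Y]scaleN1r diag_scale// scaleN1r.
Qed.

Lemma constant_restr c l f : constant_op G c ->
  c (level_restr l f) = level_restr l (c f).
Proof.
move=> hc; have bc := constant_bounded hc.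
apply: ell2_ext => t; rewrite level_restrE; case: eqVneq => [tl|tl].
  apply/eqP; rewrite -subr_eq0 -ell2B -opB//; apply/eqP.
  apply: op_coord0 => // s; rewrite ell2B level_restrE.
  case: (eqVneq (lev s) l) => [_|sl]; first by left; rewrite subrr.
  by right; rewrite constant_entry// tl eq_sym.
apply: op_coord0 => // s; rewrite level_restrE.
case: (eqVneq (lev s) l) => [sl|_]; last by left.
by right; rewrite constant_entry// sl.
Qed.

Lemma diag_constr X c : bounded_op X -> constant_op G c -> diag (X \o c) = diag X \o c.
Proof.
move=> bX hc; have bc := constant_bounded hc.
apply/funext => f; apply: ell2_ext => t; rewrite diagE; last exact: bounded_comp.
by rewrite /= diagE// constant_restr.
Qed.

Lemma diag_constl X c : bounded_op X -> constant_op G c -> diag (c \o X) = c \o diag X.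
Proof.
move=> bX hc; have bc := constant_bounded hc.
have bcX := bounded_comp bc bX.
apply: op_ext; [exact: diag_bounded|exact/bounded_comp/diag_bounded|move=> s t].
by rewrite diag_entry// /= diag_chi// constant_restr// level_restrE.
Qed.

(** As [w] has degree [- size w], the coefficient of index [w] is the part of [S] of
    degree [size w] followed by [w]. *)
Lemma coefE S w : bounded_op S -> coef G S w = diag (W w \o S).
Proof.
move=> bS; have bWS := bounded_comp (word_op_bounded w) bS.
have hd s t : diag (W w \o S) (chi t) s =
    if `[< teq (tree_infty G) t s >] then S (chi t) (act s w) else 0.
  rewrite diag_entry// /= word_opE.
  have -> : `[< teq (tree_infty G) t s >] = (lev s == lev t) => //.
  by apply/asboolP/eqP => [/teqE->|e]//; apply/teqE.
rewrite /coef; case: xgetP => [A _ [cA hA]|/(_ (diag (W w \o S)))[]].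
  by apply: op_ext; [exact: constant_bounded|exact: diag_bounded|move=> s t; rewrite hA hd].
by split; [exact: diag_constant|exact: hd].
Qed.

End WordOperators.

(** * Point evaluation *)

Section Evaluation.
Variables (R : realType) (q : nat) (T : choiceType) (G : shift_tree q T).
Implicit Types (s t : T) (w : seq 'I_q) (f g : ell2 R T) (X Y S L : op R T).
Implicit Types (c d : 'I_q -> op R T).
Local Notation act := (tree_act G).
Local Notation lev := (level G).
Local Notation L2 := (L2 R T).
Local Notation N := (hnorm L2).
Local Notation chi := (chi R).
Local Notation dot := (hdot L2).
Local Notation W := (@word_op R q T G).
Local Notation U := (@shift_op R q T G).
Let hL := L2_hilbert R T.

Lemma ell2_tail f (e : R) : 0 < e -> exists A : {fset T}, forall D : pred T,
  (forall s, s \in A -> ~~ D s) -> N (restr D f) < e.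
Proof.
move=> e0.
have e2 : 0 < (e / 2) ^+ 2 by rewrite exprn_gt0// divr_gt0.
have [A hA] : exists A : {fset T}, N f ^+ 2 - (e / 2) ^+ 2 < \sum_(s <- A) normc (f s) ^+ 2.
  apply: contrapT => hn; suff : N f ^+ 2 <= N f ^+ 2 - (e / 2) ^+ 2 by lra.
  by apply: ell2_norm_le => A; rewrite leNgt; apply/negP => ?; apply: hn; exists A.
exists A => D hD; apply: (@le_lt_trans _ _ (e / 2)); last by lra.
rewrite -(@ler_pXn2r _ 2)// ?nnegrE ?hnorm_ge0//; last by apply: ltW; rewrite divr_gt0.
apply: ell2_norm_le => B.
have h1 : \sum_(t <- B) normc (restr D f t) ^+ 2 <=
    \sum_(t <- (A `|` B)%fset) normc (restr D f t) ^+ 2.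
  rewrite [leRHS](big_fsetID _ (mem B))/=.
  rewrite (_ : [fset x in (A `|` B)%fset | x \in B]%fset = B); last first.
    by apply/fsetP => x; rewrite !inE/=; case: (x \in B); rewrite ?orbT ?andbF.
  by rewrite lerDl sumr_ge0// => t _; exact: sqr_normc_ge0.
have h2 : \sum_(t <- (A `|` B)%fset) normc (restr D f t) ^+ 2 + \sum_(s <- A) normc (f s) ^+ 2
    <= \sum_(t <- (A `|` B)%fset) normc (f t) ^+ 2.
  rewrite (big_fsetID _ (mem A)) [leRHS](big_fsetID _ (mem A))/=.
  rewrite (_ : [fset x in (A `|` B)%fset | x \in A]%fset = A); last first.
    by apply/fsetP => x; rewrite !inE/=; case: (x \in A); rewrite ?orbT ?andbF.
  rewrite big_seq big1 ?add0r => [|x xA]; last first.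
    by rewrite restrE (negPf (hD _ xA)) normc0 expr0n.
  rewrite [leLHS]addrC lerD2l; apply: ler_sum => t _; rewrite restrE.
  by case: ifP => // _; rewrite normc0 expr0n sqr_normc_ge0.
have h3 := ell2_sum_le f (A `|` B)%fset.
lra.
Qed.

Lemma ex_descent t n : exists w, size w = n /\ act (iter n (parent G) t) w = t.
Proof. by have [w] := act_surj G n t; exists w. Qed.

(** The term of index [w] vanishes at [t] unless [w] leads to [t], so that the
    series is indexed by the distance to the ancestors of [t]; it is summable
    because the restrictions of a square summable function to the horocycles are
    orthogonal. *)
Lemma coef_series S : causal G S -> pointwise_abs_series G (coef G S) S.
Proof.
move=> /causalP[bS hS] f t.
have [h hh] := choice (ex_descent t).
have sh n : size (h n) = n by case: (hh n).
have ah n : act (iter n (parent G) t) (h n) = t by case: (hh n).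
have hinj : injective h by move=> m n mn; rewrite -(sh m) mn sh.
pose g := adj S (chi t).
have g0 s : lev t < lev s -> g s = 0.
  by move=> ts; rewrite /g adj_entry// hS ?addr0// rmorph0.
pose b (n : nat) := S (level_restr G (lev t - n%:Z) f) t.
pose a w := (adj (W w) \o coef G S w) f t.
have ah_ n : a (h n) = b n.
  rewrite /a /= coefE// -{1}(ah n) adj_word_act diagE; last first.
    exact: bounded_comp (word_op_bounded _ _ _) bS.
  by rewrite /= word_opE ah level_iter_parent.
have a0 w : (forall n, h n <> w) -> a w = 0.
  move=> hw; apply: adj_word_out => u uw; apply: (hw (size w)).
  apply: (act_injw (G := G) (t := u)); first by rewrite sh.
  by rewrite uw -[RHS](ah (size w)) -uw parent_act.
pose P n x : ell2 R T := level_restr G (lev t - n%:Z) x.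
have PB (B : {fset nat}) x : \sum_(n <- B) N (P n x) ^+ 2 <= N x ^+ 2.
  pose r := [seq lev t - n%:Z | n <- B].
  have ur : uniq r by rewrite map_inj_uniq ?fset_uniq// => m n; lia.
  rewrite -(big_map (fun n : nat => lev t - n%:Z) xpredT (fun l => N (level_restr G l x) ^+ 2)).
  rewrite -norm_sum_level_restr//.
  rewrite (_ : \sum_(l <- r) _ = restr (fun s => lev s \in r) x).
    by rewrite lerXn2r// ?nnegrE ?hnorm_ge0// restr_norm.
  by apply: ell2_ext => s; rewrite sum_level_restr// restrE.
have bE n : b n = dot (P n f) g by rewrite /b op_coordE.
have bE' n : b n = dot (P n f) (P n g).
  rewrite bE; have -> : g = P n g + restr (fun s => lev s != lev t - n%:Z) g.
    by apply: ell2_ext => s; rewrite ell2D level_restrE restrE; case: eqP; rewrite ?addr0 ?add0r.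
  rewrite (hdotDr hL)// [X in _ + X]dot_disjoint.
    rewrite addr0; congr (dot _ _); apply: ell2_ext => s; rewrite /P !level_restrE.
    by rewrite ell2D level_restrE restrE; case: eqP; rewrite ?addr0.
  by move=> s; rewrite level_restrE restrE; case: eqP; [right|left].
pose M := N f ^+ 2 + N g ^+ 2.
have bM (B : {fset nat}) : \sum_(n <- B) normc (b n) <= M.
  apply: le_trans (lerD (PB B f) (PB B g)); rewrite -big_split/=; apply: ler_sum => n _.
  rewrite bE'; apply: (le_trans (cauchy_schwarz hL _ _)) => //.
  have := sqr_ge0 (N (P n f) - N (P n g)); rewrite sqrrB.
  have := sqr_ge0 (N (P n f)); have := sqr_ge0 (N (P n g)).
  by move: (N (P n f)) (N (P n g)) => x y; lra.
split.
  apply: (@summable_nneg_bound _ _ (fun w => normc (a w)) M) => A.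
  pose A' := [fset w in A | w == h (size w)]%fset.
  have A'E w : (w \in A') = (w \in A) && (w == h (size w)) by rewrite !inE.
  have AA : (A' `<=` A)%fset by apply/fsubsetP => w; rewrite A'E => /andP[].
  rewrite -(big_fset_incl _ AA) => [|w wA]; last first.
    rewrite A'E wA/= => wh; rewrite a0 ?normc0// => n nw.
    by move: wh; rewrite -nw sh eqxx.
  rewrite (eq_big_seq (fun w => normc (b (size w)))); last first.
    by move=> w; rewrite A'E => /andP[_ /eqP e]; rewrite {1}e ah_.
  apply: le_trans (bM [fset size w | w in A']%fset).
  rewrite [leRHS]big_imfset; first by [].
  by move=> w w'; rewrite !A'E => /andP[_ /eqP e] /andP[_ /eqP e'] ee; rewrite e e' ee.
apply/(has_sum_reindex _ hinj a0).
rewrite (_ : a \o h = b); last by apply/funext => n; exact: ah_.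
apply/has_sumP => e e0.
have k0 : 0 < N g + 1 by have := ell2_norm_ge0 g; lra.
have [A hA] := ell2_tail f (divr_gt0 e0 k0).
exists [fset absz (lev t - lev s) | s in A]%fset => B AB.
pose D s := (lev s <= lev t) && (absz (lev t - lev s) \in B).
pose D' s := (lev s <= lev t) && (absz (lev t - lev s) \notin B).
have -> : \sum_(n <- B) b n = dot (restr D f) g.
  have -> : \sum_(n <- B) b n = \sum_(n <- B) dot (P n f) g by apply: eq_bigr => n _.
  have <- := @hdot_suml _ _ _ hL nat B (fun n => P n f) g Logic.I (fun=> Logic.I).
  suff -> : \sum_(n <- B) P n f = restr D f by [].
  rewrite /P.
  pose r := [seq lev t - n%:Z | n <- B].
  have ur : uniq r by rewrite map_inj_uniq ?fset_uniq// => m n; lia.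
  rewrite -(big_map (fun n : nat => lev t - n%:Z) xpredT (fun l => level_restr G l f)).
  apply: ell2_ext => s; rewrite sum_level_restr// restrE; congr (if _ then _ else _).
  apply/mapP/andP => [[n nB ->]|[st sB]].
    by rewrite (_ : absz _ = n) ?nB; lia.
  by exists (absz (lev t - lev s)) => //; lia.
have -> : S f t = dot f g by rewrite op_coordE.
have -> : dot (restr D f) g - dot f g = - dot (restr D' f) g.
  rewrite -(hdotBl hL)// -(hdotNl hL)//; apply/eqP; rewrite -subr_eq0 -(hdotBl hL)//; apply/eqP.
  apply: dot_disjoint => s; rewrite !ell2B ell2N !restrE /D /D'.
  case: (leP (lev s) (lev t)) => st /=; last by right; exact: g0.
  by left; case: (_ \in B) => /=; ring.
rewrite normcN; apply: (le_lt_trans (cauchy_schwarz hL _ _)) => //.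
have : N (restr D' f) < e / (N g + 1).
  apply: hA => s sA; rewrite /D' negb_and negbK; apply/orP; right.
  by apply: (fsubsetP AB); apply/imfsetP; exists s.
rewrite ltr_pdivlMr//; apply: le_lt_trans.
by rewrite ler_wpM2l ?hnorm_ge0//; lra.
Qed.

Lemma row_alpha_low d : (forall j, constant_op G (d j)) ->
  low G (-1) (row_alpha G d) /\ upp G (-1) (row_alpha G d).
Proof.
move=> hd; split; rewrite /row_alpha.
  apply: low_sum => i; have /constantP[h _] := hd i.
  by rewrite -[-1]add0r; exact: low_comp h (low_word R G [:: i]).
apply: upp_sum => i; have /constantP[_ h] := hd i.
by rewrite -[-1]add0r; exact: upp_comp h (upp_word R G [:: i]).
Qed.

Lemma row_alpha0 : row_alpha G (fun=> 0) = 0 :> op R T.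
Proof. by rewrite /row_alpha big1. Qed.

(** All that is used of a point [d] of the ball: a geometric bound on the powers of
    [d alpha], and [L], which is [(I - d alpha)^-1]. *)
Definition resolvent d L (M r : R) : Prop :=
  [/\ forall j, constant_op G (d j), 0 <= r /\ r < 1,
    forall n f, N (iter n (row_alpha G d) f) <= M * r ^+ n * N f,
    upp G 0 L & L \o ((idfun : op R T) - row_alpha G d) = idfun /\
    ((idfun : op R T) - row_alpha G d) \o L = idfun].

Lemma ball_resolvent d : tree_ball G d -> exists L M r, resolvent d L M r.
Proof.
move=> [hd [l l1 hl]].
have [hlow hupp] := row_alpha_low hd; have bT := hlow.1.
have [M [r [r0 r1 hM]]] := root_test bT l1 hl.
have [L [bL L1 L2 Lc]] := neumann bT r0 r1 hM.
exists L, M, r; split=> //; split=> // s t; rewrite addr0 => st.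
apply: (ell2_cvg_coord (Lc (chi s))); exists 0%N => n _.
rewrite ell2_sum big1// => i _.
have [_ h] := upp_iter i hupp; apply: h; apply: le_lt_trans st.
by rewrite mulNrn; lia.
Qed.

Lemma resolvent0 : resolvent (fun=> 0) idfun 1 0.
Proof.
split; [|by split|..].
- by move=> j; apply/constantP; split; [exact: low_zero|exact: upp_zero].
- rewrite row_alpha0; case=> [|n] f; first by rewrite expr0 !mul1r.
  by rewrite [iter _ _ _](_ : _ = 0)// ell2_norm0 exprS !(mul0r, mulr0).
- exact: upp_id.
- by rewrite row_alpha0; split; apply/funext => f; apply: ell2_ext => t /=;
    rewrite [LHS](_ : _ = f t - 0) ?subr0.
Qed.

Section Resolvent.
Variables (d : 'I_q -> op R T) (L : op R T) (M r : R).
Hypothesis hres : resolvent d L M r.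
Local Notation A := (row_alpha G d).

Let hd : forall j, constant_op G (d j). Proof. by case: hres. Qed.
Let r0 : 0 <= r. Proof. by case: hres => _ []. Qed.
Let r1 : r < 1. Proof. by case: hres => _ []. Qed.
Let hM n f : N (iter n A f) <= M * r ^+ n * N f. Proof. by case: hres. Qed.

Lemma res_upp : upp G 0 L. Proof. by case: hres. Qed.
Lemma res_bounded : bounded_op L. Proof. by case: res_upp. Qed.
Lemma res_row_low : low G (-1) A. Proof. by case: (row_alpha_low hd). Qed.
Lemma res_row_upp : upp G (-1) A. Proof. by case: (row_alpha_low hd). Qed.
Lemma res_row_bounded : bounded_op A. Proof. by case: res_row_low. Qed.

Lemma resE f : L f = f + A (L f).
Proof.
have [_ _ _ _ [_ /(congr1 (fun X => X f))]] := hres.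
rewrite [LHS](_ : _ = L f - A (L f))// => /eqP; rewrite subr_eq => /eqP; exact.
Qed.

Lemma res_iter n f : L f = \sum_(i < n) iter i A f + iter n A (L f).
Proof.
elim: n => [|n IH]; first by rewrite big_ord0 add0r.
rewrite {1}IH big_ord_recr/= -addrA; congr (_ + _).
rewrite -iterS iterSr -(opD _ _ (bounded_iter n res_row_bounded)).
by rewrite -resE.
Qed.

Lemma res_pos : 0 <= M.
Proof.
have [t _] := ex_node G; have := hM 0 (chi t).
rewrite expr0 mulr1 norm_chi mulr1; apply: le_trans.
by rewrite -?(norm_chi R t) hnorm_ge0.
Qed.

Lemma res_M0 : 0 <= M * (norm_op L + 1).
Proof.
by rewrite mulr_ge0 ?res_pos// addr_ge0// norm_op_ge0//; exact: res_bounded.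
Qed.

Lemma constant_row_word n w : size w = n -> constant_op G (iter n A \o adj (W w)).
Proof.
move=> sw; have e : 0 = - 1 *+ n + (size w)%:Z by rewrite sw mulNrn; lia.
apply/constantP; split; rewrite e.
  exact: low_comp (low_iter _ res_row_low) (low_adj_word _ _ _).
exact: upp_comp (upp_iter _ res_row_upp) (upp_adj_word _ _ _).
Qed.

(** The operators [w^* w] with [w] of length [n] sum to the identity, so the words
    disappear from the [n]-th term. *)
Lemma point_termE S n : bounded_op S -> point_term G S d n = diag G (iter n A \o S).
Proof.
move=> bS; apply/funext => f; rewrite /point_term.
have bAn := bounded_iter n res_row_bounded.
have -> : (iter n A \o (\sum_(w : n.-tuple 'I_q) (adj (W w) \o coef G S w))) f =
    \sum_(w : n.-tuple 'I_q) diag G ((iter n A \o adj (W w)) \o (W w \o S)) f.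
  rewrite /= sum_opE op_sum//; apply: eq_bigr => w _.
  rewrite diag_constl ?coefE//; first exact: bounded_comp (word_op_bounded _ _ _) bS.
  by apply: constant_row_word; rewrite size_tuple.
apply: ell2_ext => t; rewrite ell2_sum diagE; last exact: bounded_comp.
rewrite /= -[in RHS](sum_word_proj G n (S _)) op_sum// ell2_sum.
apply: eq_bigr => w _; rewrite diagE//.
apply: bounded_comp; last exact: bounded_comp (word_op_bounded _ _ _) bS.
exact/bounded_comp/bounded_adj/word_op_bounded.
Qed.

Lemma diag_partial S n : bounded_op S ->
  diag G (L \o S) - \sum_(i < n) diag G (iter i A \o S) =
  diag G ((iter n A \o L) \o S).
Proof.
move=> bS; have bA := res_row_bounded.
have -> : \sum_(i < n) diag G (iter i A \o S) = diag G (\sum_(i < n) (iter i A \o S)).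
  elim: n => [|n IH].
    rewrite !big_ord0 (diag_id (c := 0))//.
    by apply/constantP; split; [exact: low_zero|exact: upp_zero].
  rewrite !big_ord_recr/= IH diag_add//; last exact: bounded_comp (bounded_iter _ _) bS.
  by apply: bounded_sum => i _; exact: bounded_comp (bounded_iter _ _) bS.
rewrite -diag_sub; first last.
- by apply: bounded_sum => i _; exact: bounded_comp (bounded_iter _ _) bS.
- exact: bounded_comp res_bounded bS.
congr diag; apply/funext => f.
rewrite [LHS](_ : _ = L (S f) - (\sum_(i < n) (iter i A \o S)) f)// sum_opE.
by rewrite (res_iter n (S f))/= addrAC subrr add0r.
Qed.

Lemma iter_row_res_le n f : N ((iter n A \o L) f) <= M * (norm_op L + 1) * r ^+ n * N f.
Proof.
apply: (le_trans (hM n (L f))).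
have M0 : 0 <= M * r ^+ n by rewrite mulr_ge0 ?res_pos ?exprn_ge0.
rewrite [leRHS](_ : _ = M * r ^+ n * ((norm_op L + 1) * N f)); last by ring.
rewrite ler_wpM2l//; apply: (le_trans (norm_op_le f res_bounded)).
by rewrite ler_wpM2r ?ell2_norm_ge0// lerDl ler01.
Qed.

Lemma partial_bounded S n : bounded_op S ->
  bounded_op (\sum_(i < n) point_term G S d i).
Proof.
move=> bS; apply: bounded_sum => i _; rewrite point_termE//; apply: diag_bounded.
exact: bounded_comp (bounded_iter _ res_row_bounded) bS.
Qed.

Lemma point_eval_cvg S : bounded_op S ->
  norm_op ((\sum_(n < K) point_term G S d n) - diag G (L \o S)) @[K --> \oo] --> (0 : R).
Proof.
move=> bS; have bLS := bounded_comp res_bounded bS.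
have C0 : 0 <= M * (norm_op L + 1) * norm_op S by rewrite mulr_ge0 ?res_M0 ?norm_op_ge0.
apply/cvgrPdist_lt => e e0.
have [K hK] := geometric_small (M * (norm_op L + 1) * norm_op S) r0 r1 e0.
exists K => // n /= Kn; rewrite sub0r normrN ger0_norm; last first.
  apply: norm_op_ge0; apply: bounded_sub; last exact: diag_bounded.
  exact: partial_bounded.
apply: le_lt_trans (hK n Kn).
have b1 : bounded_op ((iter n A \o L) \o S).
  exact: bounded_comp (bounded_comp (bounded_iter _ res_row_bounded) res_bounded) bS.
apply: norm_op_ub => [|f]; first by rewrite mulr_ge0 ?exprn_ge0.
rewrite (_ : (_ - _) f = - diag G ((iter n A \o L) \o S) f); last first.
  rewrite -diag_partial// -opprB; congr (- (_ f)); congr (_ - _).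
  by apply: eq_bigr => i _; rewrite point_termE.
rewrite (hnormN hL)//.
apply: diag_norm => // [|g]; first by rewrite mulr_ge0 ?exprn_ge0.
apply: (le_trans (iter_row_res_le n (S g))).
rewrite [leRHS](_ : _ = M * (norm_op L + 1) * r ^+ n * (norm_op S * N g)); last by ring.
by rewrite ler_wpM2l ?norm_op_le// mulr_ge0 ?res_M0 ?exprn_ge0.
Qed.

(** Summing the powers of [d alpha] inside [diag]. In this form evaluation makes
    sense without coefficients, and is tractable algebraically. *)
Lemma point_evalE S : bounded_op S -> point_eval G S d = diag G (L \o S).
Proof.
move=> bS; have bLS := diag_bounded G (bounded_comp res_bounded bS).
have hc := point_eval_cvg bS.
rewrite /point_eval; case: xgetP => [Y _ [bY hY]|/(_ (diag G (L \o S)))[]//].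
apply/funext => f; apply/eqP; rewrite -subr_eq0; apply/eqP.
apply: (hnorm0_eq0 hL) => //; apply/eqP.
rewrite eq_le hnorm_ge0 andbT; apply/ler_addgt0Pr => e e0; rewrite add0r.
have k0 : 0 < 2 * (N f + 1) by have := ell2_norm_ge0 f; lra.
move/cvgrPdist_lt: hc => /(_ _ (divr_gt0 e0 k0))[K1 _ h1].
move/cvgrPdist_lt: hY => /(_ _ (divr_gt0 e0 k0))[K2 _ h2].
have := h1 (maxn K1 K2) (leq_maxl _ _); have := h2 (maxn K1 K2) (leq_maxr _ _).
have bZ := partial_bounded (maxn K1 K2) bS.
rewrite /= !sub0r !normrN; move: (\sum_(_ < _) _) bZ => Z bZ.
have b1 := bounded_sub bZ bY; have b2 := bounded_sub bZ bLS.
rewrite !ger0_norm ?norm_op_ge0// !ltr_pdivlMr// => g1 g2.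
rewrite (_ : Y f - diag G (L \o S) f = (Z - diag G (L \o S)) f - (Z - Y) f); last first.
  rewrite [(_ - _) f in RHS](_ : _ = Z f - diag G (L \o S) f)//.
  by rewrite [(Z - Y) f](_ : _ = Z f - Y f)// opprB [RHS]addrC addrA subrK.
have := ell2_normB ((Z - diag G (L \o S)) f) ((Z - Y) f).
have := norm_op_le f b1; have := norm_op_le f b2.
have := norm_op_ge0 b1; have := norm_op_ge0 b2; have := ell2_norm_ge0 f.
nra.
Qed.

(** Subtracting from [S] its value at [d] makes [L S] strictly causal. The diagonal
    then vanishes by definition of the value; and as [L = I + d alpha L], the part of
    degree [- m - 1] is [d alpha] times the part of degree [- m], hence vanishes by
    induction. *)
Lemma res_strict S : low G 0 S -> low G 1 (L \o (S - diag G (L \o S))).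
Proof.
move=> hS; have bS := hS.1; have bL := res_bounded.
have bLS := bounded_comp bL bS; have bd := diag_bounded G bLS.
have bZ := bounded_sub bS bd.
split; first exact: bounded_comp.
move=> s t; move e : (absz (lev s - lev t)) => m.
elim: m t e => [|m IH] t e ts.
  have ts' : lev t = lev s by lia.
  rewrite [LHS](_ : _ = L (S (chi s) - diag G (L \o S) (chi s)) t)// opB// ell2B.
  rewrite (resE (diag G (L \o S) (chi s))) ell2D diag_entry// ts' eqxx /=.
  rewrite [X in _ - (_ + X)](_ : _ = 0) ?addr0 ?subrr//.
  apply: (upp_vanish (n := lev s) res_row_upp); last by lia.
  move=> u us; apply: (upp_vanish (n := lev s) res_upp); last by lia.
  move=> v vs; rewrite diag_entry//; case: eqP => // vs'; move: vs; rewrite vs' ltxx.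
  by [].
have st : lev t < lev s by lia.
rewrite [LHS](_ : _ = L ((S - diag G (L \o S)) (chi s)) t)// resE ell2D.
rewrite [X in X + _](_ : _ = 0) ?add0r; last first.
  rewrite [LHS](_ : _ = S (chi s) t - diag G (L \o S) (chi s) t)//.
  rewrite diag_entry// (lt_eqF st) subr0; apply: hS.2; lia.
apply: op_coord0; first exact: res_row_bounded.
move=> u; have [ut|ut] := eqVneq (lev u) (lev t + 1).
  by left; apply: IH; lia.
right; move: ut; rewrite neq_lt => /orP[ut|ut].
  by apply: res_row_upp.2; lia.
by apply: res_row_low.2; lia.
Qed.

Lemma ker_ballE : ker_ball G d = adj L.
Proof.
have bA := res_row_bounded; have bL := res_bounded.
have [_ _ _ _ [e1 e2]] := hres.
have bI := bounded_sub (bounded_id R T) bA.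
have eA : (idfun : op R T) - adj A = adj ((idfun : op R T) - A).
  by rewrite adj_sub ?adj_id//; exact: bounded_id.
have a1 : adj L \o ((idfun : op R T) - adj A) = idfun.
  by rewrite eA -adj_comp// e2 adj_id.
have a2 : ((idfun : op R T) - adj A) \o adj L = idfun.
  by rewrite eA -adj_comp// e1 adj_id.
rewrite /ker_ball /inv_op; case: xgetP => [Y _ [bY y1 y2]|/(_ (adj L))[]].
  apply/funext => f.
  have := congr1 (fun X => Y (X f)) a2; rewrite /= => <-.
  by have := congr1 (fun X => X (adj L f)) y1.
by split=> //; exact: bounded_adj.
Qed.

End Resolvent.
End Evaluation.

(** * Hilbert-Schmidt operators *)

Section HilbertSchmidt.
Variables (R : realType) (q : nat) (T : choiceType) (G : shift_tree q T).
Implicit Types (s t : T) (f g : ell2 R T) (X Y Z F c k : op R T).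
Local Notation lev := (level G).
Local Notation L2 := (L2 R T).
Local Notation N := (hnorm L2).
Local Notation chi := (chi R).
Local Notation dot := (hdot L2).
Local Notation U := (@shift_op R q T G).
Local Notation H2 := (H2 R G).
Local Notation C2 := (C2 R G).
Local Notation N2 := (hnorm H2).
Let hL := L2_hilbert R T.

(** Causality is left out since multiplication by [(I - c alpha)^-1] destroys it; the
    inner product of [H2] makes sense for all Hilbert-Schmidt operators. *)
Definition hs X : Prop :=
  bounded_op X /\ summable_nneg (fun t => N (X (chi t)) ^+ 2).

Lemma hs_bounded X : hs X -> bounded_op X. Proof. by case. Qed.

Let sq0 X t : 0 <= N (X (chi t)) ^+ 2.
Proof. by rewrite exprn_ge0// ell2_norm_ge0. Qed.

Lemma H2_dotE X Y : bounded_op Y ->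
  hdot H2 X Y = csum (fun t => dot (X (chi t)) (Y (chi t))).
Proof. by move=> bY; apply: csum_ext => t; rewrite [LHS]adjE'. Qed.

Lemma H2P F : hset H2 F <-> low G 0 F /\ hs F.
Proof.
have E : bounded_op F ->
   (fun t => (complex.Re (dot ((adj F \o F) (chi t)) (chi t)))%:E) =
   (fun t => (N (F (chi t)) ^+ 2)%:E).
  by move=> bF; apply/funext => t; rewrite [dot _ _]adjE'// (hnorm_sqr hL).
split=> [[/causalP hF h]|[hF [bF h]]].
  by have bF := hF.1; split=> //; split=> //; rewrite E in h.
by split; [exact/causalP|rewrite E].
Qed.

Lemma hs_norm X : hs X -> N2 X ^+ 2 = nnegsum (fun t => N (X (chi t)) ^+ 2).
Proof.
move=> [bX hX]; rewrite /hnorm H2_dotE//.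
rewrite (@csum_ext _ _ _ (fun t => (N (X (chi t)) ^+ 2)%:C)); last first.
  by move=> t; rewrite (hdot_self hL).
by rewrite csum_nneg// sqr_sqrtr// nnegsum_ge0.
Qed.

Lemma hs_abs_summable X Y : hs X -> hs Y ->
  abs_summable (fun t => dot (X (chi t)) (Y (chi t))).
Proof.
move=> [bX hX] [bY hY].
apply: (@summable_nneg_bound _ _ (fun t => normc (dot (X (chi t)) (Y (chi t))))
  (nnegsum (fun t => N (X (chi t)) ^+ 2) + nnegsum (fun t => N (Y (chi t)) ^+ 2))) => A.
apply: le_trans (lerD (nnegsum_ge A (sq0 X) hX) (nnegsum_ge A (sq0 Y) hY)).
rewrite -big_split/=; apply: ler_sum => t _.
apply: (le_trans (cauchy_schwarz hL _ _)) => //.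
have := sqr_ge0 (N (X (chi t)) - N (Y (chi t))); rewrite sqrrB.
have := sq0 X t; have := sq0 Y t.
by move: (N (X (chi t))) (N (Y (chi t))) => x y; lra.
Qed.

Lemma hs_has_sum X Y : hs X -> hs Y ->
  has_sum (fun t => dot (X (chi t)) (Y (chi t))) (hdot H2 X Y).
Proof.
by move=> hX hY; rewrite H2_dotE; [apply: abs_summable_has_sum; exact: hs_abs_summable|case: hY].
Qed.

Lemma hs_sum_le X (A : {fset T}) : hs X ->
  \sum_(t <- A) N (X (chi t)) ^+ 2 <= N2 X ^+ 2.
Proof. by move=> hX; rewrite hs_norm//; apply: nnegsum_ge => //; case: hX. Qed.

Lemma hs_bound X (M : R) : bounded_op X ->
  (forall A : {fset T}, \sum_(t <- A) N (X (chi t)) ^+ 2 <= M) ->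
  hs X /\ N2 X ^+ 2 <= M.
Proof.
move=> bX hM; have hX : hs X by split=> //; exact: summable_nneg_bound hM.
by split=> //; rewrite hs_norm//; apply: nnegsum_le.
Qed.

Lemma hs_chi_le X t : hs X -> N (X (chi t)) <= N2 X.
Proof.
move=> hX; rewrite -(@ler_pXn2r _ 2)// ?nnegrE ?hnorm_ge0//.
by have := hs_sum_le [fset t]%fset hX; rewrite big_seq_fset1.
Qed.

Lemma hs_mono X Y (K : R) : bounded_op X -> 0 <= K -> hs Y ->
  (forall t, N (X (chi t)) <= K * N (Y (chi t))) -> hs X /\ N2 X <= K * N2 Y.
Proof.
move=> bX K0 hY h.
have [|hX hN] := @hs_bound X ((K * N2 Y) ^+ 2) bX.
  move=> A; apply: (@le_trans _ _ (\sum_(t <- A) K ^+ 2 * N (Y (chi t)) ^+ 2)).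
    by apply: ler_sum => t _; rewrite -exprMn lerXn2r// ?nnegrE ?mulr_ge0 ?hnorm_ge0.
  by rewrite -mulr_sumr exprMn ler_wpM2l ?exprn_ge0 ?hs_sum_le.
split=> //; rewrite -(@ler_pXn2r _ 2)// ?nnegrE ?hnorm_ge0 ?mulr_ge0 ?hnorm_ge0//.
Qed.

Lemma hs_lmul Z X (K : R) : bounded_op Z -> 0 <= K ->
  (forall f, N (Z f) <= K * N f) -> hs X -> hs (Z \o X) /\ N2 (Z \o X) <= K * N2 X.
Proof.
move=> bZ K0 hZ hX; apply: hs_mono => // [|t]; last exact: hZ.
by apply: bounded_comp => //; case: hX.
Qed.

Lemma hs_diag X : hs X -> hs (diag G X) /\ N2 (diag G X) <= N2 X.
Proof.
move=> hX; have bX := hX.1; rewrite -[leRHS]mul1r; apply: hs_mono => //.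
  exact: diag_bounded.
by move=> t; rewrite mul1r diag_chi//; exact: restr_norm.
Qed.

Lemma hs_shiftr j X : hs X -> hs (X \o adj (U j)) /\ N2 (X \o adj (U j)) <= N2 X.
Proof.
move=> hX; have bX := hX.1.
have [|h1 h2] := @hs_bound (X \o adj (U j)) (N2 X ^+ 2)
    (bounded_comp bX (bounded_adj (shift_op_bounded _ _ _))).
  move=> A; apply: le_trans (hs_sum_le [fset tree_shift G j t | t in A]%fset hX).
  rewrite big_imfset/=; last by move=> s t _ _; exact: shift_injl.
  by apply: ler_sum => t _; rewrite /= adj_shift_chi.
by split=> //; rewrite -(@ler_pXn2r _ 2)// ?nnegrE ?hnorm_ge0.
Qed.

Lemma shift_chi j t : U j (chi (tree_shift G j t)) = chi t.
Proof.
apply: ell2_ext => s; rewrite shift_opE !chiE; congr (nat_of_bool _)%:R.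
by apply/eqP/eqP => [/shift_injl|->].
Qed.

Lemma shift_chi_out j s : (forall t, tree_shift G j t <> s) -> U j (chi s) = 0.
Proof.
by move=> h; apply: ell2_ext => t; rewrite shift_opE chiE; case: eqP => // /h.
Qed.

Lemma hs_shiftl j X : hs X -> hs (X \o U j) /\ N2 (X \o U j) <= N2 X.
Proof.
move=> hX; have bX := hX.1.
have [|h1 h2] := @hs_bound (X \o U j) (N2 X ^+ 2)
    (bounded_comp bX (shift_op_bounded _ _ _)).
  move=> A.
  pose A' := [fset s in A | s == tree_shift G j (parent G s)]%fset.
  have A'E s : (s \in A') = (s \in A) && (s == tree_shift G j (parent G s)) by rewrite !inE.
  have AA : (A' `<=` A)%fset by apply/fsubsetP => w; rewrite A'E => /andP[].
  rewrite -(big_fset_incl _ AA) => [|s sA]; last first.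
    rewrite A'E sA/= => /eqP ns; rewrite shift_chi_out; last first.
      by move=> t ts; apply: ns; rewrite -ts parent_shift.
    by rewrite op0// ell2_norm0 expr0n.
  apply: le_trans (hs_sum_le [fset parent G s | s in A']%fset hX).
  rewrite [leRHS]big_imfset; last first.
    by move=> s t; rewrite !A'E => /andP[_ /eqP e] /andP[_ /eqP e'] h; rewrite e h -e'.
  rewrite le_eqVlt; apply/orP; left; apply/eqP; apply: eq_big_seq => s.
  by rewrite A'E => /andP[_ /eqP {1}->]; rewrite /= shift_chi.
by split=> //; rewrite -(@ler_pXn2r _ 2)// ?nnegrE ?hnorm_ge0.
Qed.

(** [adj (U j)] maps the basis injectively into itself, with left inverse [U j],
    which kills the rest of the basis. *)
Lemma hs_dot_shift j X Y : hs X -> hs Y ->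
  hdot H2 (X \o adj (U j)) Y = hdot H2 X (Y \o U j).
Proof.
move=> hX hY.
have h1 := hs_has_sum (hs_shiftr j hX).1 hY.
have h2 := hs_has_sum hX (hs_shiftl j hY).1.
apply: (has_sum_unique h1); move: h2.
move=> /(has_sum_reindex _ (@shift_injl _ _ G j)); rewrite (_ : _ \o _ =
    fun t => dot ((X \o adj (U j)) (chi t)) (Y (chi t))); last first.
  by apply/funext => t; rewrite /= shift_chi adj_shift_chi.
apply=> s hs; rewrite [(Y \o U j) _](_ : _ = Y (U j (chi s)))// shift_chi_out//.
by rewrite op0; [exact: (hdot0r hL)|case: hY].
Qed.

Lemma hs_dot_adj Z X Y : bounded_op Z -> hs Y ->
  hdot H2 (Z \o X) Y = hdot H2 X (adj Z \o Y).
Proof.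
move=> bZ [bY _]; rewrite (H2_dotE _ bY) (H2_dotE _ (bounded_comp (bounded_adj bZ) bY)).
by apply: csum_ext => t; exact: (adjE _ _ bZ).
Qed.

(** The images of the basis vectors under a constant live on single horocycles. *)
Lemma hs_dot_diag X k : bounded_op X -> constant_op G k -> hdot H2 X k = hdot H2 (diag G X) k.
Proof.
move=> bX hk; have bk := constant_bounded hk; rewrite !H2_dotE//.
apply: csum_ext => t; rewrite diag_chi//.
apply/eqP; rewrite -subr_eq0 -(hdotBl hL)//; apply/eqP; apply: dot_disjoint => s.
rewrite ell2B level_restrE; case: eqVneq => st; first by left; rewrite subrr.
by right; rewrite (constant_entry (G := G)).
Qed.

(** Cauchy-Schwarz on each coordinate [<g, X chi_t>] of [adj X g]. *)
Lemma hs_op_le X f : hs X -> N (X f) <= N2 X * N f.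
Proof.
move=> hX; have bX := hX.1.
have h g : N (adj X g) <= N2 X * N g.
  rewrite -(@ler_pXn2r _ 2)// ?nnegrE ?hnorm_ge0 ?mulr_ge0 ?hnorm_ge0//.
  apply: ell2_norm_le => A; rewrite exprMn.
  apply: (@le_trans _ _ (\sum_(t <- A) N (X (chi t)) ^+ 2 * N g ^+ 2)).
    apply: ler_sum => s _; rewrite -dot_chi adjE'// -exprMn.
    rewrite lerXn2r// ?nnegrE ?mulr_ge0 ?hnorm_ge0 ?normc_ge0// mulrC.
    exact: (cauchy_schwarz hL).
  by rewrite -mulr_suml ler_wpM2r ?exprn_ge0 ?hnorm_ge0 ?hs_sum_le.
by have := norm_adj_le (bounded_adj bX) h f; rewrite (adjK bX).
Qed.

Lemma hs_lin (a : R[i]) X Y : hs X -> hs Y -> hs (a *: X + Y).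
Proof.
move=> hX hY; have bX := hX.1; have bY := hY.1.
have b := bounded_add (bounded_scale a bX) bY.
have [|//] := @hs_bound (a *: X + Y) (2 * normc a ^+ 2 * N2 X ^+ 2 + 2 * N2 Y ^+ 2) b.
move=> A; apply: (@le_trans _ _ (\sum_(t <- A) (2 * normc a ^+ 2 * N (X (chi t)) ^+ 2 +
    2 * N (Y (chi t)) ^+ 2))).
  apply: ler_sum => t _; rewrite [(_ + _) (chi t)](_ : _ = a *: X (chi t) + Y (chi t))//.
  have := parallelogram hL (x := a *: X (chi t)) (y := Y (chi t)) Logic.I Logic.I.
  rewrite ell2_normZ exprMn.
  have := sqr_ge0 (N (a *: X (chi t) - Y (chi t))); lra.
rewrite big_split/= -!mulr_sumr lerD//.
  by rewrite ler_wpM2l ?hs_sum_le// mulr_ge0// exprn_ge0// normc_ge0.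
by rewrite ler_wpM2l ?hs_sum_le.
Qed.

Lemma hs_zero : hs 0.
Proof.
split; first exact: bounded_zero.
apply: (@summable_nneg_bound _ _ _ 0) => A.
by rewrite big1// => t _; rewrite [0 _](_ : _ = 0)// ell2_norm0 expr0n.
Qed.

Lemma hs_sub X Y : hs X -> hs Y -> hs (X - Y).
Proof. by move=> hX hY; rewrite addrC -scaleN1r; exact: hs_lin. Qed.

(** Since the Hilbert-Schmidt norm dominates the operator norm, a Cauchy sequence
    converges pointwise; bounds on finite sums then pass to the limit. *)
Lemma hs_complete (u : nat -> op R T) : (forall n, hs (u n)) ->
  (forall e : R, 0 < e -> exists K, forall m n, (K <= m)%N -> (K <= n)%N ->
     N2 (u m - u n) < e) ->
  exists2 X, hs X & (forall f, cvg_in L2 (fun n => u n f) (X f)) /\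
    forall e : R, 0 < e -> exists K, forall n, (K <= n)%N -> N2 (u n - X) < e.
Proof.
move=> hu uC.
have ex f : exists l, cvg_in L2 (fun n => u n f) l.
  have : cauchy_in L2 (fun n => u n f).
    move=> e e0; have k0 : 0 < N f + 1 by have := ell2_norm_ge0 f; lra.
    have [K hK] := uC _ (divr_gt0 e0 k0); exists K => m n Km Kn.
    apply: le_lt_trans (hs_op_le f (hs_sub (hu m) (hu n))) _.
    have := hK _ _ Km Kn; rewrite ltr_pdivlMr//; apply: le_lt_trans.
    by rewrite ler_wpM2l ?hnorm_ge0//; lra.
  by case: hL => _ _ _ _ hc /hc[//|l _ hl]; exists l.
have [X hX] := choice ex.
have Xu f l : cvg_in L2 (fun n => u n f) l -> l = X f.
  by move=> h; apply: (cvg_in_unique hL _ _ _ h (hX f)).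
have [K1 hK1] := uC _ ltr01.
have bX : bounded_op X.
  apply: (@bounded_opI _ _ _ (N2 (u K1) + 1)) => [a f g|f].
    apply/esym/Xu; rewrite (_ : (fun n => _) = fun n => a *: u n f + u n g).
      exact: (cvg_in_lin hL).
    by apply/funext => n; rewrite (op_linear _ _ _ (hu n).1).
  apply: (cvg_in_norm_le hL _ _ (hX f)) => //; exists K1 => n Kn.
  have h1 := hs_op_le f (hs_sub (hu n) (hu K1)).
  have h2 := hs_op_le f (hu K1).
  have h3 := ell2_normD ((u n - u K1) f) (u K1 f).
  rewrite [X in N X <= _](_ : _ = u n f) in h3; last first.
    by rewrite [(u n - _) f](_ : _ = u n f - u K1 f)// subrK.
  have := hK1 _ _ Kn (leqnn _); have := ell2_norm_ge0 f; move: h1 h2 h3.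
  move: (N (u n f)) (N _) (N _) (N f) (N2 _) (N2 _) => x y z w v o; nra.
have key (e : R) : 0 < e -> exists K, forall n, (K <= n)%N ->
    hs (u n - X) /\ N2 (u n - X) ^+ 2 <= e ^+ 2.
  move=> e0; have [K hK] := uC _ e0; exists K => n Kn.
  apply: hs_bound => [|A]; first exact: bounded_sub (hu n).1 bX.
  apply: (finite_sum_limit_le (x := fun m t => N ((u n - u m) (chi t)) ^+ 2)).
    move=> t c c0; pose b := N ((u n - X) (chi t)).
    have b0 : 0 <= b by exact: ell2_norm_ge0.
    have e1 : 0 < c / (2 * b + 1) by rewrite divr_gt0//; lra.
    have /cvg_inP/(_ _ e1)[M hM] := hX (chi t); exists M => m Mm.
    have := hM _ Mm; rewrite ltr_pdivlMr; last lra.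
    have := ell2_normD ((u n - u m) (chi t)) (u m (chi t) - X (chi t)).
    rewrite [(u n - u m) _ + _](_ : _ = (u n - X) (chi t)); last first.
      by rewrite [(u n - u m) _](_ : _ = u n (chi t) - u m (chi t))// addrA subrK.
    exact: sqr_le_perturb b0 (ell2_norm_ge0 _) (ell2_norm_ge0 _).
  exists K => m Mm; apply: le_trans (hs_sum_le A (hs_sub (hu n) (hu m))) _.
  by rewrite lerXn2r// ?nnegrE ?hnorm_ge0 ?ltW//; exact: hK.
exists X.
  have [K hK] := key _ ltr01; have [h _] := hK _ (leqnn _).
  have -> : X = (-1) *: (u K - X) + u K by rewrite scaleN1r opprB subrK.
  exact: hs_lin.
split=> // e e0; have [K hK] := key _ (divr_gt0 e0 (ltr0Sn R 1)).
exists K => n Kn; have [_ h] := hK _ Kn.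
apply: (@le_lt_trans _ _ (e / 2)); last by lra.
by rewrite -(@ler_pXn2r _ 2)// ?nnegrE ?hnorm_ge0//; apply: ltW; rewrite divr_gt0.
Qed.

Let hs_hilbert_dots (D : set (op R T)) : (forall X, D X -> hs X) ->
  [/\ forall (a : R[i]) X Y Z, D X -> D Y -> D Z ->
        hdot H2 (a *: X + Y) Z = a * hdot H2 X Z + hdot H2 Y Z,
      forall X Y, D X -> D Y -> hdot H2 Y X = conjc (hdot H2 X Y)
    & forall X, D X -> 0 <= hdot H2 X X /\ (hdot H2 X X = 0 -> X = 0)].
Proof.
move=> Dhs; split.
- move=> a X Y Z /Dhs hX /Dhs hY /Dhs hZ.
  apply: (has_sum_unique (hs_has_sum (hs_lin a hX hY) hZ)).
  have := has_sumD (has_sumZ a (hs_has_sum hX hZ)) (hs_has_sum hY hZ).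
  rewrite (_ : (fun t => _ + _) = fun t => dot ((a *: X + Y) (chi t)) (Z (chi t)))//.
  apply/funext => t; rewrite [(_ + _) (chi t)](_ : _ = a *: X (chi t) + Y (chi t))//.
  by rewrite (hdotL hL).
- move=> X Y /Dhs hX /Dhs hY; apply: (has_sum_unique (hs_has_sum hY hX)).
  have := has_sumJ (hs_has_sum hX hY).
  rewrite (_ : (fun t => conjc _) = fun t => dot (Y (chi t)) (X (chi t)))//.
  by apply/funext => t; rewrite -ell2_dotC.
move=> X /Dhs hX; have bX := hX.1.
have -> : hdot H2 X X = (N2 X ^+ 2)%:C.
  rewrite H2_dotE// hs_norm// -csum_nneg//; last by case: hX.
  by apply: csum_ext => t; rewrite (hdot_self hL).
split; first by rewrite lecR exprn_ge0// hnorm_ge0.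
move=> -[/eqP]; rewrite sqrf_eq0 => /eqP n0; apply: op_ext => //; first exact: bounded_zero.
move=> s t; rewrite [RHS](_ : _ = 0)//.
suff -> : X (chi s) = 0 by [].
apply: (hnorm0_eq0 hL) => //; apply/eqP; rewrite eq_le hnorm_ge0 andbT -n0.
exact: hs_chi_le.
Qed.

Lemma H2_hs F : hset H2 F -> hs F. Proof. by move=> /H2P[]. Qed.

Lemma H2_hilbert : is_hilbert H2.
Proof.
have [h1 h2 h3] := hs_hilbert_dots H2_hs.
split=> //.
  split; first by apply/H2P; split; [exact: low_zero|exact: hs_zero].
  move=> a X Y /H2P[lX hX] /H2P[lY hY]; apply/H2P; split; last exact: hs_lin.
  by apply: low_add => //; exact: low_scale.
move=> u hu uC; have [X hX [Xc hc]] := hs_complete (fun n => H2_hs (hu n)) uC.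
have lX : low G 0 X.
  split=> [|s t st]; first by case: hX.
  apply: (ell2_cvg_coord (Xc (chi s))); exists 0%N => n _.
  by have /H2P[[_ h] _] := hu n; exact: h.
by exists X; [exact/H2P|exact/cvg_inP].
Qed.

Lemma C2P k : hset C2 k <-> constant_op G k /\ hs k.
Proof.
split=> [[hk /H2P[_ h]]|[hk h]] //.
by split=> //; apply/H2P; split=> //; case/constantP: hk.
Qed.

Lemma C2_H2 k : hset C2 k -> hset H2 k. Proof. by case. Qed.

Lemma C2_hilbert : is_hilbert C2.
Proof.
have [h1 h2 h3] := hs_hilbert_dots (fun k (hk : hset C2 k) => H2_hs (C2_H2 hk)).
split=> //.
  split.
    apply/C2P; split; last exact: hs_zero.
    by apply/constantP; split; [exact: low_zero|exact: upp_zero].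
  move=> a X Y /C2P[/constantP[lX uX] hX] /C2P[/constantP[lY uY] hY]; apply/C2P.
  split; last exact: hs_lin.
  apply/constantP; split; first by apply: low_add => //; exact: low_scale.
  by apply: upp_add => //; exact: upp_scale.
move=> u hu uC.
have [X hX [Xc hc]] := hs_complete (fun n => H2_hs (C2_H2 (hu n))) uC.
have kX : constant_op G X.
  apply: constantI => [|s t st]; first by case: hX.
  apply: (ell2_cvg_coord (Xc (chi s))); exists 0%N => n _.
  by have [h _] := hu n; exact: (constant_entry h).
by exists X; [exact/C2P|exact/cvg_inP].
Qed.

Lemma hs_rank1 f t : hs (rank1 f t) /\ N2 (rank1 f t) <= N f.
Proof.
have [|h1 h2] := @hs_bound (rank1 f t) (N f ^+ 2) (bounded_rank1 f t).
  move=> A; apply: (@le_trans _ _ (\sum_(s <- A) if s == t then N f ^+ 2 else 0)).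
    apply: ler_sum => s _; rewrite rank1_chi eq_sym; case: ifP => // _.
    by rewrite ell2_norm0 expr0n.
  have [tA|tA] := boolP (t \in A).
    rewrite (big_fsetD1 t)//= eqxx big_seq big1 ?addr0// => s.
    by rewrite !inE => /andP[/negPf ->].
  rewrite big_seq big1 ?exprn_ge0 ?hnorm_ge0// => s sA.
  by case: eqP => // e; rewrite -e sA in tA.
by split=> //; rewrite -(@ler_pXn2r _ 2)// ?nnegrE ?hnorm_ge0.
Qed.

End HilbertSchmidt.

Section DirectSum.
Variables (R : realType) (V W : lmodType R[i]).
Variables (H : preHilbert V) (K : preHilbert W).
Hypotheses (hH : is_hilbert H) (hK : is_hilbert K).

Lemma dsum_norm x y : hset H x -> hset K y ->
  hnorm (dsum H K) (x, y) ^+ 2 = hnorm H x ^+ 2 + hnorm K y ^+ 2.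
Proof.
move=> hx hy; rewrite {1}/hnorm /= !hdot_self// -[_ + _](rmorphD (real_complex R))/=.
by rewrite sqr_sqrtr// addr_ge0// exprn_ge0// hnorm_ge0.
Qed.

Lemma dsum_hilbert : is_hilbert (dsum H K).
Proof.
split.
- split; first by split; exact: hset0.
  by move=> a x y [hx1 hx2] [hy1 hy2]; split; exact: hsetL.
- move=> a x y z [hx1 hx2] [hy1 hy2] [hz1 hz2] /=.
  by rewrite !hdotL// mulrDr addrACA.
- by move=> x y [hx1 hx2] [hy1 hy2] /=; rewrite rmorphD/= -!hdotC.
- move=> [x y] [/= hx hy]; rewrite !hdot_self// -[_ + _](rmorphD (real_complex R)).
  have x0 := sqr_ge0 (hnorm H x); have y0 := sqr_ge0 (hnorm K y).
  split; first by rewrite lecR addr_ge0.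
  move=> -[/eqP]; rewrite paddr_eq0// !sqrf_eq0 => /andP[/eqP nx /eqP ny].
  by rewrite (hnorm0_eq0 hH hx nx) (hnorm0_eq0 hK hy ny).
move=> u hu uC.
have le1 p : hset (dsum H K) p -> hnorm H p.1 <= hnorm (dsum H K) p.
  case: p => x y [hx hy]; rewrite -(@ler_pXn2r _ 2)// ?nnegrE ?hnorm_ge0//.
  by rewrite dsum_norm// lerDl exprn_ge0// hnorm_ge0.
have le2 p : hset (dsum H K) p -> hnorm K p.2 <= hnorm (dsum H K) p.
  case: p => x y [hx hy]; rewrite -(@ler_pXn2r _ 2)// ?nnegrE ?hnorm_ge0//.
  by rewrite dsum_norm// lerDr exprn_ge0// hnorm_ge0.
have hB m n : hset (dsum H K) (u m - u n).
  by have [a1 a2] := hu m; have [b1 b2] := hu n; split; exact: hsetB.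
have [x hx /cvg_inP ux] : exists2 x, hset H x & cvg_in H (fun n => (u n).1) x.
  case: hH => _ _ _ _; apply; first by move=> n; case: (hu n).
  move=> e /uC[M hM]; exists M => m n Mm Mn; apply: le_lt_trans (hM _ _ Mm Mn).
  exact: (le1 (u m - u n)).
have [y hy /cvg_inP uy] : exists2 y, hset K y & cvg_in K (fun n => (u n).2) y.
  case: hK => _ _ _ _; apply; first by move=> n; case: (hu n).
  move=> e /uC[M hM]; exists M => m n Mm Mn; apply: le_lt_trans (hM _ _ Mm Mn).
  exact: (le2 (u m - u n)).
exists (x, y); first by split.
apply/cvg_inP => e e0.
have [M1 h1] := ux _ (divr_gt0 e0 (ltr0Sn R 1)).
have [M2 h2] := uy _ (divr_gt0 e0 (ltr0Sn R 1)).
exists (maxn M1 M2) => n; rewrite geq_max => /andP[/h1 g1 /h2 g2].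
have [a1 a2] := hu n.
rewrite -(@ltr_pXn2r _ 2)// ?nnegrE ?hnorm_ge0 ?ltW//.
rewrite [u n - _](_ : _ = ((u n).1 - x, (u n).2 - y)); last by case: (u n).
rewrite dsum_norm//; [|exact: hsetB|exact: hsetB].
have := hnorm_ge0 H ((u n).1 - x); have := hnorm_ge0 K ((u n).2 - y).
move: (hnorm _ _) (hnorm _ _) g1 g2 => a b; nra.
Qed.

End DirectSum.

(** * Square roots and ranges *)

Section SquareRoot.
Variables (R : realType) (V : lmodType R[i]) (K : preHilbert V).
Hypothesis hK : is_hilbert K.
Variable A : V -> V.
Hypotheses (bA : bounded_linear K K A)
  (A_contr : forall x, hset K x -> hnorm K (A x) <= hnorm K x)
  (A_sym : forall x y, hset K x -> hset K y -> hdot K (A x) y = hdot K x (A y)).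
Local Notation N := (hnorm K).
Local Notation inK := (hset K).

Let half : R[i] := (2^-1 : R)%:C.

Let half_norm : normc half = 2^-1 :> R.
Proof. by rewrite normc_real ger0_norm// invr_ge0. Qed.

(** With [A] a self-adjoint contraction, [I - Y] squares to [I - A] when [Y] is the
    fixed point of [Y = (A + Y ^ 2) / 2], and the iteration from 0 converges since
    it is dominated by the scalar one, at [A = 1]. *)
Fixpoint sqrt_iter (n : nat) : V -> V := fun x =>
  if n is n'.+1 then half *: (A x + sqrt_iter n' (sqrt_iter n' x)) else 0.

Fixpoint sqrt_bound (n : nat) : R :=
  if n is n'.+1 then (1 + sqrt_bound n' ^+ 2) / 2 else 0.

Local Notation Y := sqrt_iter.
Local Notation y := sqrt_bound.

Let hA x : inK x -> inK (A x). Proof. by case: bA => h _ _; exact: h. Qed.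

Lemma sqrt_bound01 n : 0 <= y n <= 1.
Proof. by elim: n => [|n /andP[h0 h1]] /=; rewrite ?lexx ?ler01//; apply/andP; split; nra. Qed.

Lemma sqrt_bound_mono n m : (n <= m)%N -> y n <= y m.
Proof.
have step k : y k <= y k.+1.
  by rewrite /=; have := sqr_ge0 (1 - y k); rewrite sqrrB expr1n mul1r; lra.
elim: m => [|m IH]; first by rewrite leqn0 => /eqP ->.
rewrite leq_eqVlt => /orP[/eqP ->//|]; rewrite ltnS => /IH h.
exact: le_trans h (step m).
Qed.

Lemma sqrt_iter_in n x : inK x -> inK (Y n x).
Proof.
elim: n x => [|n IH] x hx /=; first exact: hset0.
by apply: (hsetZ hK); apply: (hsetD hK); [exact: hA|exact/IH/IH].
Qed.

Lemma sqrt_iter_lin n (a : R[i]) x z : inK x -> inK z ->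
  Y n (a *: x + z) = a *: Y n x + Y n z.
Proof.
elim: n x z => [|n IH] x z hx hz /=; first by rewrite scaler0 addr0.
rewrite (IH _ _ hx hz) (IH _ _ (sqrt_iter_in n hx) (sqrt_iter_in n hz)).
case: bA => _ -> // _.
rewrite !scalerDr !scalerA [half * a]mulrC -!addrA; congr (_ + _).
by rewrite addrCA.
Qed.

Lemma sqrt_iterB n x z : inK x -> inK z -> Y n (x - z) = Y n x - Y n z.
Proof. by move=> hx hz; rewrite addrC -scaleN1r sqrt_iter_lin// scaleN1r addrC. Qed.

Lemma sqrt_iter_norm n x : inK x -> N (Y n x) <= y n * N x.
Proof.
elim: n x => [|n IH] x hx /=; first by rewrite (hnorm0 hK) mul0r.
have h1 := sqrt_iter_in n hx; have h2 := sqrt_iter_in n h1.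
have := hnormD hK (hA hx) h2; rewrite (hnormZ hK _ (hsetD hK (hA hx) h2)) half_norm.
have := IH _ h1; have := IH _ hx; have := A_contr hx.
have /andP[y0 _] := sqrt_bound01 n; have := hnorm_ge0 K x.
move: (N (A x)) (N (Y n x)) (N (Y n (Y n x))) (N _) (N x) (y n) y0 => a b c d e f.
move=> f0 e0 ae bfe cfb dac; nra.
Qed.

Lemma sqrt_iter_step n x : inK x -> N (Y n.+1 x - Y n x) <= (y n.+1 - y n) * N x.
Proof.
elim: n x => [|n IH] x hx.
  rewrite [Y 0 x]/= [y 0]/= !subr0; exact: (sqrt_iter_norm 1).
have hn k z (hz : inK z) := sqrt_iter_in k hz.
pose D z := Y n.+1 z - Y n z.
have -> : Y n.+2 x - Y n.+1 x = half *: (Y n.+1 (D x) + D (Y n x)).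
  rewrite -[Y n.+2 x]/(half *: (A x + Y n.+1 (Y n.+1 x))).
  rewrite -[X in _ - X]/(half *: (A x + Y n (Y n x))) -scalerBr; congr (_ *: _).
  rewrite /D (sqrt_iterB n.+1); [|exact: hn|exact: hn].
  by rewrite addrA subrK opprD addrACA subrr add0r.
have hD z : inK z -> inK (D z) by move=> hz; apply: (hsetB hK); exact: hn.
have h1 := hn n.+1 _ (hD _ hx); have h2 := hD _ (hn n _ hx).
rewrite (hnormZ hK)//; last exact: (hsetD hK).
rewrite half_norm.
have := hnormD hK h1 h2.
have := sqrt_iter_norm n.+1 (hD _ hx); have := IH _ hx; have := IH _ (hn n _ hx).
have := sqrt_iter_norm n hx.
have -> : y n.+2 - y n.+1 = (y n.+1 - y n) * (y n.+1 + y n) / 2.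
  by rewrite -[y n.+2]/((1 + y n.+1 ^+ 2) / 2) {2}[y n.+1]/=; field.
rewrite -/(D x) -/(D (Y n x)).
have /andP[z0 _] := sqrt_bound01 n.+1; have /andP[w0 _] := sqrt_bound01 n.
have zw : y n <= y n.+1 by exact: sqrt_bound_mono.
have x0 := hnorm_ge0 K x.
move: (N (Y n.+1 (D x))) (N (D (Y n x))) (N (D x)) (N (Y n x)) (N _) z0 w0 zw.
move: (y n.+1) (y n) (N x) x0 => p q e e0 a b c d f p0 q0 pq de bd ce apc fab.
have h3 : b <= (p - q) * (q * e) by apply: (le_trans bd); rewrite ler_wpM2l ?subr_ge0.
have h4 : a <= p * ((p - q) * e) by apply: (le_trans apc); rewrite ler_wpM2l.
rewrite mulrC ler_pdivrMr//.
by rewrite (_ : _ * 2 = p * ((p - q) * e) + (p - q) * (q * e)); [lra|field].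
Qed.

Lemma sqrt_iter_dist n m x : (n <= m)%N -> inK x ->
  N (Y m x - Y n x) <= (y m - y n) * N x.
Proof.
move=> nm hx; have hn k := sqrt_iter_in k hx.
elim: m nm => [|m IH]; first by rewrite leqn0 => /eqP ->; rewrite !subrr (hnorm0 hK) mul0r.
rewrite leq_eqVlt => /orP[/eqP ->|]; first by rewrite !subrr (hnorm0 hK) mul0r.
rewrite ltnS => /IH h; apply: (le_trans (hnorm_dist hK (hn _) (hn m) (hn _))).
have := sqrt_iter_step m hx; rewrite !mulrBl in h *; lra.
Qed.

Lemma sqrt_iter_sym n x z : inK x -> inK z -> hdot K (Y n x) z = hdot K x (Y n z).
Proof.
elim: n x z => [|n IH] x z hx hz /=; first by rewrite hdot0l// hdot0r.
have h1 := sqrt_iter_in n hx; have h2 := sqrt_iter_in n h1.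
have h3 := sqrt_iter_in n hz; have h4 := sqrt_iter_in n h3.
rewrite (hdotZl hK)//; last by apply: (hsetD hK) => //; exact: hA.
rewrite (hdotZr hK)//; last by apply: (hsetD hK) => //; exact: hA.
rewrite (hdotDl hK)//; last exact: hA.
rewrite (hdotDr hK)//; last exact: hA.
by rewrite A_sym// !IH// conjc_real.
Qed.

Lemma sqrt_bound_cauchy (e : R) : 0 < e ->
  exists M, forall m n, (M <= n)%N -> (n <= m)%N -> y m - y n < e.
Proof.
move=> e0.
have : cvgn y.
  apply: nondecreasing_is_cvgn; first by move=> n m /sqrt_bound_mono.
  by exists 1 => _ [n _ <-]; case/andP: (sqrt_bound01 n).
move=> /cvg_ex[l /cvgrPdist_lt/(_ _ (divr_gt0 e0 (ltr0Sn R 1)))[M _ hM]].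
exists M => m n Mn nm; have := hM n Mn; have := hM m (leq_trans Mn nm).
rewrite /= !ltr_norml => /andP[h1 h2] /andP[h3 h4]; lra.
Qed.

Lemma ex_sqrt : exists P : V -> V, [/\ bounded_linear K K P,
  forall x, inK x -> 0 <= hdot K (P x) x &
  forall x, inK x -> P (P x) = x - A x].
Proof.
have hYK n x (hx : inK x) := sqrt_iter_in n hx.
have ex x : exists l, inK x -> inK l /\ cvg_in K (fun n => Y n x) l.
  have [hx|nx] := pselect (inK x); last by exists 0.
  have : cauchy_in K (fun n => Y n x).
    move=> e e0; have k0 : 0 < N x + 1 by have := hnorm_ge0 K x; lra.
    have [M hM] := sqrt_bound_cauchy (divr_gt0 e0 k0).
    have key m n : (M <= n)%N -> (n <= m)%N -> N (Y m x - Y n x) < e.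
      move=> Mn nm; apply: (le_lt_trans (sqrt_iter_dist nm hx)).
      have := hM _ _ Mn nm; rewrite ltr_pdivlMr//; apply: le_lt_trans.
      by rewrite ler_wpM2l ?subr_ge0 ?sqrt_bound_mono// lerDl ler01.
    exists M => m n Mm Mn; case: (leqP n m) => nm; first exact: key.
    by rewrite (hnormBC hK (hYK _ _ hx) (hYK _ _ hx)); apply: key => //; exact: ltnW.
  case: hK => _ _ _ _ hc /hc [n|l hl cl]; first exact: hYK.
  by exists l.
have [Z hZ] := choice ex.
have ZK x : inK x -> inK (Z x) by move=> /hZ[].
have Zc x : inK x -> cvg_in K (fun n => Y n x) (Z x) by move=> /hZ[].
have Zlin a x z : inK x -> inK z -> Z (a *: x + z) = a *: Z x + Z z.
  move=> hx hz; have hxz := hsetL hK a hx hz.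
  apply: (cvg_in_unique hK (fun n => hYK n _ hxz) _ _ (Zc _ hxz)).
  - exact: ZK.
  - by apply: (hsetL hK); exact: ZK.
  rewrite (_ : (fun n => _) = fun n => a *: Y n x + Y n z).
    exact: (cvg_in_lin hK a (fun n => hYK n _ hx) (fun n => hYK n _ hz)
      (ZK _ hx) (ZK _ hz) (Zc _ hx) (Zc _ hz)).
  by apply/funext => n; exact: sqrt_iter_lin.
have Znorm x : inK x -> N (Z x) <= N x.
  move=> hx; apply: (cvg_in_norm_le hK (fun n => hYK n _ hx) (ZK _ hx) (Zc _ hx)).
  exists 0%N => n _; apply: (le_trans (sqrt_iter_norm n hx)).
  have /andP[_ y1] := sqrt_bound01 n; rewrite -[leRHS]mul1r.
  by rewrite ler_wpM2r ?hnorm_ge0.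
have ZB x z : inK x -> inK z -> Z (x - z) = Z x - Z z.
  by move=> hx hz; rewrite addrC -scaleN1r Zlin// scaleN1r addrC.
have Zsym x z : inK x -> inK z -> hdot K (Z x) z = hdot K x (Z z).
  move=> hx hz; apply/eqP; rewrite -subr_eq0; apply/eqP; apply: eq0_normc.
  apply/eqP; rewrite eq_le normc_ge0 andbT; apply/ler_addgt0Pr => e e0; rewrite add0r.
  have k0 : 0 < N x + N z + 1 by have := hnorm_ge0 K x; have := hnorm_ge0 K z; lra.
  have /cvg_inP/(_ _ (divr_gt0 e0 k0))[M1 h1] := Zc _ hx.
  have /cvg_inP/(_ _ (divr_gt0 e0 k0))[M2 h2] := Zc _ hz.
  set n := maxn M1 M2; have g1 := h1 n (leq_maxl _ _); have g2 := h2 n (leq_maxr _ _).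
  have i1 := hYK n _ hx; have i2 := hYK n _ hz; have i3 := ZK _ hx; have i4 := ZK _ hz.
  have -> : hdot K (Z x) z - hdot K x (Z z) =
      hdot K x (Y n z - Z z) - hdot K (Y n x - Z x) z.
    by rewrite (hdotBr hK)// (hdotBl hK)// sqrt_iter_sym//; ring.
  apply: (le_trans (le_normcD _ _)); rewrite normcN.
  have j1 := cauchy_schwarz hK hx (hsetB hK i2 i4).
  have j2 := cauchy_schwarz hK (hsetB hK i1 i3) hz.
  move: g1 g2; rewrite !ltr_pdivlMr// => g1 g2.
  have := hnorm_ge0 K x; have := hnorm_ge0 K z.
  have := hnorm_ge0 K (Y n z - Z z); have := hnorm_ge0 K (Y n x - Z x).
  move: j1 j2 g1 g2; move: (normc _) (normc _) (N _) (N _) (N x) (N z) => a b c d f g.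
  nra.
have Zfix x : inK x -> Z x = half *: (A x + Z (Z x)).
  move=> hx; have i0 := ZK _ hx; have i1 := ZK _ i0; have i2 := hA hx.
  have i3 : inK (half *: (A x + Z (Z x))) by apply: (hsetZ hK); exact: (hsetD hK).
  apply: (cvg_in_unique hK (fun n => hYK n.+1 _ hx) i0 i3).
    have /cvg_inP h := Zc _ hx; apply/cvg_inP => e /h[M hM]; exists M => n Mn.
    by apply: hM; exact: leqW.
  apply/cvg_inP => e e0.
  have /cvg_inP/(_ _ e0)[M1 h1] := Zc _ hx.
  have /cvg_inP/(_ _ e0)[M2 h2] := Zc _ i0.
  exists (maxn M1 M2) => n; rewrite geq_max => /andP[/h1 g1 /h2 g2].
  rewrite -[Y n.+1 x]/(half *: (A x + Y n (Y n x))) -scalerBr.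
  have j1 := hYK n _ hx; have j2 := hYK n _ j1; have j3 := hYK n _ i0.
  rewrite (_ : _ - _ = Y n (Y n x - Z x) + (Y n (Z x) - Z (Z x))); last first.
    by rewrite sqrt_iterB// addrA subrK opprD addrACA subrr add0r.
  have k1 := hsetB hK j1 i0; have k2 := hYK n _ k1; have k3 := hsetB hK j3 i1.
  rewrite (hnormZ hK); last exact: (hsetD hK).
  rewrite half_norm; have := hnormD hK k2 k3.
  have := sqrt_iter_norm n k1; have /andP[y0 y1] := sqrt_bound01 n.
  have := hnorm_ge0 K (Y n x - Z x).
  move: g1 g2; move: (N _) (N _) (N _) (N _) (y n) y0 y1 => a b c d f; nra.
exists (fun x => x - Z x); split.
- split; first by move=> x hx; apply: (hsetB hK) => //; exact: ZK.
    by move=> a x z hx hz; rewrite Zlin// scalerBr opprD addrACA.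
  exists 2 => x hx; apply: (le_trans (hnormB hK hx (ZK _ hx))).
  by have := Znorm _ hx; lra.
- move=> x hx; have i0 := ZK _ hx; rewrite (hdotBl hK)// (hdot_self hK hx).
  have h1 := cauchy_schwarz hK i0 hx; have h2 := Znorm _ hx.
  have h3 := hdotC hK i0 hx; rewrite -Zsym// in h3.
  have h4 := Re_le_normc (hdot K (Z x) x).
  have := hnorm_ge0 K x.
  move: h1 h3 h4; case: (hdot K (Z x) x) => u v.
  move=> h1 [h3] h4 n0; rewrite lecE/=; apply/andP; split.
    by apply/eqP; lra.
  have := ler_norm u; move: h1 h4 => /=; move: (Num.sqrt _) (N (Z x)) (N x) h2 n0 => a b c.
  nra.
move=> x hx; have i0 := ZK _ hx; have i1 := ZK _ i0.
rewrite ZB//.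
have {}h : Z x + Z x = A x + Z (Z x).
  rewrite {1 2}(Zfix _ hx) -scalerDl /half -(rmorphD (real_complex R)).
  by rewrite (_ : 2^-1 + 2^-1 = 1) ?scale1r//; field.
have -> : A x = Z x + Z x - Z (Z x) by rewrite h addrK.
by rewrite -[Z x + Z x - _]addrA [in RHS]opprD [RHS]addrA.
Qed.

End SquareRoot.

Section ClosedRange.
Variables (R : realType) (V W : lmodType R[i]).
Variables (H : preHilbert V) (K : preHilbert W).
Hypotheses (hH : is_hilbert H) (hK : is_hilbert K).
Variable A : V -> W.
Hypothesis bA : bounded_linear H K A.

Definition range_closure : set W := [set l | hset K l /\
  exists2 y : nat -> V, (forall n, hset H (y n)) & cvg_in K (A \o y) l].

Lemma range_closure_image x : hset H x -> range_closure (A x).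
Proof.
move=> hx; split; first by case: bA => h _ _; exact: h.
exists (fun=> x) => //; apply/cvg_inP => e e0; exists 0%N => n _.
by rewrite /= subrr (hnorm0 hK).
Qed.

Lemma range_closure_closed : closed_subspace K range_closure.
Proof.
have AK x : hset H x -> hset K (A x) by case: bA => h _ _; exact: h.
split; first by move=> l [].
- by have [_ <- _ _ _] := bounded_linearE hH bA; apply: range_closure_image; exact: hset0.
- move=> a l m [hl [y hy yl]] [hm [z hz zm]]; split; first exact: (hsetL hK).
  exists (fun n => a *: y n + z n); first by move=> n; exact: (hsetL hH).
  rewrite (_ : _ \o _ = fun n => a *: (A \o y) n + (A \o z) n).
    by apply: (cvg_in_lin hK) => //= n; exact: AK.
  by apply/funext => n /=; case: bA => _ -> // _.
move=> u l hu hl /cvg_inP ul; split=> //.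
have ex n : exists x, hset H x /\ hnorm K (A x - u n) < n.+1%:R^-1.
  have [hun [y hy /cvg_inP yu]] := hu n.
  have [|M hM] := yu n.+1%:R^-1; first by rewrite invr_gt0.
  by exists (y M); split=> //; exact: hM.
have [y hy] := choice ex; exists y => [n|]; first by case: (hy n).
apply/cvg_inP => e e0.
have [M1 h1] := ul _ (divr_gt0 e0 (ltr0Sn R 1)).
have [M2 h2] := ltr_add_invr (y := 0) (x := e / 2) (divr_gt0 e0 (ltr0Sn R 1)).
rewrite add0r in h2; exists (maxn M1 M2) => n; rewrite geq_max => /andP[/h1 g1 g2].
have [hyn hn] := hy n; have [hun _] := hu n.
have g3 : n.+1%:R^-1 <= M2.+1%:R^-1 :> R by rewrite lef_pV2 ?posrE// ler_nat ltnS.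
have := hnorm_dist hK (AK _ hyn) hun hl.
move: hn g3 h2; rewrite /=; move: n.+1%:R^-1 M2.+1%:R^-1 => a b; lra.
Qed.

End ClosedRange.

(** Let [H] be contained in [K], the inclusion being bounded with adjoint [J]. If
    [P] is the positive square root of the composite of [J] with the inclusion, then
    [|J y|_H = |P y|_K], so that [P y |-> J y] extends by continuity to the closure
    of the range of [P]; the extension is [P] itself there, and is isometric for the
    norms of [K] and [H]. *)
Section RangeOfSquareRoot.
Variables (R : realType) (V : lmodType R[i]) (H K : preHilbert V).
Hypotheses (hH : is_hilbert H) (hK : is_hilbert K).
Variables (J P : V -> V).
Hypotheses (HK : bounded_linear H K idfun) (JA : is_adjoint H K idfun J).
Hypotheses (bP : bounded_linear K K P) (P0 : forall x, hset K x -> 0 <= hdot K (P x) x)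
  (PP : forall x, hset K x -> P (P x) = J x).
Local Notation inK := (hset K).
Local Notation inH := (hset H).

Let HKin x : inH x -> inK x. Proof. by case: HK => h _ _; exact: h. Qed.
Let PK x : inK x -> inK (P x). Proof. by case: bP => h _ _; exact: h. Qed.
Let JH x : inK x -> inH (J x). Proof. by case: JA => -[h _ _] _; exact: h. Qed.
Let Jadj x y : inH x -> inK y -> hdot K x y = hdot H x (J y).
Proof. by case: JA => _; exact. Qed.

(** Polarization of the reality of the quadratic form. *)
Lemma positive_symmetric x y : inK x -> inK y -> hdot K (P x) y = hdot K x (P y).
Proof.
have [_ _ PZ PD _] := bounded_linearE hK bP.
have real z : inK z -> complex.Im (hdot K (P z) z) = 0.
  by move=> hz; have := P0 hz; rewrite lecE/= => /andP[/eqP].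
move=> hx hy; have hPx := PK hx; have hPy := PK hy.
have e1 := real _ (hsetD hK hx hy).
have hiy := hsetZ hK 'i hy.
have e2 := real _ (hsetD hK hx hiy).
move: e1 e2; rewrite !PD// PZ//.
have hiPy := hsetZ hK 'i hPy.
rewrite !(hdotDl hK) ?(hdotDr hK)//; try exact: (hsetD hK).
rewrite !(hdotZl hK)// !(hdotZr hK)//.
have := real _ hx; have := real _ hy.
rewrite (hdotC hK hPy hx).
move: (hdot K (P x) x) (hdot K (P y) y) (hdot K (P x) y) (hdot K (P y) x).
move=> [a b] [c d] [f g] [h k] /= -> ->; rewrite !(mul0r, mul1r, add0r, mulr0, addr0, sub0r, oppr0).
move=> e1 e2; congr (_ +i* _); lra.
Qed.

Lemma norm_J y : inK y -> hnorm H (J y) = hnorm K (P y).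
Proof.
move=> hy; apply/eqP; rewrite -(@eqrXn2 _ 2) ?hnorm_ge0//; apply/eqP.
rewrite (hnorm_sqr hH (JH hy)) (hnorm_sqr hK (PK hy)) -Jadj//; last exact: JH.
by rewrite -PP// positive_symmetric//; exact: PK.
Qed.

Let PB x y : inK x -> inK y -> P (x - y) = P x - P y.
Proof. by have [_ _ _ _ h] := bounded_linearE hK bP; exact: h. Qed.
Let JB x y : inK x -> inK y -> J (x - y) = J x - J y.
Proof. by have [bJ _] := JA; have [_ _ _ _ h] := bounded_linearE hK bJ; exact: h. Qed.

(** The Cauchy sequences [P y_n] and [J y_n] determine each other. *)
Lemma range_sqrt_closure (y : nat -> V) l : (forall n, inK (y n)) -> inK l ->
  cvg_in K (P \o y) l -> [/\ inH (P l), cvg_in H (J \o y) (P l) & hnorm H (P l) = hnorm K l].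
Proof.
move=> hy hl yl.
have hPy n : inK ((P \o y) n) by exact: PK.
have hJy n : inH ((J \o y) n) by exact: JH.
have yC := cvg_in_cauchy hK hPy hl yl.
have JC : cauchy_in H (J \o y).
  move=> e /yC[M hM]; exists M => m n Mm Mn; have := hM _ _ Mm Mn.
  by rewrite /= -PB// -JB// norm_J//; exact: (hsetB hK).
have [w hw yw] : exists2 w, inH w & cvg_in H (J \o y) w.
  by case: hH => _ _ _ _; apply.
have ew : w = P l.
  apply: (cvg_in_unique hK (u := J \o y)); [by move=> n; apply: HKin|exact: HKin|exact: PK| |].
    exact: (bounded_linear_cvg hH HK hJy hw yw).
  rewrite (_ : J \o y = P \o (P \o y)); last by apply/funext => n /=; rewrite PP.
  exact: (bounded_linear_cvg hK bP hPy hl yl).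
rewrite -ew; split=> //; apply/eqP; rewrite eq_le; apply/andP; split.
  apply/ler_addgt0Pr => e e0.
  have /cvg_inP/(_ _ (divr_gt0 e0 (ltr0Sn R 1)))[M1 h1] := yw.
  have /cvg_inP/(_ _ (divr_gt0 e0 (ltr0Sn R 1)))[M2 h2] := yl.
  set n := maxn M1 M2; have g1 := h1 n (leq_maxl _ _); have g2 := h2 n (leq_maxr _ _).
  have := hnormB hH (hJy n) (hsetB hH (hJy n) hw); rewrite subKr.
  have := hnormD hK (hsetB hK (hPy n) hl) hl; rewrite subrK.
  by rewrite {2}/comp (norm_J (hy n)) -/((P \o y) n); move: g1 g2; rewrite /=; lra.
apply/ler_addgt0Pr => e e0.
have /cvg_inP/(_ _ (divr_gt0 e0 (ltr0Sn R 1)))[M1 h1] := yw.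
have /cvg_inP/(_ _ (divr_gt0 e0 (ltr0Sn R 1)))[M2 h2] := yl.
set n := maxn M1 M2; have g1 := h1 n (leq_maxl _ _); have g2 := h2 n (leq_maxr _ _).
have := hnormB hK (hPy n) (hsetB hK (hPy n) hl); rewrite subKr.
have := hnormD hH (hsetB hH (hJy n) hw) hw; rewrite subrK.
by rewrite {2}/comp (norm_J (hy n)) -/((P \o y) n); move: g1 g2; rewrite /=; lra.
Qed.

Lemma range_sqrt_decomposition x : inK x -> exists p, [/\ range_closure K K P p,
  P (x - p) = 0, P x = P p & forall z, inK z -> J z = 0 -> hdot K p z = 0].
Proof.
move=> hx.
have [p Mp orth] := orthogonal_projection hK (range_closure_closed hK hK bP) hx.
have hp : inK p by case: Mp.
have hxp := hsetB hK hx hp.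
have e : P (x - p) = 0.
  apply: (hdot_eq0_all hK); first exact: PK.
  move=> z hz; rewrite positive_symmetric//; apply: orth.
  exact: (range_closure_image hK bP).
exists p; split=> //; first by apply/eqP; rewrite -subr_eq0 -PB// e.
move=> z hz Jz.
have Pz : P z = 0.
  apply: (hnorm0_eq0 hK); first exact: PK.
  by rewrite -norm_J// Jz (hnorm0 hH).
case: Mp => _ [y hy yp].
apply: (cvg_in_dot_eq hK _ hp hz yp); first by move=> n; exact: PK.
by exists 0%N => n _; rewrite /= positive_symmetric// Pz (hdot0r hK).
Qed.

(** The range of [J] is dense in [H], as [J] is adjoint to an injection; so every
    element of [H] is a limit of some [J y_n], and then the [P y_n] converge too. *)
Lemma range_sqrt : hset H = [set P x | x in hset K].
Proof.
apply/seteqP; split=> [h hh|_ [x hx <-]]; last first.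
  have [p [[hp [y hy yp]] _ -> _]] := range_sqrt_decomposition hx.
  by have [] := range_sqrt_closure hy hp yp.
have [bJ _] := JA.
have [p Mp orth] := orthogonal_projection hH (range_closure_closed hK hH bJ) hh.
have hp : inH p by case: Mp.
have hhp := hsetB hH hh hp.
have e : h = p.
  apply/eqP; rewrite -subr_eq0; apply/eqP; apply: (hdot_eq0_all hK); first exact: HKin.
  move=> z hz; rewrite Jadj//; apply: orth.
  exact: (range_closure_image hH bJ).
rewrite e; case: Mp => _ [y hy yp].
have hPy n : inK ((P \o y) n) by exact: PK.
have hJy n : inH ((J \o y) n) by exact: JH.
have yC := cvg_in_cauchy hH hJy hp yp.
have PC : cauchy_in K (P \o y).
  move=> d /yC[M hM]; exists M => m n Mm Mn; have := hM _ _ Mm Mn.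
  by rewrite /= -PB// -JB// norm_J//; exact: (hsetB hK).
have [l hl yl] : exists2 l, inK l & cvg_in K (P \o y) l.
  by case: hK => _ _ _ _; apply.
exists l => //; have [hPl Pl _] := range_sqrt_closure hy hl yl.
exact: (cvg_in_unique hH hJy hPl hp Pl yp).
Qed.

Lemma range_sqrt_norm x : inK x ->
  hnorm H (P x) = hnorm K (x - orthoproj K [set z | inK z /\ J z = 0] x).
Proof.
move=> hx; have [p [[hp [y hy yp]] Pxp -> orth]] := range_sqrt_decomposition hx.
have [_ _ ->] := range_sqrt_closure hy hp yp.
have J0 z : inK z -> P z = 0 -> J z = 0.
  by move=> hz Pz; rewrite -PP// Pz; have [_ -> _ _ _] := bounded_linearE hK bP.
have hxp := hsetB hK hx hp.
rewrite /orthoproj; case: xgetP => [m _ [[hm Jm] om]|/(_ (x - p)) []]; last first.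
  by split; [split => //; exact: J0|move=> z [hz Jz]; rewrite subKr; exact: orth].
suff -> : x - m = p by [].
have hxm := hsetB hK hx hm.
have hd : inK (x - m - p) by exact: (hsetB hK).
apply/eqP; rewrite -subr_eq0; apply/eqP; apply: (hnorm0_eq0 hK) => //.
apply/eqP; rewrite -sqrf_eq0 (hnorm_sqr hK)//.
have Jd : J (x - m - p) = 0.
  by rewrite addrAC JB// (J0 (x - p))// Jm subrr.
by rewrite {1}(hdotBl hK)// om// orth// subrr.
Qed.

End RangeOfSquareRoot.

(** * The observability operator of a colligation *)

Section Realization.
Local Opaque Defs.H2 hs low upp constant_op causal.
Variables (R : realType) (q : nat) (T : choiceType) (G : shift_tree q T).
Variable H : preHilbert (op R T : lmodType R[i]).
Hypotheses (hH : is_hilbert H) (H_sub : hset H `<=` hset (H2 R G))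
  (H_inv : right_invariant G H).
Variable j : 'I_q.
Variables A B C D : op R T -> op R T.
Local Notation L2 := (L2 R T).
Local Notation H2 := (H2 R G).
Local Notation C2 := (C2 R G).
Local Notation U := (@shift_op R q T G j).
Local Notation V := (block A B C D).
Local Notation HC := (dsum H C2).
Hypotheses (bA : bounded_linear H H A) (bB : bounded_linear C2 H B)
  (bC : bounded_linear H C2 C) (bD : bounded_linear C2 C2 D)
  (bV : bounded_linear HC HC V).
Hypotheses
  (A_mod : forall F c : op R T, hset H F -> constant_op G c ->
     A (F \o c) = A F \o adj U \o c \o U)
  (B_mod : forall d c : op R T, hset C2 d -> constant_op G c ->
     B (d \o c) = B d \o adj U \o c \o U)
  (C_mod : forall F c : op R T, hset H F -> constant_op G c -> C (F \o c) = C F \o c)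
  (D_mod : forall d c : op R T, hset C2 d -> constant_op G c -> D (d \o c) = D d \o c)
  (VV : forall F d : op R T, hset H F -> hset C2 d ->
     V (adjoint HC HC V (F, d)) = (F \o (adj U \o U), d)).
Implicit Types (s t : T) (f g : ell2 R T) (F X Y c d k : op R T).
Local Notation lev := (level G).
Local Notation N := (hnorm L2).
Local Notation N2 := (hnorm H2).
Local Notation NH := (hnorm H).
Local Notation chi := (chi R).
Local Notation dot := (hdot L2).
Let hL := L2_hilbert R T.
Let h2 := H2_hilbert R G.
Let hC := C2_hilbert R G.
Let hHC : is_hilbert HC. Proof. exact: dsum_hilbert. Qed.

Let AH F : hset H F -> hset H (A F). Proof. by case: bA => h _ _; exact: h. Qed.
Let BH d : hset C2 d -> hset H (B d). Proof. by case: bB => h _ _; exact: h. Qed.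
Let CC F : hset H F -> hset C2 (C F). Proof. by case: bC => h _ _; exact: h. Qed.
Let DC d : hset C2 d -> hset C2 (D d). Proof. by case: bD => h _ _; exact: h. Qed.
Let AnH n F : hset H F -> hset H (iter n A F).
Proof. by move=> hF; elim: n => [//|n IH] /=; exact: AH. Qed.

Let bU : bounded_op U. Proof. exact: shift_op_bounded. Qed.
Let bUs : bounded_op (adj U). Proof. exact: bounded_adj. Qed.
Let lowUs : low G 1 (adj U). Proof. exact: (low_adj_word R G [:: j]). Qed.
Let uppUs : upp G 1 (adj U). Proof. exact: (upp_adj_word R G [:: j]). Qed.
Let lowU : low G (-1) U. Proof. exact: (low_word R G [:: j]). Qed.
Let UK f : U (adj U f) = f. Proof. exact: shift_opK. Qed.

Let H2low F : hset H2 F -> low G 0 F. Proof. by move=> /H2P[]. Qed.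
Let H2hs F : hset H2 F -> hs F. Proof. exact: H2_hs. Qed.
Let H2b F : hset H2 F -> bounded_op F. Proof. by move=> /H2hs[]. Qed.
Let Cconst d : hset C2 d -> constant_op G d. Proof. by move=> /C2P[]. Qed.

Lemma H2_shiftr X : hset H2 X -> [/\ hset H2 (X \o adj U), low G 1 (X \o adj U) &
  N2 (X \o adj U) <= N2 X].
Proof.
move=> hX; have [h1 hn] := hs_shiftr G j (H2hs hX).
have lX : low G 1 (X \o adj U) by rewrite -[1]add0r; exact: low_comp (H2low hX) lowUs.
split; [apply/H2P; split; [exact: low_weaken lX|exact: h1]|exact: lX|exact: hn].
Qed.

Lemma H2_rank1 f t : (forall s, lev s != lev t -> f s = 0) ->
  hset C2 (rank1 f t) /\ N2 (rank1 f t) <= N f.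
Proof.
move=> hf; have [h1 hn] := hs_rank1 G f t; split; last exact: hn.
by apply/C2P; split; [exact: constant_rank1|exact: h1].
Qed.

Lemma norm_shift_proj : norm_op (adj U \o U) <= 1 :> R.
Proof.
have hU f : N (U f) <= 1 * N f by rewrite mul1r; exact: word_op_norm.
apply: norm_op_ub => // f; apply: (le_trans (norm_adj_le bU hU _)).
by rewrite mul1r; exact: hU.
Qed.

Let Vs_adj : is_adjoint HC HC V (adjoint HC HC V).
Proof. exact: (adjointP hHC hHC). Qed.

(** [V V^*] being below the identity, [V^*] and hence [V] are contractions. *)
Lemma colligation_contraction F d : hset H F -> hset C2 d ->
  NH (A F + B d) ^+ 2 + N2 (C F + D d) ^+ 2 <= NH F ^+ 2 + N2 d ^+ 2.
Proof.
move=> hF hd.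
have [[VsHC _ _] adjV] := Vs_adj.
have [VHC _ _] := bV.
have star p : hset HC p -> hnorm HC (adjoint HC HC V p) <= hnorm HC p.
  move: p => [X k] [/= hX hk]; have hp : hset HC (X, k) by split.
  have hVp := VsHC _ hp.
  apply: le_of_sqr; first exact: hnorm_ge0.
  rewrite (hnorm_sqr hHC hVp) -(adjV _ _ hVp hp) (VV hX hk) (dsum_norm hH hC hX hk).
  have -> : hdot HC (X \o (adj U \o U), k) (X, k) =
      hdot H (X \o (adj U \o U)) X + hdot C2 k k by [].
  rewrite complex_ReD -(hnorm_sqr hC hk) lerD2r.
  apply: le_trans (ler_norm _) _; apply: le_trans (Re_le_normc _) _.
  have [hXE hn _] := H_inv hX hX (constant_shift R G j).
  apply: (le_trans (cauchy_schwarz hH hXE hX)); rewrite expr2.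
  apply: ler_wpM2r; first exact: hnorm_ge0.
  apply: (le_trans hn); rewrite -[leRHS]mulr1.
  by apply: ler_wpM2l; [exact: hnorm_ge0|exact: norm_shift_proj].
have hp : hset HC (F, d) by split.
have hVp := VHC _ hp.
have key : hnorm HC (V (F, d)) <= hnorm HC (F, d).
  have [->|n0] := eqVneq (hnorm HC (V (F, d))) 0; first exact: hnorm_ge0.
  have np : 0 < hnorm HC (V (F, d)) by rewrite lt_def n0 hnorm_ge0.
  rewrite -(ler_pM2r np) -expr2 (hnorm_sqr hHC hVp) (adjV _ _ hp hVp).
  apply: le_trans (ler_norm _) _; apply: le_trans (Re_le_normc _) _.
  apply: (le_trans (cauchy_schwarz hHC hp (VsHC _ hVp))).
  by apply: ler_wpM2l; [exact: hnorm_ge0|exact: star].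
have [h1 h2'] := hVp.
have := sqr_le (hnorm_ge0 _ _) key.
by rewrite (dsum_norm hH hC h1 h2') (dsum_norm hH hC hF hd).
Qed.

Lemma A_contraction F : hset H F -> N2 (C F) ^+ 2 + NH (A F) ^+ 2 <= NH F ^+ 2.
Proof.
move=> hF; have := colligation_contraction hF (hset0 hC).
have [_ -> _ _ _] := bounded_linearE hC bB.
have [_ -> _ _ _] := bounded_linearE hC bD.
by rewrite !addr0 (hnorm0 h2) expr0n/= addr0 addrC.
Qed.

Fixpoint obs (n : nat) F : op R T :=
  if n is n'.+1 then C F + (obs n' (A F) \o adj U) else 0.

Lemma obs_in n F : hset H F -> hset H2 (obs n F).
Proof.
elim: n F => [|n IH] F hF /=; first exact: (hset0 h2).
by apply: (hsetD h2); [exact/C2_H2/CC|case: (H2_shiftr (IH _ (AH hF)))].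
Qed.

(** Only the diagonal of [X] meets a constant, and it vanishes. *)
Lemma C2_orthogonal k X : hset C2 k -> hset H2 X -> low G 1 X -> hdot H2 k X = 0.
Proof.
move=> hk hX lX; rewrite (hdotC h2 hX (C2_H2 hk)).
rewrite (hs_dot_diag (H2b hX) (Cconst hk)) (diag_eq0 lX).
by rewrite (hdot0l h2 (C2_H2 hk)) rmorph0.
Qed.

(** Terms of different degree are orthogonal, so the energies lost by the state at
    each step add up. *)
Lemma obs_norm n F : hset H F -> N2 (obs n F) ^+ 2 <= NH F ^+ 2 - NH (iter n A F) ^+ 2.
Proof.
elim: n F => [|n IH] F hF; first by rewrite /= (hnorm0 h2) expr0n subrr.
have [hX lX nX] := H2_shiftr (obs_in n (AH hF)).
rewrite [obs _ _]/= (hnorm_pythagoras h2 (C2_H2 (CC hF)) hX); last first.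
  exact: C2_orthogonal (CC hF) hX lX.
have h := IH _ (AH hF); rewrite -iterSr in h.
apply: (le_trans (lerD (lexx _) (le_trans (sqr_le (hnorm_ge0 _ _) nX) h))).
by rewrite addrA lerD2r; exact: A_contraction.
Qed.

Lemma obs_dist m n F : hset H F ->
  N2 (obs (m + n) F - obs m F) ^+ 2 <= NH (iter m A F) ^+ 2 - NH (iter (m + n) A F) ^+ 2.
Proof.
elim: m F => [|m IH] F hF; first by rewrite add0n [obs 0 _]/= subr0; exact: obs_norm.
rewrite addSn !iterSr; apply: le_trans (IH _ (AH hF)).
have hd := hsetB h2 (obs_in (m + n) (AH hF)) (obs_in m (AH hF)).
have [_ _ hn] := H2_shiftr hd.
apply: sqr_le; first exact: hnorm_ge0.
rewrite (_ : obs (m + n).+1 F - obs m.+1 F =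
  (obs (m + n) (A F) - obs m (A F)) \o adj U)//.
by rewrite [LHS]/= opprD addrACA subrr add0r.
Qed.

Lemma obs_cvg F : hset H F -> exists2 X, hset H2 X & cvg_in H2 (fun n => obs n F) X.
Proof.
move=> hF; pose a n := NH (iter n A F) ^+ 2.
have aS n : a n.+1 <= a n.
  rewrite /a iterS; have := A_contraction (AnH n hF).
  by apply: le_trans; rewrite lerDr sqr_ge0.
have : cvgn a.
  apply: nonincreasing_is_cvgn; first exact/nonincreasing_seqP.
  by exists 0 => _ [n _ <-]; exact: sqr_ge0.
move=> /cvg_ex[l /cvgrPdist_lt al].
have : cauchy_in H2 (fun n => obs n F).
  move=> e e0; have e2 : 0 < e ^+ 2 / 2 by rewrite divr_gt0// exprn_gt0.
  have [M _ hM] := al _ e2.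
  have key m n : (M <= m)%N -> N2 (obs (m + n) F - obs m F) < e.
    move=> Mm; rewrite ltNge; apply/negP => /(sqr_le (ltW e0)).
    move/le_trans => /(_ _ (obs_dist m n hF)); rewrite -/(a m) -/(a (m + n)%N).
    have := dist_halves (hM m Mm) (hM (m + n)%N (leq_trans Mm (leq_addr _ _))).
    by rewrite ltNge => /negP.
  exists M => m n Mm Mn; case: (leqP m n) => mn.
    by rewrite (hnormBC h2 (obs_in _ hF) (obs_in _ hF)) -(subnKC mn); exact: key.
  by rewrite -(subnKC (ltnW mn)); exact: key.
by case: h2 => _ _ _ _; apply => n; exact: obs_in.
Qed.

Let ex_O F : exists X, hset H F -> hset H2 X /\ cvg_in H2 (fun n => obs n F) X.
Proof.
have [/obs_cvg[X h1 h2']|nF] := pselect (hset H F); first by exists X.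
by exists 0.
Qed.

(** The observability operator of the colligation: [O F] is the causal operator
    whose part of degree [n] is [C (A^n F) U^{n*}]. *)
Definition O : op R T -> op R T := projT1 (choice ex_O).

Lemma O_in F : hset H F -> hset H2 (O F).
Proof. by move=> hF; case: (projT2 (choice ex_O) F hF). Qed.

Lemma O_lim F : hset H F -> cvg_in H2 (fun n => obs n F) (O F).
Proof. by move=> hF; case: (projT2 (choice ex_O) F hF). Qed.

Lemma O_norm F : hset H F -> N2 (O F) <= NH F.
Proof.
move=> hF; apply: (cvg_in_norm_le h2 (fun n => obs_in n hF) (O_in hF) (O_lim hF)).
exists 0%N => n _; apply: le_of_sqr; first exact: hnorm_ge0.
by apply: (le_trans (obs_norm n hF)); rewrite gerBl sqr_ge0.
Qed.

Lemma O_cvg F f : hset H F -> cvg_in L2 (fun n => obs n F f) (O F f).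
Proof.
move=> hF; have /cvg_inP h := O_lim hF; apply/cvg_inP => e e0.
have k0 : 0 < N f + 1 by have := ell2_norm_ge0 f; lra.
have [M hM] := h _ (divr_gt0 e0 k0); exists M => n Mn.
have hd := hsetB h2 (obs_in n hF) (O_in hF).
apply: (le_lt_trans (hs_op_le G f (H2hs hd))).
have := hM _ Mn; rewrite ltr_pdivlMr//; apply: le_lt_trans.
by rewrite ler_wpM2l ?hnorm_ge0//; lra.
Qed.

Lemma O_unique F X : hset H F -> (forall f, cvg_in L2 (fun n => obs n F f) (X f)) -> O F = X.
Proof.
move=> hF hX; apply/funext => f.
exact: (cvg_in_unique hL (fun=> Logic.I) Logic.I Logic.I (O_cvg f hF) (hX f)).
Qed.

Lemma obs_lin n (a : R[i]) F X : hset H F -> hset H X ->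
  obs n (a *: F + X) = a *: obs n F + obs n X.
Proof.
elim: n F X => [|n IH] F X hF hX; first by rewrite /= scaler0 addr0.
have [_ Al _] := bA; have [_ Cl _] := bC.
rewrite [LHS]/= Al// Cl// IH; [|exact: AH|exact: AH].
rewrite [RHS](_ : _ = a *: (C F + (obs n (A F) \o adj U)) + (C X + (obs n (A X) \o adj U)))//.
by rewrite scalerDr addrACA.
Qed.

Lemma O_lin (a : R[i]) F X : hset H F -> hset H X -> O (a *: F + X) = a *: O F + O X.
Proof.
move=> hF hX; apply: O_unique; first exact: (hsetL hH).
move=> f; rewrite (_ : (fun n => _) = fun n => a *: obs n F f + obs n X f); last first.
  by apply/funext => n; rewrite obs_lin.
exact: (cvg_in_lin hL a (fun=> Logic.I) (fun=> Logic.I) Logic.I Logic.I (O_cvg f hF) (O_cvg f hX)).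
Qed.

Lemma O_bounded : bounded_linear H H2 O.
Proof.
split; [exact: O_in|exact: O_lin|exists 1 => F hF].
by rewrite mul1r; exact: O_norm.
Qed.

Lemma OD F X : hset H F -> hset H X -> O (F + X) = O F + O X.
Proof. by move=> hF hX; have := O_lin 1 hF hX; rewrite !scale1r. Qed.

Lemma O_rec F : hset H F -> O F = C F + (O (A F) \o adj U).
Proof.
move=> hF; apply: O_unique => // f.
have /cvg_inP h := O_cvg (adj U f) (AH hF); apply/cvg_inP => e /h[M hM].
exists M.+1 => -[//|n] Mn; have := hM n Mn.
rewrite [obs n.+1 F f](_ : _ = C F f + obs n (A F) (adj U f))//.
by rewrite [(_ + _) f](_ : _ = C F f + O (A F) (adj U f))// opprD addrACA subrr add0r.
Qed.

Lemma constant_conj_shift c : constant_op G c -> constant_op G ((adj U \o c) \o U).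
Proof.
move=> /constantP[lc uc]; apply/constantP; split.
  by apply: (low_weaken (k := 1 + 0 + -1)) => //; exact: low_comp (low_comp lowUs lc) lowU.
have uU : upp G (-1) U by exact: (upp_word R G [:: j]).
by apply: (upp_weaken (k := 1 + 0 + -1)) => //; exact: upp_comp (upp_comp uppUs uc) uU.
Qed.

Lemma H_right F c : hset H F -> constant_op G c -> hset H (F \o c).
Proof. by move=> hF hc; case: (H_inv hF hF hc). Qed.

Lemma obs_mod n F c : hset H F -> constant_op G c -> obs n (F \o c) = obs n F \o c.
Proof.
elim: n F c => [|n IH] F c hF hc //=.
rewrite C_mod// A_mod//.
have -> : obs n (A F \o adj U \o c \o U) = obs n (A F) \o ((adj U \o c) \o U).
  exact: (IH _ _ (AH hF) (constant_conj_shift hc)).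
apply/funext => f /=.
rewrite [LHS](_ : _ = C F (c f) + obs n (A F) (adj U (c (U (adj U f)))))//.
by rewrite UK.
Qed.

(** The conjugations by [U] produced by [A_mod] cancel against the factors [U^{n*}]. *)
Lemma O_mod F c : hset H F -> constant_op G c -> O (F \o c) = O F \o c.
Proof.
move=> hF hc; apply: O_unique; first exact: H_right.
move=> f; rewrite (_ : (fun n => _) = fun n => obs n F (c f)); last first.
  by apply/funext => n; rewrite obs_mod.
exact: O_cvg.
Qed.

(** * The transfer operator *)

Let BD0 : B 0 = 0 /\ D 0 = 0.
Proof.
by have [_ -> _ _ _] := bounded_linearE hC bB; have [_ -> _ _ _] := bounded_linearE hC bD.
Qed.

(** The effect of the transfer operator on a constant [d], which serves to define
    it: the direct output, then what the resulting state emits one level higher. *)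
Definition input d : op R T := D d + (O (B d) \o adj U).

Lemma input_in d : hset C2 d -> hset H2 (input d).
Proof.
move=> hd; apply: (hsetD h2); first exact/C2_H2/DC.
by case: (H2_shiftr (O_in (BH hd))).
Qed.

(** [O_rec] and the definition of [input] add up to one step of the state equations. *)
Lemma state_step F d : hset H F -> hset C2 d ->
  O F + input d = (C F + D d) + (O (A F + B d) \o adj U).
Proof.
move=> hF hd; rewrite (O_rec hF) /input (OD (AH hF) (BH hd)) addrACA.
by congr (_ + _).
Qed.

Lemma input_lin (a : R[i]) d k : hset C2 d -> hset C2 k ->
  input (a *: d + k) = a *: input d + input k.
Proof.
move=> hd hk; have [_ Bl _] := bB; have [_ Dl _] := bD.
rewrite /input Bl// Dl// (O_lin a (BH hd) (BH hk)).
by rewrite [in RHS]scalerDr addrACA.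
Qed.

Lemma input_sum (I : Type) (r : seq I) (a : I -> R[i]) (u : I -> op R T) :
  (forall i, hset C2 (u i)) ->
  input (\sum_(i <- r) a i *: u i) = \sum_(i <- r) a i *: input (u i).
Proof.
move=> hu; have hs (r' : seq I) : hset C2 (\sum_(i <- r') a i *: u i).
  by apply: (hset_sum hC) => i _; apply: (hsetZ hC).
elim: r => [|i r IH].
  rewrite !big_nil /input; have [-> ->] := BD0; rewrite add0r.
  have -> : O 0 = 0 by have [_ -> _ _ _] := bounded_linearE hH O_bounded.
  by [].
by rewrite !big_cons input_lin// IH.
Qed.

Lemma input_mod d c : hset C2 d -> constant_op G c -> input (d \o c) = input d \o c.
Proof.
move=> hd hc; rewrite /input D_mod// B_mod//.
have -> : O (B d \o adj U \o c \o U) = O (B d) \o ((adj U \o c) \o U).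
  exact: (O_mod (BH hd) (constant_conj_shift hc)).
apply/funext => f.
rewrite [LHS](_ : _ = D d (c f) + O (B d) (adj U (c (U (adj U f)))))//.
by rewrite UK.
Qed.

Lemma rank1_C2 s t : lev s = lev t -> hset C2 (rank1 (chi s) t).
Proof.
move=> st; apply: (H2_rank1 _).1 => u; rewrite -st chiE.
by case: (eqVneq u s) => // ->; rewrite eqxx.
Qed.

Definition column t : ell2 R T := input (rank1 (chi t) t) (chi t).

(** As [input] commutes with right multiplication by constants, the column of [t] can
    be read at any node of its horocycle. *)
Lemma column_shift s t : lev t = lev s -> input (rank1 (chi t) s) (chi s) = column t.
Proof.
move=> ts.
have -> : rank1 (chi t) s = rank1 (chi t) t \o rank1 (chi t) s.
  apply/funext => f; rewrite [RHS](_ : _ = (f s *: chi t) t *: chi t)//.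
  by rewrite ell2Z chiE eqxx mulr1.
rewrite input_mod; [|exact: rank1_C2|exact: Cconst (rank1_C2 ts)].
by rewrite /= rank1_chi eqxx.
Qed.

Lemma column_low s t : lev t < lev s -> column s t = 0.
Proof.
move=> ts; apply: (low_entry (G := G) (k := 0)); last by rewrite addr0.
by apply: H2low; apply: input_in; exact: rank1_C2.
Qed.

(** The coefficients [a] are fed level by level into the colligation started in the
    state [F]: at each step the output of that level is split off orthogonally,
    and the energy balance is that of a contraction. *)
Lemma simulation n : forall F s (A0 : {fset T}) (a : T -> R[i]), hset H F ->
  (forall t, t \in A0 -> lev s <= lev t < lev s + n%:Z) ->
  N (O F (chi s) + \sum_(t <- A0) a t *: column t) ^+ 2 <=
  NH F ^+ 2 + \sum_(t <- A0) normc (a t) ^+ 2.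
Proof.
elim: n => [|n IH] F s A0 a hF hA.
  have -> : A0 = fset0.
    by apply/eqP; rewrite -fsubset0; apply/fsubsetP => t /hA; rewrite addr0; lia.
  rewrite !big_seq_fset0 !addr0; apply: sqr_le; first exact: ell2_norm_ge0.
  exact: le_trans (hs_chi_le G s (H2hs (O_in hF))) (O_norm hF).
pose A1 := [fset t in A0 | lev t == lev s]%fset.
pose A2 := [fset t in A0 | lev t != lev s]%fset.
have A1E t : (t \in A1) = (t \in A0) && (lev t == lev s) by rewrite !inE.
have A2E t : (t \in A2) = (t \in A0) && (lev t != lev s) by rewrite !inE.
have split_sum (W : nmodType) (h : T -> W) :
    \sum_(t <- A0) h t = \sum_(t <- A1) h t + \sum_(t <- A2) h t.
  exact: (big_fsetID _ (fun t => lev t == lev s)).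
pose f := \sum_(t <- A1) a t *: chi t.
pose x := rank1 f s.
have f_level t : lev t != lev s -> f t = 0.
  move=> ts; rewrite /f ell2_sum big_seq big1// => u; rewrite A1E => /andP[_ /eqP us].
  by rewrite ell2Z chiE; case: eqP => [tu|]; rewrite ?mulr0//; rewrite tu us eqxx in ts.
have [hx nx] := H2_rank1 f_level.
have nf : N f ^+ 2 = \sum_(t <- A1) normc (a t) ^+ 2.
  rewrite norm_disjoint_sum ?fset_uniq//.
    by apply: eq_bigr => t _; rewrite ell2_normZ norm_chi mulr1.
  move=> t u v tu; rewrite !ell2Z !chiE.
  by case: (eqVneq v t) => [->|_]; [right; rewrite (negPf tu) mulr0|left; rewrite mulr0].
have input_x : input x (chi s) = \sum_(t <- A1) a t *: column t.
  have -> : x = \sum_(t <- A1) a t *: rank1 (chi (if lev t == lev s then t else s)) s.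
    apply/funext => g; rewrite sum_opE /x /rank1 /f scaler_sumr; apply: eq_big_seq => t.
    rewrite A1E => /andP[_ ->].
    by rewrite [RHS](_ : _ = a t *: (g s *: chi t))// !scalerA mulrC.
  rewrite input_sum; last by move=> t; apply: rank1_C2; case: eqP.
  rewrite sum_opE; apply: eq_big_seq => t; rewrite A1E => /andP[_ ts]; rewrite ts.
  rewrite [LHS](_ : _ = a t *: input (rank1 (chi t) s) (chi s))//.
  by rewrite column_shift//; exact/eqP.
have hF' : hset H (A F + B x) by apply: (hsetD hH); [exact: AH|exact: BH].
have hd' : hset C2 (C F + D x) by apply: (hsetD hC); [exact: CC|exact: DC].
pose rest := O (A F + B x) (chi (tree_shift G j s)) + \sum_(t <- A2) a t *: column t.
have -> : O F (chi s) + \sum_(t <- A0) a t *: column t = (C F + D x) (chi s) + rest.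
  rewrite split_sum -input_x /rest [LHS]addrA [RHS]addrA; congr (_ + _).
  rewrite -(adj_shift_chi R G j s).
  exact: (congr1 (fun X : op R T => X (chi s)) (state_step hF hx)).
rewrite (hnorm_pythagoras hL)//; last first.
  apply: dot_disjoint => t; case: (eqVneq (lev t) (lev s)) => ts; last first.
    by left; exact: constant_entry (Cconst hd') ts.
  right; rewrite ell2D (low_entry (H2low (O_in hF'))) ?add0r; last first.
    by rewrite level_shift ts addr0; lia.
  rewrite ell2_sum big_seq big1// => u; rewrite A2E => /andP[/hA uA us].
  by rewrite ell2Z column_low ?mulr0// ts; lia.
have hrest : N rest ^+ 2 <= NH (A F + B x) ^+ 2 + \sum_(t <- A2) normc (a t) ^+ 2.
  apply: IH => // t; rewrite A2E level_shift => /andP[/hA tA ts]; lia.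
have e1 := sqr_le (ell2_norm_ge0 _) (hs_chi_le G s (H2hs (C2_H2 hd'))).
have e2 := colligation_contraction hF hx.
have e3 := sqr_le (hnorm_ge0 _ _) nx.
rewrite (split_sum R^o) -nf.
apply: (le_trans (lerD e1 hrest)).
rewrite addrA [_ + NH _ ^+ 2]addrC addrA lerD2r.
exact: le_trans e2 (lerD (lexx _) e3).
Qed.

Lemma columns_contractive (A0 : {fset T}) (a : T -> R[i]) :
  N (\sum_(t <- A0) a t *: column t) ^+ 2 <= \sum_(t <- A0) normc (a t) ^+ 2.
Proof.
have [->|[t0 t0A]] := fset_0Vmem A0.
  by rewrite !big_seq_fset0 ell2_norm0 expr0n.
pose n := (\max_(t <- A0) absz (lev t0 - lev t))%N.
have hn t : t \in A0 -> (absz (lev t0 - lev t) <= n)%N.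
  by move=> tA; exact: (leq_bigmax_seq t).
(* Start in the zero state, from an ancestor whose level is below all those involved. *)
pose s := iter n (parent G) t0.
have ls : lev s = lev t0 - n%:Z by rewrite level_iter_parent.
have := @simulation (n + n).+1 0 s A0 a (hset0 hH).
have -> : O 0 = 0 by have [_ -> _ _ _] := bounded_linearE hH O_bounded.
have z : (0 : op R T) (chi s) = 0 by [].
rewrite (hnorm0 hH) expr0n z !add0r; apply.
by move=> t /hn; rewrite ls; lia.
Qed.

(** Finite combinations of the columns being bounded by their coefficients, the
    inner products with the columns define a contraction, by duality; the transfer
    operator is its adjoint. *)
Lemma ex_transfer : exists S : op R T,
  [/\ bounded_op S, forall f, N (S f) <= N f & forall t, S (chi t) = column t].
Proof.
pose r g : ell2 R T := mkell2 (fun t => dot g (column t)).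
have hr g (A0 : {fset T}) : \sum_(t <- A0) normc (dot g (column t)) ^+ 2 <= N g ^+ 2.
  pose a t := dot g (column t).
  set x := \sum_(t <- A0) _.
  have x0 : 0 <= x by apply: sumr_ge0 => t _; exact: sqr_normc_ge0.
  have xE : x%:C = dot (\sum_(t <- A0) a t *: column t) g.
    rewrite (hdot_suml hL)// (rmorph_sum (real_complex R)); apply: eq_bigr => t _.
    by rewrite (hdotZl hL)// [dot (column t) g]ell2_dotC mulcJ.
  have h1 := cauchy_schwarz hL (x := \sum_(t <- A0) a t *: column t) (y := g) Logic.I Logic.I.
  rewrite -xE normc_real ger0_norm// in h1.
  have h3 := columns_contractive A0 a; rewrite -/x in h3.
  have := ell2_norm_ge0 g; have := ell2_norm_ge0 (\sum_(t <- A0) a t *: column t).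
  move: x x0 (N g) (N (\sum_(t <- A0) _)) h1 h3 {xE} => x x0 u v h1 h3 v0 u0.
  have h4 : x ^+ 2 <= x * u ^+ 2.
    apply: (le_trans (sqr_le x0 h1)); rewrite exprMn ler_wpM2r// ?exprn_ge0//.
  have [xz|xp] := eqVneq x 0; first by rewrite xz exprn_ge0.
  by have {}xp : 0 < x; [rewrite lt_def xp|move: h4; rewrite expr2 ler_pM2l].
have rE g t : r g t = dot g (column t) by exact: (mkell2E (hr g)).
have rN g : N (r g) <= 1 * N g.
  rewrite mul1r; apply: le_of_sqr; first exact: ell2_norm_ge0.
  apply: ell2_norm_le => A0; apply: le_trans (hr g A0).
  by apply: ler_sum => t _; rewrite rE.
have br : bounded_op r.
  apply: (bounded_opI _ rN) => a f g; apply: ell2_ext => t.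
  by rewrite ell2D ell2Z !rE (hdotL hL).
exists (adj r); split; first exact: bounded_adj.
  by move=> f; rewrite -[leRHS]mul1r; exact: norm_adj_le.
move=> t; apply: ell2_dot_ext => h; rewrite -adjE// -rE.
exact: dot_chi.
Qed.

Definition transfer : op R T := projT1 (cid ex_transfer).
Local Notation S := transfer.

Lemma transfer_bounded : bounded_op S. Proof. by case: (projT2 (cid ex_transfer)). Qed.
Lemma transfer_norm f : N (S f) <= N f. Proof. by case: (projT2 (cid ex_transfer)). Qed.
Lemma transfer_chi t : S (chi t) = column t. Proof. by case: (projT2 (cid ex_transfer)). Qed.

Lemma transfer_low : low G 0 S.
Proof.
apply: lowI; first exact: transfer_bounded.
by move=> s t; rewrite addr0 => st; rewrite transfer_chi column_low.
Qed.

Lemma transfer_schur : schur_multiplier G S.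
Proof.
split; first by apply/causalP; exact: transfer_low.
by apply: norm_op_ub => // f; rewrite mul1r; exact: transfer_norm.
Qed.

Lemma input_bound : exists M : R, forall d, hset C2 d -> N2 (input d) <= M * N2 d.
Proof.
have [_ _ [MB hMB]] := bB; have [_ _ [MD hMD]] := bD.
exists (MD + MB) => d hd.
have [hX _ nX] := H2_shiftr (O_in (BH hd)).
apply: (le_trans (hnormD h2 (C2_H2 (DC hd)) hX)); rewrite mulrDl; apply: lerD.
  exact: hMD hd.
exact: le_trans nX (le_trans (O_norm (BH hd)) (hMB _ hd)).
Qed.

Lemma input0 : input 0 = 0.
Proof.
have h0 := hset0 hC; have := input_lin 1 h0 h0.
by rewrite !scale1r addr0 => /eqP; rewrite -subr_eq subrr => /eqP.
Qed.

Lemma rank1_lin (a : R[i]) f g t : rank1 (a *: f + g) t = a *: rank1 f t + rank1 g t.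
Proof.
apply/funext => h; rewrite [RHS](_ : _ = a *: (h t *: f) + h t *: g)//.
by rewrite /rank1 scalerDr !scalerA mulrC.
Qed.

Lemma rank1_level l f s : l = lev s -> hset C2 (rank1 (level_restr G l f) s) /\
  N2 (rank1 (level_restr G l f) s) <= N f.
Proof.
move=> ls; have [|h1 hn] := @H2_rank1 (level_restr G l f) s.
  by move=> t ts; rewrite level_restrE ls (negPf ts).
by split; [exact: h1|exact: le_trans hn (restr_norm _ _)].
Qed.

(** Both sides commute with right multiplication by constants, which reduces the
    identity to rank one constants, where it is the choice of the columns. *)
Lemma transfer_input d : hset C2 d -> S \o d = input d.
Proof.
move=> hd; have bd : bounded_op d by exact: H2b (C2_H2 hd).
apply: op_ext; [exact: bounded_comp transfer_bounded bd|exact: H2b (input_in hd)|].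
move=> s t; congr (ell2_val _ t).
pose Y g := input (rank1 (level_restr G (lev s) g) s) (chi s).
have hr g := rank1_level g (erefl (lev s)).
have bY : bounded_op Y.
  have [M hM] := input_bound.
  apply: (@bounded_opI _ _ _ `|M|) => [a f g|f].
    have [h1 _] := hr f; have [h1' _] := hr g.
    rewrite /Y /level_restr restr_lin rank1_lin (input_lin a h1 h1').
    reflexivity.
  have [h1 h1n] := hr f.
  apply: (le_trans (hs_chi_le G s (H2hs (input_in h1)))); apply: (le_trans (hM _ h1)).
  apply: (@le_trans _ _ (`|M| * N2 (rank1 (level_restr G (lev s) f) s))).
    by apply: ler_wpM2r; [exact: hnorm_ge0|exact: ler_norm].
  by apply: ler_wpM2l.
have YE : Y = S \o level_restr G (lev s).
  apply: (op_ext bY (bounded_comp transfer_bounded (bounded_level_restr _ _ _))).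
  move=> u v; congr (ell2_val _ v); rewrite /Y /= level_restr_chi.
  case: eqP => us; first by rewrite transfer_chi column_shift.
  rewrite (op0 transfer_bounded) (_ : rank1 0 s = 0) ?input0//.
  by apply/funext => h; rewrite /rank1 scaler0.
have -> : input d (chi s) = Y (d (chi s)).
  have hs1 := Cconst (rank1_C2 (erefl (lev s))).
  have := input_mod hd hs1.
  have -> : d \o rank1 (chi s) s = rank1 (d (chi s)) s.
    by apply/funext => g; rewrite /rank1 /= opZ.
  move=> e; rewrite /Y; have -> : level_restr G (lev s) (d (chi s)) = d (chi s).
    apply: ell2_ext => u; rewrite level_restrE; case: eqVneq => // us.
    by rewrite (constant_entry (Cconst hd)).
  by rewrite e /= rank1_chi eqxx.
rewrite YE /=; have -> // : level_restr G (lev s) (d (chi s)) = d (chi s).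
apply: ell2_ext => u; rewrite level_restrE; case: eqVneq => // us.
by rewrite (constant_entry (Cconst hd)).
Qed.

(** Of the terms [C (A^i F) U^{i*}] of [O F], only that of index [n] contributes in
    degree 0 between operators of degrees [- n - k] and [k]. *)
Lemma diag_observability n : forall (k : int) Z Q F, hset H F ->
  low G (- (n%:Z + k)) Z -> upp G (- (n%:Z + k)) Z -> low G k Q -> upp G k Q ->
  diag G (Z \o (O F \o Q)) = Z \o (C (iter n A F) \o (iter n (adj U) \o Q)).
Proof.
elim: n => [|n IH] k Z Q F hF lZ uZ lQ uQ.
  have bZ := low_bounded lZ; have bQ := low_bounded lQ.
  have hCF := Cconst (CC hF); have [lC uC] := (constantP _ _).1 hCF.
  have lO := H2low (O_in (AH hF)).
  have -> : Z \o (O F \o Q) = (Z \o (C F \o Q)) + (Z \o (O (A F) \o (adj U \o Q))).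
    apply/funext => f; rewrite (O_rec hF).
    exact: (opD (C F (Q f)) (O (A F) (adj U (Q f))) bZ).
  have hl : low G 1 (Z \o (O (A F) \o (adj U \o Q))).
    apply: low_weaken (low_comp lZ (low_comp lO (low_comp lowUs lQ))); lia.
  rewrite diag_add; last exact: low_bounded hl.
    rewrite (diag_eq0 hl) addr0; apply: diag_id; apply/constantP; split.
      by apply: low_weaken (low_comp lZ (low_comp lC lQ)); lia.
    by apply: upp_weaken (upp_comp uZ (upp_comp uC uQ)); lia.
  exact: bounded_comp bZ (bounded_comp (low_bounded lC) bQ).
have bZ := low_bounded lZ; have bQ := low_bounded lQ.
have hCF := Cconst (CC hF); have [lC uC] := (constantP _ _).1 hCF.
have lO := H2low (O_in (AH hF)).
have -> : Z \o (O F \o Q) = (Z \o (C F \o Q)) + (Z \o (O (A F) \o (adj U \o Q))).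
  apply/funext => f; rewrite (O_rec hF).
  exact: (opD (C F (Q f)) (O (A F) (adj U (Q f))) bZ).
have hu := upp_comp uZ (upp_comp uC uQ).
rewrite diag_add; first last.
- exact: bounded_comp bZ (bounded_comp (low_bounded lO) (bounded_comp bUs bQ)).
- exact: upp_bounded hu.
rewrite (diag_eq0_upp _ hu) ?add0r; last by lia.
have e : - (n.+1%:Z + k) = - (n%:Z + (1 + k)) by lia.
rewrite e in lZ uZ.
rewrite (IH (1 + k) Z (adj U \o Q) (A F) (AH hF) lZ uZ (low_comp lowUs lQ) (upp_comp uppUs uQ)).
by apply/funext => f; rewrite /= -!iterS !iterSr.
Qed.

Lemma transfer_coef w : realization_coef G j A B C D w (coef G S w).
Proof.
have bS := transfer_bounded; have bW := word_op_bounded R G w.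
have bWS := bounded_comp bW bS.
rewrite (coefE G w bS); split; first exact: diag_constant.
move=> d hd; have hdc := Cconst hd; rewrite -(diag_constr bWS hdc).
have hOB := O_in (BH hd); have hDd := Cconst (DC hd).
have bDd := constant_bounded hDd; have bO := H2b hOB.
have -> : (word_op G w \o S) \o d = (word_op G w \o D d) + (word_op G w \o (O (B d) \o adj U)).
  rewrite -[LHS]/(word_op G w \o (S \o d)) (transfer_input hd).
  apply/funext => f; exact: (opD (D d f) (O (B d) (adj U f)) bW).
have b1 := bounded_comp bW bDd; have b2 := bounded_comp bW (bounded_comp bO bUs).
rewrite (diag_add G b1 b2).
case: w bW bWS b1 b2 => [|i w] bW bWS b1 b2.
  have W0 X : word_op G [::] \o X = X.
    by apply/funext => f; apply: ell2_ext => t; rewrite /= word_opE.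
  rewrite !W0 (diag_id hDd) diag_eq0 ?addr0//.
  by rewrite -[1]add0r; exact: low_comp (H2low hOB) lowUs.
have [lD uD] := (constantP _ _).1 hDd.
rewrite (diag_eq0_upp _ (upp_comp (upp_word R G (i :: w)) uD)) ?add0r; last by rewrite /=; lia.
have lW := low_word R G (i :: w); have uW := upp_word R G (i :: w).
have e : - (size (i :: w))%:Z = - ((size w)%:Z + 1) by rewrite /=; lia.
rewrite e in lW uW.
rewrite (diag_observability (BH hd) lW uW lowUs uppUs) adj_iter//.
by apply/funext => f; rewrite /= -iterS iterSr.
Qed.

Lemma realization_coef_unique w X X' : realization_coef G j A B C D w X ->
  realization_coef G j A B C D w X' -> X = X'.
Proof.
move=> [kX hX] [kX' hX'].
apply: (op_ext (constant_bounded kX) (constant_bounded kX')) => s t.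
have h := rank1_C2 (erefl (lev s)).
have := congr1 (fun Y : op R T => Y (chi s)) (etrans (hX _ h) (esym (hX' _ h))).
by rewrite /= rank1_chi eqxx => ->.
Qed.

(** * The Gram identity *)

Let Os := adjoint H H2 O.
Let Ms := adjoint H2 H2 (left_mul S).

Let Os_adj : is_adjoint H H2 O Os. Proof. exact: (adjointP hH h2 O_bounded). Qed.
Let OsH X : hset H2 X -> hset H (Os X). Proof. by case: Os_adj => -[h _ _] _; exact: h. Qed.
Let OsE F X : hset H F -> hset H2 X -> hdot H2 (O F) X = hdot H F (Os X).
Proof. by case: Os_adj => _; exact. Qed.

Lemma H2_lmul Z (K : R) X : low G 0 Z -> 0 <= K -> (forall f, N (Z f) <= K * N f) ->
  hset H2 X -> hset H2 (Z \o X) /\ N2 (Z \o X) <= K * N2 X.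
Proof.
move=> lZ K0 hZ hX; have [h1 hn] := hs_lmul G (low_bounded lZ) K0 hZ (H2hs hX).
split; last exact: hn.
by apply/H2P; split; [exact: low_weaken (low_comp lZ (H2low hX))|exact: h1].
Qed.

Let SM X : hset H2 X -> hset H2 (S \o X) /\ N2 (S \o X) <= N2 X.
Proof.
move=> hX; have [||h1 hn] := @H2_lmul S 1 X transfer_low _ _ hX; first exact: ler01.
  by move=> f; rewrite mul1r; exact: transfer_norm.
by split; [exact: h1|move: hn; rewrite mul1r].
Qed.

Lemma left_mul_bounded : bounded_linear H2 H2 (left_mul S).
Proof.
split; first by move=> X /SM[].
  move=> a X Y _ _; apply/funext => f.
  exact: (op_linear a (X f) (Y f) transfer_bounded).
by exists 1 => X hX; rewrite mul1r; case: (SM hX).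
Qed.

Let Ms_adj : is_adjoint H2 H2 (left_mul S) Ms.
Proof. exact: (adjointP h2 h2 left_mul_bounded). Qed.
Let MsH X : hset H2 X -> hset H2 (Ms X). Proof. by case: Ms_adj => -[h _ _] _; exact: h. Qed.
Let MsE Y X : hset H2 Y -> hset H2 X -> hdot H2 (S \o Y) X = hdot H2 Y (Ms X).
Proof. by case: Ms_adj => _; exact. Qed.

(** The backward shift on [H2], adjoint to [Y |-> Y U^*]. *)
Definition tail X : op R T := (X - diag G X) \o U.

Lemma diag_C2 X : hset H2 X -> hset C2 (diag G X).
Proof.
move=> hX; apply/C2P; split; first exact: diag_constant (H2b hX).
exact: (hs_diag G (H2hs hX)).1.
Qed.

Lemma strict_part X : hset H2 X -> low G 1 (X - diag G X).
Proof.
move=> hX; have bX := H2b hX; apply: lowI; first exact: bounded_sub bX (diag_bounded G bX).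
move=> s t st; rewrite [LHS](_ : _ = X (chi s) t - diag G X (chi s) t)//.
rewrite diag_entry//; case: eqVneq => [_|ne]; first by rewrite subrr.
by rewrite subr0; apply: (low_entry (H2low hX)); move: ne; rewrite neq_lt; lia.
Qed.

Lemma tail_in X : hset H2 X -> hset H2 (tail X).
Proof.
move=> hX; apply/H2P; split; first exact: low_weaken (low_comp (strict_part hX) lowU).
exact: (hs_shiftl G j (hs_sub G (H2hs hX) (H2hs (C2_H2 (diag_C2 hX))))).1.
Qed.

Lemma tailK X : hset H2 X -> X = diag G X + (tail X \o adj U).
Proof.
move=> hX; apply/funext => f.
rewrite [RHS](_ : _ = diag G X f + (X (U (adj U f)) - diag G X (U (adj U f))))//.
by rewrite UK addrC subrK.
Qed.

Lemma dot_diagr d X : hset C2 d -> hset H2 X -> hdot H2 d X = hdot H2 d (diag G X).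
Proof.
move=> hd hX; have hd2 := C2_H2 hd; have hX2 := C2_H2 (diag_C2 hX).
by rewrite (hdotC h2 hX hd2) (hs_dot_diag (H2b hX) (Cconst hd)) -(hdotC h2 hX2 hd2).
Qed.

Lemma dot_tail Y X : hset H2 Y -> hset H2 X ->
  hdot H2 (Y \o adj U) X = hdot H2 Y (tail X).
Proof.
move=> hY hX; have [h1 l1 _] := H2_shiftr hY; have hd := diag_C2 hX.
have e : hdot H2 (Y \o adj U) (diag G X) = 0.
  rewrite (hs_dot_diag (H2b h1) (Cconst hd)) (diag_eq0 l1).
  exact: (hdot0l h2 (C2_H2 hd)).
rewrite -[LHS]subr0 -e -(hdotBr h2 hX (C2_H2 hd) h1).
exact: (hs_dot_shift G j (H2hs hY) (hs_sub G (H2hs hX) (H2hs (C2_H2 hd)))).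
Qed.

(** Left multiplication by [S] commutes with right multiplication by [U^*], hence so
    do their adjoints. *)
Lemma Ms_tail X : hset H2 X -> Ms (tail X) = tail (Ms X).
Proof.
move=> hX; apply/eqP; rewrite -subr_eq0; apply/eqP.
have h1 := MsH (tail_in hX); have h1' := tail_in (MsH hX).
have hd := hsetB h2 h1 h1'.
apply: (hdot_eq0_all h2 hd) => Y hY.
rewrite (hdotC h2 hY hd) (hdotBr h2 h1 h1' hY) -(MsE hY (tail_in hX)).
have [h3 _ _] := H2_shiftr hY.
rewrite -(dot_tail hY (MsH hX)) -(MsE h3 hX) -(dot_tail (SM hY).1 hX).
by rewrite -[S \o (Y \o adj U)]/((S \o Y) \o adj U) subrr rmorph0.
Qed.

(** The adjoint of [F, d |-> O F + S d] computed in two ways, through the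
    definition and through [state_step]. *)
Lemma adjoint_state X : hset H2 X ->
  adjoint HC HC V (Os (tail X), diag G X) = (Os X, diag G (Ms X)).
Proof.
move=> hX; have [[VsHC _ _] adjV] := Vs_adj.
have hp : hset HC (Os (tail X), diag G X).
  by split; [exact: OsH (tail_in hX)|exact: diag_C2].
have hp' : hset HC (Os X, diag G (Ms X)).
  by split; [exact: OsH|exact: diag_C2 (MsH hX)].
have hq := VsHC _ hp.
have hd := hsetB hHC hq hp'.
apply/eqP; rewrite -subr_eq0; apply/eqP; apply: (hdot_eq0_all hHC hd) => -[F d] hFd.
have [hF hd'] := hFd; rewrite /= in hF hd'.
rewrite (hdotC hHC hFd hd) (hdotBr hHC hq hp' hFd) -(adjV _ _ hFd hp).
have hF' : hset H (A F + B d) by apply: (hsetD hH); [exact: AH|exact: BH].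
have hk' : hset C2 (C F + D d) by apply: (hsetD hC); [exact: CC|exact: DC].
have -> : hdot HC (V (F, d)) (Os (tail X), diag G X) =
  hdot H (A F + B d) (Os (tail X)) + hdot H2 (C F + D d) (diag G X) by [].
have -> : hdot HC (F, d) (Os X, diag G (Ms X)) =
  hdot H F (Os X) + hdot H2 d (diag G (Ms X)) by [].
rewrite -(OsE hF' (tail_in hX)) -(dot_diagr hk' hX) -(OsE hF hX).
rewrite -(dot_diagr hd' (MsH hX)) -(MsE (C2_H2 hd') hX) (transfer_input hd').
rewrite -(dot_tail (O_in hF') hX).
have [h3 _ _] := H2_shiftr (O_in hF').
rewrite [hdot _ (O (A F + B d) \o adj U) X + _]addrC.
rewrite -(hdotDl h2 (C2_H2 hk') h3 hX) -(hdotDl h2 (O_in hF) (input_in hd') hX).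
by rewrite (state_step hF hd') subrr rmorph0.
Qed.

(** Apply [V] to [adjoint_state]: the hypothesis on [V V^*] computes the left side,
    and the projection [U^* U] is absorbed by the factor [U^*]. *)
Lemma observability_rec X : hset H2 X ->
  O (Os X) + (S \o diag G (Ms X)) = diag G X + (O (Os (tail X)) \o adj U).
Proof.
move=> hX; have h1 := OsH hX; have hk := diag_C2 (MsH hX).
have := VV (OsH (tail_in hX)) (diag_C2 hX); rewrite (adjoint_state hX).
rewrite /block /= => -[e1 e2'].
rewrite (transfer_input hk) (state_step h1 hk) e1 e2'.
rewrite (O_mod (OsH (tail_in hX)) (constant_shift R G j)).
congr (_ + _); apply/funext => f /=.
by rewrite UK.
Qed.

Let Delta X := O (Os X) - (X - (S \o Ms X)).

Lemma Delta_in X : hset H2 X -> hset H2 (Delta X).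
Proof.
move=> hX; apply: (hsetB h2); first exact: O_in (OsH hX).
by apply: (hsetB h2); [exact: hX|case: (SM (MsH hX))].
Qed.

Lemma Delta_rec X : hset H2 X -> Delta X = Delta (tail X) \o adj U.
Proof.
move=> hX; have hM := MsH hX.
have e1 := observability_rec hX.
have e2' : S \o Ms X = (S \o diag G (Ms X)) + ((S \o Ms (tail X)) \o adj U).
  rewrite (Ms_tail hX) {1}(tailK hM); apply/funext => f.
  exact: (opD (diag G (Ms X) f) (tail (Ms X) (adj U f)) transfer_bounded).
have e3 := tailK hX.
have E : Delta (tail X) \o adj U = (O (Os (tail X)) \o adj U) -
   ((tail X \o adj U) - ((S \o Ms (tail X)) \o adj U)) by [].
have eP : O (Os X) = diag G X + (O (Os (tail X)) \o adj U) - (S \o diag G (Ms X)).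
  by rewrite -e1 addrK.
by rewrite E /Delta e2' {2}e3 eP; exact: cancel_sum.
Qed.

(** By [Delta_rec], the difference [Delta X] of the two sides raises levels by any
    amount, hence vanishes. *)
Lemma observability_gram X : hset H2 X -> O (Os X) = X - (S \o Ms X).
Proof.
move=> hX; apply/eqP; rewrite -subr_eq0; apply/eqP.
have hl n : forall Y, hset H2 Y -> low G n%:Z (Delta Y).
  elim: n => [|n IH] Y hY; first exact: H2low (Delta_in hY).
  rewrite (Delta_rec hY); apply: low_weaken (low_comp (IH _ (tail_in hY)) lowUs); lia.
by apply: (low_all_eq0 (G := G)) => n; exact: hl.
Qed.

(** * The reproducing kernel *)

Section PointEvaluation.
Variables (c : 'I_q -> op R T) (L : op R T) (M r : R).
Hypothesis hres : resolvent G c L M r.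
Let bL := res_bounded hres.

Lemma L_H2 X : hset H2 X -> hs (L \o X) /\ N2 (L \o X) <= norm_op L * N2 X.
Proof.
move=> hX.
exact: (hs_lmul G bL (norm_op_ge0 bL) (fun f => norm_op_le f bL) (H2hs hX)).
Qed.

Lemma eval_diag X : hset H2 X -> point_eval G X c = diag G (L \o X).
Proof. by move=> hX; exact: (point_evalE hres (H2b hX)). Qed.

Lemma eval_C2 X : hset H2 X -> hset C2 (point_eval G X c) /\
  N2 (point_eval G X c) <= norm_op L * N2 X.
Proof.
move=> hX; rewrite (eval_diag hX); have [h1 hn] := L_H2 hX.
have [h3 h4] := hs_diag G h1; split; last exact: le_trans h4 hn.
by apply/C2P; split; [exact: diag_constant (hs_bounded h1)|exact: h3].
Qed.

Lemma eval_termE n F : hset H F ->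
  eval_term G j A C c F n = diag G (iter n (row_alpha G c) \o O F).
Proof.
move=> hF; have e : - 1 *+ n = - (n%:Z + 0) :> int by rewrite mulNrn; lia.
have lZ := low_iter n (res_row_low hres); have uZ := upp_iter n (res_row_upp hres).
rewrite e in lZ uZ.
have := diag_observability hF lZ uZ (low_id R G) (upp_id R G).
by rewrite /eval_term adj_iter//.
Qed.

Lemma eval_term_C2 n F : hset H F -> hset C2 (eval_term G j A C c F n) /\
  N2 (eval_term G j A C c F n) <= M * N2 (O F) * r ^+ n.
Proof.
move=> hF; rewrite (eval_termE n hF).
have bT := bounded_iter n (res_row_bounded hres).
have K0 : 0 <= M * r ^+ n.
  by rewrite mulr_ge0 ?(res_pos hres)// exprn_ge0//; case: hres => _ [].
have hM f : N (iter n (row_alpha G c) f) <= M * r ^+ n * N f by case: hres.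
have [h1 hn] := hs_lmul G bT K0 hM (H2hs (O_in hF)).
have [h3 h4] := hs_diag G h1; split.
  by apply/C2P; split; [exact: diag_constant (hs_bounded h1)|exact: h3].
by rewrite mulrAC; exact: le_trans h4 hn.
Qed.

Lemma eval_series F : hset H F ->
  abs_series_in C2 (eval_term G j A C c F) (point_eval G (O F) c).
Proof.
move=> hF; have hO := O_in hF.
have [r0 r1] : 0 <= r /\ r < 1 by case: hres.
split.
- by move=> n; case: (eval_term_C2 n hF).
- apply: (geometric_nneseries (K := M * N2 (O F)) r0 r1) => n; first exact: hnorm_ge0.
  by case: (eval_term_C2 n hF).
- by case: (eval_C2 hO).
apply/cvg_inP => e e0.
have [K hK] := geometric_small (M * (norm_op L + 1) * N2 (O F)) r0 r1 e0.
exists K => n Kn; apply: le_lt_trans (hK n Kn).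
have bO := H2b hO; have bT := bounded_iter n (res_row_bounded hres).
have -> : \sum_(i < n) eval_term G j A C c F i =
    \sum_(i < n) diag G (iter i (row_alpha G c) \o O F).
  by apply: eq_bigr => i _; exact: eval_termE.
have hS : hset C2 (\sum_(i < n) diag G (iter i (row_alpha G c) \o O F)).
  apply: (hset_sum hC) => i _; rewrite -(eval_termE i hF).
  by case: (eval_term_C2 i hF).
rewrite (hnormBC hC hS (eval_C2 hO).1) (eval_diag hO) (diag_partial hres n bO).
have C0 : 0 <= M * (norm_op L + 1) * r ^+ n.
  by apply: mulr_ge0; [exact: (res_M0 hres)|exact: exprn_ge0].
have [h1 hn] := hs_lmul G (bounded_comp bT bL) C0 (iter_row_res_le hres n) (H2hs hO).
by rewrite mulrAC; exact: le_trans (hs_diag G h1).2 hn.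
Qed.

Lemma eval_bounded : bounded_linear H C2 (fun F => point_eval G (O F) c).
Proof.
split.
- by move=> F hF; case: (eval_C2 (O_in hF)).
- move=> a F X hF hX; have hOF := O_in hF; have hOX := O_in hX.
  rewrite (O_lin a hF hX) (eval_diag (hsetL h2 a hOF hOX)) (eval_diag hOF) (eval_diag hOX).
  have -> : L \o (a *: O F + O X) = a *: (L \o O F) + (L \o O X).
    by apply/funext => f; exact: (op_linear a (O F f) (O X f) bL).
  have b1 := (hs_bounded (L_H2 hOF).1); have b2 := (hs_bounded (L_H2 hOX).1).
  by rewrite (diag_add G (bounded_scale a b1) b2) (diag_scale G a b1).
exists (norm_op L) => F hF; apply: (le_trans (eval_C2 (O_in hF)).2).
by apply: ler_wpM2l; [exact: norm_op_ge0|exact: O_norm].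
Qed.

Local Notation K := (ker_ball G c).

Lemma ker_ball_low : low G 0 K.
Proof. by rewrite (ker_ballE hres) -[0]oppr0; exact: upp_adj (res_upp hres). Qed.

Lemma ker_ball_H2 k : hset C2 k -> hset H2 (K \o k) /\ N2 (K \o k) <= norm_op K * N2 k.
Proof.
move=> hk; have bK := low_bounded ker_ball_low.
exact: (H2_lmul ker_ball_low (norm_op_ge0 bK) (fun f => norm_op_le f bK) (C2_H2 hk)).
Qed.

(** As [K] is the adjoint of [L], evaluation at [c] is represented by [K k]; the
    truncation to the diagonal is not felt by the constant [k]. *)
Lemma eval_reproducing X k : hset H2 X -> hset C2 k ->
  hdot H2 (point_eval G X c) k = hdot H2 X (K \o k).
Proof.
move=> hX hk; rewrite (eval_diag hX) (ker_ballE hres).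
rewrite -(hs_dot_diag (hs_bounded (L_H2 hX).1) (Cconst hk)).
exact: (hs_dot_adj G X bL (H2hs (C2_H2 hk))).
Qed.

Lemma eval_adjoint k : hset C2 k ->
  adjoint H C2 (fun F => point_eval G (O F) c) k = Os (K \o k).
Proof.
move=> hk; have [[_ Osl [MO hMO]] _] := Os_adj.
apply: (adjoint_eq hH (B := fun k => Os (K \o k)) _ hk).
split; last first.
  move=> F k' hF hk'; rewrite -(OsE hF (ker_ball_H2 hk').1).
  exact: (eval_reproducing (O_in hF) hk').
have bK := low_bounded ker_ball_low.
split.
- by move=> k' hk'; exact: OsH (ker_ball_H2 hk').1.
- move=> a k1 k2 hk1 hk2.
  have -> : K \o (a *: k1 + k2) = a *: (K \o k1) + (K \o k2).
    by apply/funext => f; exact: (op_linear a (k1 f) (k2 f) bK).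
  exact: Osl (ker_ball_H2 hk1).1 (ker_ball_H2 hk2).1.
exists (`|MO| * norm_op K) => k' hk'; have [h1 hn] := ker_ball_H2 hk'.
apply: (le_trans (hMO _ h1)); apply: (@le_trans _ _ (`|MO| * N2 (K \o k'))).
  by apply: ler_wpM2r; [exact: hnorm_ge0|exact: ler_norm].
by rewrite -mulrA; apply: ler_wpM2l; [exact: normr_ge0|exact: hn].
Qed.

(** The adjoint of multiplication by [S] maps [K k] to [S^(c)^* K k], since [S] and
    its value at [c] have the same evaluation at [c] after multiplication on the
    right by a causal operator. *)
Lemma Ms_ker_ball k : hset C2 k -> Ms (K \o k) = adj (point_eval G S c) \o (K \o k).
Proof.
move=> hk; have [hKk _] := ker_ball_H2 hk; have bS := transfer_bounded.
have eS := point_evalE hres bS.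
pose Z := point_eval G S c; rewrite -/Z in eS *.
have kZ : constant_op G Z by rewrite eS; exact: diag_constant (bounded_comp bL bS).
have bZ := constant_bounded kZ; have kZ' := constant_adj kZ; have bZ' := constant_bounded kZ'.
have lZ : low G 0 Z by case/constantP: kZ.
have lZ' : low G 0 (adj Z) by case/constantP: kZ'.
have [h3 _] := H2_lmul lZ' (norm_op_ge0 bZ') (fun f => norm_op_le f bZ') hKk.
have h1 := MsH hKk.
have hd := hsetB h2 h1 h3.
apply/eqP; rewrite -subr_eq0; apply/eqP; apply: (hdot_eq0_all h2 hd) => X hX.
rewrite (hdotC h2 hX hd) (hdotBr h2 h1 h3 hX) -(MsE hX hKk).
rewrite -(hs_dot_adj G X bZ (H2hs hKk)).
have [hZX _] := H2_lmul lZ (norm_op_ge0 bZ) (fun f => norm_op_le f bZ) hX.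
have hSX := (SM hX).1.
rewrite -(eval_reproducing hSX hk) -(eval_reproducing hZX hk).
suff -> : point_eval G (S \o X) c = point_eval G (Z \o X) c by rewrite subrr rmorph0.
rewrite (eval_diag hSX) (eval_diag hZX).
apply/eqP; rewrite -subr_eq0; apply/eqP.
rewrite -(diag_sub G (hs_bounded (L_H2 hSX).1) (hs_bounded (L_H2 hZX).1)).
have -> : (L \o (S \o X)) - (L \o (Z \o X)) = (L \o (S - Z)) \o X.
  by apply/funext => f; exact: (esym (opB (S (X f)) (Z (X f)) bL)).
apply: diag_eq0; rewrite -[1]addr0; apply: low_comp (H2low hX).
by rewrite eS; exact: (res_strict hres transfer_low).
Qed.

Lemma ker_schurE k : hset C2 k -> ker_schur G S c \o k = O (Os (K \o k)).
Proof.
move=> hk; have [hKk _] := ker_ball_H2 hk.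
by rewrite (observability_gram hKk) (Ms_ker_ball hk).
Qed.

Lemma ker_schur_bounded : bounded_op (ker_schur G S c).
Proof.
have bS := transfer_bounded; have bK := low_bounded ker_ball_low.
have bZ : bounded_op (point_eval G S c).
  by rewrite (point_evalE hres bS); exact: diag_bounded (bounded_comp bL bS).
exact: bounded_comp (bounded_sub (bounded_id R T) (bounded_comp bS (bounded_adj bZ))) bK.
Qed.

End PointEvaluation.

Lemma kernel_factorization (c d : 'I_q -> op R T) k : tree_ball G c -> tree_ball G d -> hset C2 k ->
  point_eval G (ker_schur G S d) c \o k =
  point_eval G (O (adjoint H C2 (fun F => point_eval G (O F) d) k)) c.
Proof.
move=> /ball_resolvent[L [M [r hc]]] /ball_resolvent[L' [M' [r' hd]]] hk.
rewrite (eval_adjoint hd hk); have [hKk _] := ker_ball_H2 hd hk.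
have bKS := ker_schur_bounded hd.
rewrite (point_evalE hc bKS) (eval_diag hc (O_in (OsH hKk))) -(ker_schurE hd hk).
by rewrite -(diag_constr (bounded_comp (res_bounded hc) bKS) (Cconst hk)).
Qed.

(** * The canonical model *)

Section CanonicalModel.
Hypothesis hAC : forall F, hset H F ->
  A F = (F - point_eval G F (fun=> 0)) \o U /\ C F = point_eval G F (fun=> 0).

Lemma canonical_state F : hset H F -> F = C F + (A F \o adj U).
Proof.
move=> hF; have [-> ->] := hAC hF; have hF2 := H_sub hF.
by rewrite (point_evalE (resolvent0 R G) (H2b hF2)); exact: (tailK hF2).
Qed.

(** The difference [O F - F] is shifted by one level at each step of the
    recursion, hence is zero. *)
Lemma canonical_observability F : hset H F -> O F = F.
Proof.
have hl n : forall X, hset H X -> low G n%:Z (O X - X).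
  elim: n => [|n IH] X hX.
    exact: low_sub (H2low (O_in hX)) (H2low (H_sub hX)).
  have -> : O X - X = (O (A X) - A X) \o adj U.
    rewrite {2}(canonical_state hX) (O_rec hX) opprD addrACA subrr add0r.
    by [].
  apply: low_weaken (low_comp (IH _ (AH hX)) lowUs); lia.
move=> hF; apply/eqP; rewrite -subr_eq0; apply/eqP.
by apply: (low_all_eq0 (G := G)) => n; exact: hl.
Qed.

Lemma inclusion_bounded : bounded_linear H H2 idfun.
Proof.
split; [exact: H_sub|by []|exists 1 => F hF].
by rewrite mul1r /= -{1}(canonical_observability hF); exact: O_norm.
Qed.

Lemma inclusion_adjoint : is_adjoint H H2 idfun Os.
Proof.
split; first by case: Os_adj.
by move=> F X hF hX; rewrite -(OsE hF hX) canonical_observability.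
Qed.

Lemma defect_Os X : hset H2 X -> defect G S X = Os X.
Proof.
by move=> hX; rewrite -[RHS](canonical_observability (OsH hX)) (observability_gram hX).
Qed.

Lemma sqrt_defect (P := sqrtop H2 (defect G S)) : [/\ bounded_linear H2 H2 P,
  forall X, hset H2 X -> 0 <= hdot H2 (P X) X &
  forall X, hset H2 X -> P (P X) = Os X].
Proof.
suff [bP P0 PP] : [/\ bounded_linear H2 H2 P,
    forall X, hset H2 X -> 0 <= hdot H2 (P X) X &
    forall X, hset H2 X -> P (P X) = defect G S X].
  by split; [exact: bP|exact: P0|move=> X hX; rewrite (PP _ hX) (defect_Os hX)].
rewrite /P /sqrtop; case: xgetP => [P' _ //|no]; exfalso.
have bMs := Ms_adj.1; have [_ Msl [MM hMM]] := bMs.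
have Ms_norm X : hset H2 X -> N2 (Ms X) <= N2 X.
  move=> hX; have hM := MsH hX; apply: le_of_sqr; first exact: hnorm_ge0.
  have [->|n0] := eqVneq (N2 (Ms X)) 0; first by rewrite expr0n exprn_ge0// hnorm_ge0.
  have np : 0 < N2 (Ms X) by rewrite lt_def n0; exact: hnorm_ge0.
  apply: sqr_le; first exact: hnorm_ge0.
  rewrite -(ler_pM2r np) -expr2 (hnorm_sqr h2 hM) -(MsE hM hX).
  apply: le_trans (ler_norm _) _; apply: le_trans (Re_le_normc _) _.
  apply: (le_trans (cauchy_schwarz h2 (SM hM).1 hX)); rewrite mulrC.
  by apply: ler_wpM2l; [exact: hnorm_ge0|exact: (SM hM).2].
have [|||P' [b1 b2 b3]] := @ex_sqrt R _ H2 h2 (fun X => S \o Ms X).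
- split; first by move=> X hX; exact: (SM (MsH hX)).1.
    move=> a X Y hX hY; rewrite (Msl _ _ _ hX hY); apply/funext => f.
    exact: (op_linear a (Ms X f) (Ms Y f) transfer_bounded).
  exists 1 => X hX; rewrite mul1r; exact: le_trans (SM (MsH hX)).2 (Ms_norm _ hX).
- move=> X hX; exact: le_trans (SM (MsH hX)).2 (Ms_norm _ hX).
- move=> X Y hX hY; have hMX := MsH hX; have hMY := MsH hY.
  rewrite (MsE hMX hY) (hdotC h2 (SM hMY).1 hX) (MsE hMY hX).
  by rewrite -(hdotC h2 hMY hMX).
by apply: (no P'); split.
Qed.

Lemma canonical_de_Branges_Rovnyak : is_deBranges_Rovnyak G S H.
Proof.
have [bP P0 PP] := sqrt_defect.
split; first exact: hH.
  exact: (range_sqrt hH h2 inclusion_bounded inclusion_adjoint bP P0 PP).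
move=> F hF.
rewrite (range_sqrt_norm hH h2 inclusion_bounded inclusion_adjoint bP P0 PP hF).
suff e : [set X | hset H2 X /\ defect G S X = 0] = [set X | hset H2 X /\ Os X = 0].
  by rewrite /ker_proj e.
apply/seteqP; split=> X [hX e]; split.
- exact: hX.
- by rewrite -(defect_Os hX).
- exact: hX.
by rewrite (defect_Os hX).
Qed.

End CanonicalModel.
End Realization.

Theorem theorem6p8 (R : realType) (q : nat) (hq : (1 <= q)%N) (T : choiceType)
    (G : shift_tree q T)
    (H : preHilbert (op R T : lmodType R[i]))
    (H_hilbert : is_hilbert H)
    (H_sub : hset H `<=` hset (H2 R G))
    (H_inv : right_invariant G H)
    (j : 'I_q)
    (A B C D : op R T -> op R T)
    (A_bounded : bounded_linear H H A)
    (B_bounded : bounded_linear (C2 R G) H B)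
    (C_bounded : bounded_linear H (C2 R G) C)
    (D_bounded : bounded_linear (C2 R G) (C2 R G) D)
    (V_bounded : bounded_linear (dsum H (C2 R G)) (dsum H (C2 R G))
                                (block A B C D))
    (A_mod : forall F c : op R T, hset H F -> constant_op G c ->
       A (F \o c) = A F \o adj (shift_op G j) \o c \o shift_op G j)
    (B_mod : forall d c : op R T, hset (C2 R G) d -> constant_op G c ->
       B (d \o c) = B d \o adj (shift_op G j) \o c \o shift_op G j)
    (C_mod : forall F c : op R T, hset H F -> constant_op G c ->
       C (F \o c) = C F \o c)
    (D_mod : forall d c : op R T, hset (C2 R G) d -> constant_op G c ->
       D (d \o c) = D d \o c)
    (VV : forall F d : op R T, hset H F -> hset (C2 R G) d ->
       block A B C D
         (adjoint (dsum H (C2 R G)) (dsum H (C2 R G)) (block A B C D) (F, d)) =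
       (F \o (adj (shift_op G j) \o shift_op G j), d)) :
  exists S : op R T,
    [/\ (* (I) *)
        [/\ schur_multiplier G S,
            forall w : seq 'I_q,
              unique (realization_coef G j A B C D w) (coef G S w)
          & pointwise_abs_series G (coef G S) S],
        (* (II) *)
        exists E : ('I_q -> op R T) -> op R T -> op R T,
          (forall c, tree_ball G c ->
             (forall F, hset H F ->
                abs_series_in (C2 R G) (eval_term G j A C c F) (E c F)) /\
             bounded_linear H (C2 R G) (E c)) /\
          (forall c d k, tree_ball G c -> tree_ball G d -> hset (C2 R G) k ->
             point_eval G (ker_schur G S d) c \o k =
             E c (adjoint H (C2 R G) (E d) k))
      & (* (III) *)
        (forall F, hset H F ->
           A F = (F - point_eval G F (fun=> 0)) \o shift_op G j /\
           C F = point_eval G F (fun=> 0)) ->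
        is_deBranges_Rovnyak G S H].
Proof.
pose S := transfer H_hilbert H_inv A_bounded B_bounded C_bounded D_bounded V_bounded
  A_mod B_mod C_mod D_mod VV.
pose obs_op := O H_hilbert H_inv A_bounded B_bounded C_bounded D_bounded V_bounded VV.
exists S; split; last exact: canonical_de_Branges_Rovnyak.
- split; first exact: transfer_schur.
    move=> w; have hw : realization_coef G j A B C D w (coef G S w) by exact: transfer_coef.
    by split=> // X; exact: realization_coef_unique hw.
  by apply: coef_series; apply/causalP; exact: transfer_low.
exists (fun (c : 'I_q -> op R T) F => point_eval G (obs_op F) c); split.
  move=> c /ball_resolvent[L [M [r hres]]]; split.
    by move=> F hF; exact: (eval_series _ _ _ _ _ _ _ _ hres hF).
  exact: (eval_bounded _ _ _ _ _ _ _ _ hres).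
by move=> c d k; exact: kernel_factorization.
Qed.
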